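(* Let $\mathfrak{T}$ be a polytopal tiling of $\mathbb{R}^d$ of (translational) finite local complexity. Then there is an isomorphism (pattern-equivariant Poincaré duality) $H^{\bullet}(\mathfrak{T}^1)\cong H_{d-\bullet}(\mathfrak{T}^1)$ between the pattern-equivariant cohomology and the pattern-equivariant homology of $\mathfrak{T}$; that is, $H^{k}(\mathfrak{T}^1)\cong H_{d-k}(\mathfrak{T}^1)$ for every $k$.
   Context: **Tilings.** A cellular tiling of $\mathbb{R}^d$ is a pair $\mathfrak{T}=(\mathcal{T},l)$, where $\mathcal{T}$ is a regular CW decomposition of $\mathbb{R}^d$ (attaching maps may be taken to be homeomorphisms) and $l$ is a labelling, i.e. a map from the cells of $\mathcal{T}$ to some set of labels. ''Cell'' means closed cell. The tiling is polytopal if its cells are convex polytopes. A tile is a $d$-cell. A patch is a finite subcomplex of $\mathcal{T}$ together with the restricted labelling; equality and equivalence of patches always respects the cell structure and the labels. $\mathfrak{T}$ has (translational) finite local complexity (FLC) if for every $r>0$ there are only finitely many patches of diameter at most $r$ up to translation. **Coronas.** The $0$-corona of a tile $t$ is the patch whose only tile is $t$; for $i\ge 1$ the $i$-corona of $t$ is the patch of tiles having non-empty intersection with the $(i-1)$-corona of $t$. The $i$-corona of a lower dimensional cell is the intersection of the $i$-coronas of the tiles containing it. Two cells $c_1,c_2$ have identical $i$-coronas up to translation if some translation takes $c_1$ to $c_2$ and the $i$-corona of $c_1$ to that of $c_2$. **PE cohomology and homology.** Let $C^\bullet(\mathcal{T})$ be the cellular cochain complex of $\mathcal{T}$ over $\mathbb{Z}$: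 a $k$-cochain $\psi$ assigns an integer to each oriented $k$-cell, with opposite values on opposite orientations. Let $C_\bullet^{\mathrm{BM}}(\mathcal{T})$ be the cellular Borel–Moore chain complex: a $k$-chain is a possibly infinite formal integer combination of oriented $k$-cells, with the usual cellular boundary maps extended linearly. Orient the cells so that translates of cells carry translated orientations. A $k$-cochain or Borel–Moore $k$-chain is pattern-equivariant (PE) if there is some $i\in\mathbb{N}_0$ such that any two $k$-cells with identical $i$-coronas up to translation have the same coefficient. PE cochains form a subcomplex $C^\bullet(\mathfrak{T}^1)$ of $C^\bullet(\mathcal{T})$, with cohomology $H^\bullet(\mathfrak{T}^1)$ (the PE cohomology). PE chains form a subcomplex $C_\bullet(\mathfrak{T}^1)$ of $C_\bullet^{\mathrm{BM}}(\mathcal{T})$, with homology $H_\bullet(\mathfrak{T}^1)$ (the PE homology). *)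

(* Defs.v *)
From HB Require Import structures.
From mathcomp Require Import all_boot all_order all_algebra ring_quotient lra.
From mathcomp Require Import boolp classical_sets functions cardinality.
From mathcomp Require Import fsbigop reals topology normedtype.

Set Implicit Arguments.
Unset Strict Implicit.
Unset Printing Implicit Defensive.

Import Order.TTheory GRing.Theory Num.Theory.
Import numFieldNormedType.Exports.
Local Open Scope classical_set_scope.
Local Open Scope ring_scope.

Section Subquotient.
Variables (M : zmodType) (Z B : zmodClosed M).

Record restricted := Restricted { rval : M; rvalP : rval \in Z }.
HB.instance Definition _ := [isSub for rval].
HB.instance Definition _ := [Choice of restricted by <:].
HB.instance Definition _ := [SubChoice_isSubZmodule of restricted by <:].

Definition restriction : {pred restricted} := fun z => val z \in B.

Lemma restriction_zmod_closed : zmod_closed restriction.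
Proof.
have E z : (z \in restriction) = (val z \in B) by [].
split=> [|x y]; rewrite !E; first by rewrite raddf0 rpred0.
by move=> xB yB; rewrite raddfB rpredB.
Qed.
HB.instance Definition _ :=
  GRing.isZmodClosed.Build restricted restriction restriction_zmod_closed.

(* Z / (Z `&` B) *)
Definition subquotient : zmodType := Quotient.quot restriction.
End Subquotient.

Section Geometry.
Context {R : realType} {d : nat}.
Local Notation V := 'rV[R]_d.
Implicit Types (c e f : set V) (x y v : V).

Definition hull n (p : 'I_n -> V) : set V :=
  [set x | exists w : 'I_n -> R,
     [/\ forall i, 0 <= w i, \sum_i w i = 1 & x = \sum_i w i *: p i]].

Definition polytope c := exists n (p : 'I_n.+1 -> V), c = hull p.

(* The row space of A is the linear span of the differences of points of c,
   i.e. the vector space parallel to the affine hull of c. *)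
Definition spans_differences c (A : 'M[R]_d) :=
  forall n (B : 'M[R]_(n, d)),
    (A <= B)%MS <-> (forall x y, c x -> c y -> (y - x <= B)%MS).

Definition direction c : 'M[R]_d := xget 0 [set A | spans_differences c A].

Definition dim c : nat := \rank (direction c).

(* The interior of c relative to its affine hull. *)
Definition relint c : set V :=
  [set x | c x /\ \forall y \near x, (y - x <= direction c)%MS -> c y].

Definition shift v c : set V := [set x + v | x in c].

Definition enorm v : R := Num.sqrt (\sum_i v 0 i ^+ 2).

Lemma spans_differences_exists c : exists A, spans_differences c A.
Proof.
pose p n := `[< exists B : 'M[R]_(n, d), row_free B /\
   forall i, exists x y, [/\ c x, c y & row i B = y - x] >].
have p0 : exists n, p n.
  exists 0%N; apply/asboolP; exists 0; split; last by case.
  by rewrite -row_leq_rank.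
have pd n : p n -> (n <= d)%N.
  by move=> /asboolP[B [+ _]]; rewrite -row_leq_rank => /leq_trans; apply; exact: rank_leq_col.
have [n /asboolP[B [Bfree Bc]] nmax] := ex_maxnP p0 pd.
exists <<B>>%MS => m C; rewrite genmxE; split=> [BC x y cx cy|sC].
  apply: submx_trans BC; apply: contraT => nB.
  have : (B < (y - x)%R + B)%MS.
    rewrite ltmxE addsmxSr /=; apply: contra nB => h.
    exact: submx_trans (addsmxSl _ _) h.
  move/rank_ltmx; rewrite (eqP Bfree) addsmxE => h.
  suff : p n.+1 by move/nmax; rewrite ltnn.
  apply/asboolP; exists (col_mx (y - x) B : 'M_(1 + n, d)); split.
    by rewrite -row_leq_rank.
  rewrite -[n.+1]/(1 + n)%N => i; have [j ->|j ->] := split_ordP i.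
    by exists x, y; rewrite rowKu; split=> //; rewrite [j]ord1 row_id.
  by rewrite rowKd; exact: Bc.
by apply/row_subP => i; have [x [y [cx cy ->]]] := Bc i; exact: sC.
Qed.

Lemma directionP c : spans_differences c (direction c).
Proof.
by rewrite /direction; case: xgetP => [A -> //|/=]; case: (spans_differences_exists c) => A + h => /h.
Qed.

Lemma sub_direction c x y : c x -> c y -> (y - x <= direction c)%MS.
Proof. by move: x y; apply/(directionP c). Qed.

Lemma near_mulmx_small m (M : 'M[R]_(d, m)) (b : V) (eta : R) : 0 < eta ->
  \forall y \near b, forall i, `|((y - b) *m M) 0 i| <= eta.
Proof.
move=> eta0.
pose K := 1 + \sum_i \sum_k `|M k i|.
have K0 : 0 < K by rewrite ltr_pwDl// sumr_ge0// => i _; rewrite sumr_ge0.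
have e0 : 0 < eta / K by rewrite divr_gt0.
apply/nbhs_ballP; exists (eta / K) => //= y byy i.
rewrite mxE (le_trans (ler_norm_sum _ _ _))//.
have : \sum_k `|M k i| <= K.
  rewrite /K (bigD1 i)//= addrCA lerDl addr_ge0// sumr_ge0// => j _.
  by rewrite sumr_ge0.
move=> sK; apply: (@le_trans _ _ (\sum_k eta / K * `|M k i|)).
  apply: ler_sum => k _; rewrite normrM ler_wpM2r//.
  have [_ /(_ 0 k)] := byy.
  by move=> h; rewrite !mxE distrC ltW.
by rewrite -mulr_sumr mulrAC ler_pdivrMr// ler_wpM2l// ltW.
Qed.

Lemma hull_combination n (p : 'I_n -> V) (b : V) (w : 'I_n -> R) :
  \sum_i w i = 0 -> \sum_i w i *: p i = \sum_i w i *: (p i - b).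
Proof.
move=> w0; under [RHS]eq_bigr do rewrite scalerBr.
by rewrite sumrB -scaler_suml w0 scale0r subr0.
Qed.

Lemma polytope_relint c : polytope c -> relint c !=set0.
Proof.
move=> [n [p ->]]; set H := hull p.
pose N : R := n.+1%:R^-1.
have N0 : 0 < N by rewrite invr_gt0 ltr0Sn.
have SN : \sum_(i < n.+1) N = 1.
  by rewrite sumr_const card_ord -[N *+ _]mulr_natl divff// pnatr_eq0.
pose b := \sum_i N *: p i.
pose P := \matrix_i (p i - b).
have Hb : H b by exists (fun=> N); split=> // i; exact: ltW.
have dP : (direction H <= P)%MS.
  apply/(directionP H) => x y [wx [_ sx ->]] [wy [_ sy ->]].
  rewrite -sumrB; under eq_bigr do rewrite -scalerBl.
  rewrite (hull_combination _ b) ?sumrB ?sx ?sy ?subrr//.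
  apply: summx_sub => i _; apply: scalemx_sub.
  by rewrite -[p i - b](rowK (fun i => p i - b)) row_sub.
exists b; split=> //.
have h2 : 0 < N / 2 by rewrite divr_gt0.
have := near_mulmx_small (pinvmx P) b h2.
apply: filterS => y hy yd.
have /mulmxKpV := submx_trans yd dP.
set u := _ *m pinvmx P; rewrite -/u in hy => uP.
exists (fun i => N + u 0 i - (\sum_j u 0 j) * N); split.
- move=> i; have : (\sum_j u 0 j) * N <= N / 2.
    have : \sum_j u 0 j <= \sum_(j < n.+1) N / 2.
      by apply: ler_sum => j _; exact: le_trans (ler_norm _) (hy j).
    rewrite -mulr_suml SN mul1r => h; rewrite mulrC; exact: ler_wpM2l (ltW N0) _ _ h.
  have := hy i; rewrite ler_norml => /andP[h1 _]; lra.
- by rewrite sumrB big_split/= SN -mulr_sumr SN mulr1 addrK.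
- have sp0 : \sum_i (p i - b) = 0.
    rewrite sumrB sumr_const card_ord -scaler_nat /b -scaler_sumr scalerA.
    by rewrite divff ?pnatr_eq0// scale1r subrr.
  transitivity (b + \sum_i (u 0 i - (\sum_j u 0 j) * N) *: (p i - b)).
    under eq_bigr do rewrite scalerBl.
    rewrite sumrB -scaler_sumr sp0 scaler0 subr0 -[LHS](subrK b) addrC.
    rewrite -uP mulmx_sum_row; congr (_ + _).
    by apply: eq_bigr => i _; rewrite rowK.
  have w0 : \sum_i (u 0 i - (\sum_j u 0 j) * N) = 0.
    by rewrite sumrB -mulr_sumr SN mulr1 subrr.
  rewrite -(hull_combination p b w0) -big_split/=.
  by apply: eq_bigr => i _; rewrite -scalerDl addrA.
Qed.

Lemma hull_convex n (p : 'I_n -> V) (x y : V) (t : R) : 0 <= t -> t <= 1 ->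
  hull p x -> hull p y -> hull p ((1 - t) *: x + t *: y).
Proof.
move=> t0 t1 [wx [x0 sx ->]] [wy [y0 sy ->]].
exists (fun i => (1 - t) * wx i + t * wy i); split.
- by move=> i; rewrite addr_ge0// mulr_ge0// subr_ge0.
- by rewrite big_split/= -!mulr_sumr sx sy !mulr1 subrK.
- rewrite !scaler_sumr -big_split/=; apply: eq_bigr => i _.
  by rewrite [RHS]scalerDl !scalerA.
Qed.

Lemma relint_segment c x y (t : R) : polytope c -> c x -> relint c y ->
  0 < t -> t <= 1 -> relint c ((1 - t) *: x + t *: y).
Proof.
move=> [n [p ->]] cx [cy ny] t0 t1; set z := _ + _.
have cz : hull p z by apply: hull_convex => //; exact: ltW.
split=> //.
have /nbhs_ballP[e /= e0 be] := ny.
have et0 : 0 < e * t by rewrite mulr_gt0.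
apply/nbhs_ballP; exists (e * t) => //= w bw wd.
have -> : w = (1 - t) *: x + t *: (y + t^-1 *: (w - z)).
  rewrite scalerDr scalerA divff ?gt_eqF// scale1r addrA -/z.
  by rewrite addrC subrK.
apply: hull_convex => //; first exact: ltW.
apply: be.
  rewrite mx_norm_ball /ball_ /= opprD addrA subrr sub0r normrN normrZ.
  rewrite ger0_norm ?invr_ge0 ?ltW// mulrC ltr_pdivrMr// distrC.
  by move: bw; rewrite mx_norm_ball.
by rewrite addrAC subrr add0r scalemx_sub.
Qed.

Lemma relint_near c x (e : R) : polytope c -> c x -> 0 < e ->
  exists2 y, relint c y & ball x e y.
Proof.
move=> pc cx e0; have [y ry] := polytope_relint pc.
pose N := `|y - x| + e.
have N0 : 0 < N by rewrite ltr_wpDl.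
have t0 : 0 < e / N / 2 by rewrite !divr_gt0.
set t := e / N / 2 in t0 *.
have tN : t * N < e by rewrite /t mulrAC divfK ?gt_eqF//; lra.
exists ((1 - t) *: x + t *: y).
  apply: relint_segment => //; rewrite -(ler_pM2r N0) mul1r (le_trans (ltW tN))//.
  by rewrite lerDr.
rewrite mx_norm_ball /ball_ /= scalerBl scale1r -addrA opprD addrA subrr sub0r.
rewrite addrC -scalerBr normrN normrZ gtr0_norm//.
apply: le_lt_trans tN; apply: ler_wpM2l; first exact: ltW.
by rewrite lerDl ltW.
Qed.

Lemma shiftK v : cancel (shift v) (shift (- v)).
Proof.
move=> c; apply/seteqP; split=> [_ [_ [x cx <-] <-]|x cx]; first by rewrite addrK.
by exists (x + v); [exists x|rewrite addrK].
Qed.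

Lemma shiftNK v : cancel (shift (- v)) (shift v).
Proof. by move=> c; have := shiftK (- v) c; rewrite opprK. Qed.

Lemma direction_shift v c : (direction (shift v c) <= direction c)%MS.
Proof.
apply/directionP => _ _ [x cx <-] [y cy <-].
by rewrite opprD addrACA subrr addr0 sub_direction.
Qed.

Lemma dim_shift v c : dim (shift v c) = dim c.
Proof.
apply/eqP; rewrite eqn_leq (mxrankS (direction_shift v c)).
by have := mxrankS (direction_shift (- v) (shift v c)); rewrite shiftK.
Qed.

End Geometry.

(* A regular CW decomposition of R^d all of whose closed cells are convex
   polytopes, with a labelling of its cells.  A convex polytope c is
   homeomorphic to a closed ball of dimension dim c, by a map which takes the
   open ball to relint c; so the open cells are the sets relint c.  Values of
   label outside cells are irrelevant. *)
Record polytopal_tiling (R : realType) (d : nat) (L : Type) := PolytopalTiling {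
  cells : set (set 'rV[R]_d);
  label : set 'rV[R]_d -> L;
  cells_polytope : forall c, cells c -> polytope c;
  cells_partition : forall x, exists! c, cells c /\ relint c x;
  cells_boundary : forall c, cells c -> exists2 F : set (set 'rV[R]_d),
    finite_set F /\ (forall e, F e -> cells e /\ (dim e < dim c)%N) &
    c `\` relint c = \bigcup_(e in F) e;
  cells_weak_topology : forall A : set 'rV[R]_d,
    (forall c, cells c -> closed (A `&` c)) -> closed A
}.

Section Tiling.
Context {R : realType} {d : nat} {L : Type} (T : polytopal_tiling R d L).
Local Notation V := 'rV[R]_d.
Implicit Types (c e f t : set V) (P Q : set (set V)) (v : V).

Definition tile t := cells T t /\ dim t = d.

Definition patch P :=
  [/\ finite_set P, P `<=` cells T &
      forall c e, P c -> cells T e -> e `<=` c -> P e].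

Definition carrier P : set V := \bigcup_(c in P) c.

Definition diameter_le (r : R) P :=
  forall x y, carrier P x -> carrier P y -> enorm (x - y) <= r.

Definition translates v P Q :=
  Q = [set shift v c | c in P] /\ forall c, P c -> label T (shift v c) = label T c.

Definition FLC := forall r : R, 0 < r ->
  exists F : set (set (set V)),
    [/\ finite_set F, (forall P, F P -> patch P /\ diameter_le r P) &
        forall P, patch P -> diameter_le r P ->
          exists2 Q, F Q & exists v, translates v Q P].

Fixpoint tile_corona (i : nat) t : set (set V) :=
  match i with
  | 0 => [set e | cells T e /\ e `<=` t]
  | j.+1 => [set e | cells T e /\ exists s,
      [/\ tile s, e `<=` s & s `&` carrier (tile_corona j t) !=set0]]
  end.

(* If c is a tile then c is the only tile containing c, and this is
   tile_corona i c. *)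
Definition corona (i : nat) c : set (set V) :=
  [set e | cells T e /\ forall t, tile t -> c `<=` t -> tile_corona i t e].

Definition identical_coronas (i : nat) c1 c2 :=
  exists v, c2 = shift v c1 /\ translates v (corona i c1) (corona i c2).

(* Degrees are integers, so that all groups of degree outside 0..d vanish. *)
Definition cell_of_dim (k : int) c := cells T c /\ (dim c)%:Z = k.

(* Once an orientation of the cells is fixed, both a k-cochain and a
   Borel-Moore k-chain are given by an integer coefficient for each k-cell;
   psi c is the coefficient of c if c is a k-cell, and 0 otherwise. *)
Definition is_pe_chain (k : int) (psi : set V -> int) :=
  (forall c, ~ cell_of_dim k c -> psi c = 0) /\
  exists i : nat, forall c1 c2, cell_of_dim k c1 -> cell_of_dim k c2 ->
    identical_coronas i c1 c2 -> psi c1 = psi c2.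

Definition facet f c :=
  [/\ cells T f, cells T c, f `<=` c & dim c = (dim f).+1].

(* An orientation of an m-cell c is represented by an ordered basis
   (the rows of frame m c) of its direction space; only the sign of a change
   of basis matters.  The basis of a vertex is empty, so that vertices are
   positively oriented. *)
Record orientation := Orientation {
  frame : forall m : nat, set V -> 'M[R]_(m, d);
  frame_basis : forall c, cells T c -> (frame (dim c) c :=: direction c)%MS;
  frame_translate : forall c v, cells T c -> cells T (shift v c) ->
    0 < \det (frame (dim c) (shift v c) *m pinvmx (frame (dim c) c))
}.

Variable o : orientation.

(* Incidence number of a facet f of c: the sign of the basis (outward vector,
   frame of f) relative to the frame of c.  The sign does not depend on the
   points chosen in f and in the relative interior of c. *)
Definition incidence c f : int :=
  sgz (\det (col_mx (xget 0 f - xget 0 (relint c)) (frame o (dim f) f)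
             *m pinvmx (frame o (1 + dim f) c))).

(* The index sets of both sums are finite: finite_facets, finite_cofacets. *)
Definition coboundary (psi : set V -> int) (c : set V) : int :=
  \sum_(f \in [set f | facet f c]) incidence c f * psi f.

Definition boundary (chi : set V -> int) (f : set V) : int :=
  \sum_(c \in [set c | facet f c]) incidence c f * chi c.

Lemma relint_inj e f x : cells T e -> cells T f -> relint e x -> relint f x -> e = f.
Proof.
move=> ce cf re rf; have [c [_ u]] := cells_partition T x.
by rewrite -(u e)// (u f).
Qed.

Lemma finite_open_cells c : cells T c ->
  finite_set [set e | cells T e /\ relint e `&` c !=set0].
Proof.
have [n] := ubnP (dim c); elim: n c => // n IH c /ltnSE cn cc.
have [F [finF Fc] bdF] := cells_boundary cc.
apply: (@sub_finite_set _ _ ([set c] `|` \bigcup_(f in F)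
    [set e | cells T e /\ relint e `&` f !=set0])).
  move=> e [ce [x [ex cx]]]; have [rx|nrx] := pselect (relint c x).
    by left; exact: relint_inj ce cc ex rx.
  have : (c `\` relint c) x by [].
  by rewrite bdF => -[f Ff fx]; right; exists f => //; split=> //; exists x.
rewrite finite_setU; split; first exact: finite_set1.
apply: bigcup_finite => // f /Fc[cf fc]; apply: IH => //.
exact: leq_trans fc cn.
Qed.

Lemma finite_faces c : cells T c -> finite_set [set e | cells T e /\ e `<=` c].
Proof.
move=> /finite_open_cells; apply: sub_finite_set => e [ce ec]; split=> //.
have [x xe] := polytope_relint (cells_polytope ce).
by exists x; split=> //; apply: ec; case: xe.
Qed.

Lemma finite_star x : finite_set [set c | cells T c /\ c x].
Proof.
have [c0 [[cc0 rx0] _]] := cells_partition T x.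
pose S := [set c | [/\ cells T c, c x & ~ relint c x]].
suff finS : finite_set S.
  apply: (@sub_finite_set _ _ ([set c0] `|` S)); last by rewrite finite_setU.
  move=> c [cc cx]; have [rx|nrx] := pselect (relint c x); last by right.
  by left; exact: relint_inj cc cc0 rx rx0.
apply: contrapT => /infiniteP/pcard_leP/unsquash f.
have fS n : S (f n) by exact: funS.
have finj : injective f by move=> m n; apply: (@inj _ _ setT); rewrite ?inE.
have /choice[y yP] : forall n, exists y,
    relint (f n) y /\ ball x (n.+1%:R^-1 : R) y.
  move=> n; have [cf fx _] := fS n.
  have [|y ry bxy] := @relint_near _ _ (f n) x n.+1%:R^-1 (cells_polytope cf) fx.
    by rewrite invr_gt0 ltr0Sn.
  by exists y.
have clA : closed (range y).
  apply: (@cells_weak_topology _ _ _ T) => c cc.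
  have /accessible_finite_set_closed : accessible_space V.
    by apply: hausdorff_accessible; exact: norm_hausdorff.
  apply.
  apply: (@sub_finite_set _ _ (y @` (f @^-1`
      [set e | cells T e /\ relint e `&` c !=set0]))).
    move=> _ [[n _ <-] cy]; exists n => //=; have [cf _ _] := fS n.
    by split=> //; exists (y n); split=> //; case: (yP n).
  apply/finite_image/finite_preimage; last exact: finite_open_cells.
  by move=> m n _ _; exact: finj.
have /clA[n _ ynx] : closure (range y) x.
  move=> B /nbhs_ballP[e /= e0 eB].
  have [n ne] : exists n : nat, n.+1%:R^-1 < e.
    exists (Num.truncn e^-1); rewrite invf_plt ?posrE ?ltr0Sn//.
    exact: truncnS_gt.
  exists (y n); split; first by exists n.
  by apply/eB/(le_ball (ltW ne)); case: (yP n).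
by have [_ _] := fS n; apply; rewrite -ynx; case: (yP n).
Qed.

Lemma finite_facets c : finite_set [set f | facet f c].
Proof.
have [cc|ncc] := pselect (cells T c).
  by apply: sub_finite_set (finite_faces cc) => f [].
by rewrite (_ : [set _ | _] = set0)// -subset0 => f [].
Qed.

Lemma finite_cofacets f : finite_set [set c | facet f c].
Proof.
have [cf|ncf] := pselect (cells T f); last first.
  by rewrite (_ : [set _ | _] = set0)// -subset0 => c [].
have [x [fx _]] := polytope_relint (cells_polytope cf).
apply: sub_finite_set (finite_star x) => c [_ cc fc _]; split=> //.
exact: fc.
Qed.

Lemma coboundary0 c : coboundary 0 c = 0.
Proof. by apply: fsbig1 => f _; rewrite mulr0. Qed.

Lemma boundary0 f : boundary 0 f = 0.
Proof. by apply: fsbig1 => c _; rewrite mulr0. Qed.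

Lemma coboundaryB psi phi c :
  coboundary (psi - phi) c = coboundary psi c - coboundary phi c.
Proof.
rewrite /coboundary !(fsbig_finite _ _ (finite_facets c))/= -sumrB.
by apply: eq_bigr => f _; rewrite -mulrBr.
Qed.

Lemma boundaryB psi phi f :
  boundary (psi - phi) f = boundary psi f - boundary phi f.
Proof.
rewrite /boundary !(fsbig_finite _ _ (finite_cofacets f))/= -sumrB.
by apply: eq_bigr => c _; rewrite -mulrBr.
Qed.

Lemma carrierS P Q : P `<=` Q -> carrier P `<=` carrier Q.
Proof. by move=> PQ x [c Pc cx]; exists c => //; exact: PQ. Qed.

Lemma cell_nonempty c : cells T c -> c !=set0.
Proof.
by move=> cc; have [x [cx _]] := polytope_relint (cells_polytope cc); exists x.
Qed.

Lemma tile_corona_cells i t : tile_corona i t `<=` cells T.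
Proof. by case: i => [|i] e []. Qed.

Lemma tile_coronaS i t t' : tile t -> tile t' -> t `&` t' !=set0 ->
  tile_corona i t `<=` tile_corona i.+1 t'.
Proof.
move=> tt tt' tt'0; elim: i => [|i IH] e /= [ce].
  move=> et; split=> //; exists t; split=> //.
  have [x [tx t'x]] := tt'0; exists x; split=> //.
  by exists t' => //=; split=> //; case: tt'.
move=> [s [ts es [x [sx xi]]]]; split=> //; exists s; split=> //.
by exists x; split=> //; exact: carrierS IH _ xi.
Qed.

Lemma tile_corona_le i j t : tile t -> (i <= j)%N ->
  tile_corona i t `<=` tile_corona j t.
Proof.
move=> tt /subnK <-; elim: (j - i)%N => // n IH.
apply: subset_trans IH _; apply: tile_coronaS => //.
by rewrite setIid; apply: cell_nonempty; case: tt.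
Qed.

Lemma tile_corona_id i t : tile t -> tile_corona i t t.
Proof.
move=> tt; apply: (tile_corona_le tt (leq0n i)).
by split=> //; case: tt.
Qed.

Lemma tile_corona_sub_corona i c t : cells T c -> tile t -> c `<=` t ->
  tile_corona i t `<=` corona i.+1 c.
Proof.
move=> cc tt ct e ei; split; first exact: tile_corona_cells ei.
move=> t' tt' ct'; apply: (@tile_coronaS i t) ei => //.
by have [x cx] := cell_nonempty cc; exists x; split; [exact: ct|exact: ct'].
Qed.

Lemma corona_le i j c : (i <= j)%N -> corona i c `<=` corona j c.
Proof.
move=> ij e [ce ei]; split=> // t tt ct.
by apply: (tile_corona_le tt ij); exact: ei.
Qed.

Lemma translates_sym v P Q : translates v P Q -> translates (- v) Q P.
Proof.
move=> [-> lP]; split.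
  apply/seteqP; split=> [c Pc|_ [_ [e Pe <-] <-]]; last by rewrite shiftK.
  by exists (shift v c); [exists c|rewrite shiftK].
by move=> _ [c Pc <-]; rewrite shiftK lP.
Qed.

Section IdenticalCoronas.
Variables (i : nat) (v : V) (c1 c2 : set V).
Hypotheses (cell1 : cells T c1) (c12 : c2 = shift v c1).
Hypothesis tr : translates v (corona i.+1 c1) (corona i.+1 c2).

Lemma shift_corona_cells e : corona i.+1 c1 e -> cells T (shift v e).
Proof. by move=> e1; have : corona i.+1 c2 (shift v e); [rewrite tr.1; exists e|case]. Qed.

Lemma shift_tile s : tile s -> corona i.+1 c1 s -> tile (shift v s).
Proof.
by move=> [cs ds] s1; split; [exact: shift_corona_cells|rewrite dim_shift].
Qed.

Lemma shift_tile_corona t : tile t -> c1 `<=` t ->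
  [/\ tile (shift v t), c2 `<=` shift v t &
      forall j e, (j <= i)%N -> tile_corona j t e ->
        tile_corona j (shift v t) (shift v e)].
Proof.
move=> tt c1t; have sub := tile_corona_sub_corona cell1 tt c1t.
split.
- by apply: shift_tile => //; apply: (sub i); exact: tile_corona_id.
- by rewrite c12; exact: image_subset.
elim=> [|j IH] e ji ej.
  split; last by apply: image_subset; case: ej.
  by apply/shift_corona_cells/(sub i)/(tile_corona_le tt ji).
have ce : cells T (shift v e).
  by apply/shift_corona_cells/(sub i)/(tile_corona_le tt ji).
case: ej => ce' [s [ts es [x [sx [g gj gx]]]]].
have js : tile_corona j.+1 t s.
  by split; [case: ts|exists s; split=> //; exists x; split=> //; exists g].
split=> //; exists (shift v s); split.
- by apply: shift_tile => //; apply/(sub i)/(tile_corona_le tt ji).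
- exact: image_subset.
- exists (x + v); split; first by exists x.
  by exists (shift v g); [apply: IH => //; exact: ltnW|exists x].
Qed.

End IdenticalCoronas.

Lemma shift_corona i v c1 c2 e : cells T c1 -> cells T c2 -> c2 = shift v c1 ->
  translates v (corona i.+1 c1) (corona i.+1 c2) ->
  corona i c1 e -> corona i c2 (shift v e).
Proof.
move=> cc1 cc2 c12 tr e1; split.
  by apply: (shift_corona_cells tr); exact: corona_le e1.
move=> t tt c2t; have c21 : c1 = shift (- v) c2 by rewrite c12 shiftK.
have [tt1 c1t _] := shift_tile_corona cc2 c21 (translates_sym tr) tt c2t.
have [_ _] := shift_tile_corona cc1 c12 tr tt1 c1t.
by move=> /(_ i e (leqnn i)); rewrite shiftNK; apply; apply: e1.2.
Qed.

Lemma identical_coronasS i c1 c2 : cells T c1 -> cells T c2 ->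
  identical_coronas i.+1 c1 c2 -> identical_coronas i c1 c2.
Proof.
move=> cc1 cc2 [v [c12 tr]]; exists v; split=> //; split; last first.
  by move=> c c1i; apply: tr.2; exact: corona_le c1i.
have c21 : c1 = shift (- v) c2 by rewrite c12 shiftK.
apply/seteqP; split=> [e e2|_ [e e1 <-]]; last exact: shift_corona tr e1.
exists (shift (- v) e); last by rewrite shiftNK.
exact: shift_corona (translates_sym tr) e2.
Qed.

Lemma identical_coronas_le i j c1 c2 : cells T c1 -> cells T c2 -> (i <= j)%N ->
  identical_coronas j c1 c2 -> identical_coronas i c1 c2.
Proof.
move=> cc1 cc2 /subnK <-; elim: (j - i)%N => // n IH /identical_coronasS h.
by apply: IH; exact: h.
Qed.

(* PE cochains and PE chains of degree k, relative to the orientation. *)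
Definition pe_chains k : {pred set V -> int} := fun psi => `[< is_pe_chain k psi >].

Lemma pe_chains_zmod_closed k : zmod_closed (pe_chains k).
Proof.
split=> [|phi psi /asboolP[phi0 [i phii]] /asboolP[psi0 [j psij]]].
  by apply/asboolP; split=> //; exists 0%N.
apply/asboolP; split=> [c nc|].
  by rewrite [LHS]/(phi c - psi c) phi0// psi0// subrr.
exists (maxn i j) => c1 c2 kc1 kc2 eq12.
have [cc1 cc2] : cells T c1 /\ cells T c2 by case: kc1; case: kc2.
rewrite [LHS]/(phi c1 - psi c1) [RHS]/(phi c2 - psi c2).
rewrite (phii c1 c2)// 1?(psij c1 c2)//.
  by apply: identical_coronas_le eq12 => //; exact: leq_maxr.
by apply: identical_coronas_le eq12 => //; exact: leq_maxl.
Qed.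
HB.instance Definition _ k := GRing.isZmodClosed.Build (set V -> int)
  (pe_chains k) (pe_chains_zmod_closed k).

Definition pe_cocycles k : {pred set V -> int} := fun psi =>
  `[< psi \in pe_chains k /\ forall c, coboundary psi c = 0 >].

Definition pe_coboundaries k : {pred set V -> int} := fun psi =>
  `[< exists2 phi, phi \in pe_chains (k - 1) & psi = coboundary phi >].

Definition pe_cycles k : {pred set V -> int} := fun chi =>
  `[< chi \in pe_chains k /\ forall f, boundary chi f = 0 >].

Definition pe_boundaries k : {pred set V -> int} := fun chi =>
  `[< exists2 phi, phi \in pe_chains (k + 1) & chi = boundary phi >].

Lemma pe_cocycles_zmod_closed k : zmod_closed (pe_cocycles k).
Proof.
split=> [|phi psi /asboolP[phiP dphi] /asboolP[psiP dpsi]]; apply/asboolP.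
  by split=> [|c]; [exact: rpred0|exact: coboundary0].
by split=> [|c]; [exact: rpredB|rewrite coboundaryB dphi dpsi subrr].
Qed.
HB.instance Definition _ k := GRing.isZmodClosed.Build (set V -> int)
  (pe_cocycles k) (pe_cocycles_zmod_closed k).

Lemma pe_coboundaries_zmod_closed k : zmod_closed (pe_coboundaries k).
Proof.
split=> [|_ _ /asboolP[phi phiP ->] /asboolP[psi psiP ->]]; apply/asboolP.
  by exists 0; [exact: rpred0|apply/funext => c; rewrite coboundary0].
exists (phi - psi); first exact: rpredB.
by apply/funext => c; rewrite coboundaryB.
Qed.
HB.instance Definition _ k := GRing.isZmodClosed.Build (set V -> int)
  (pe_coboundaries k) (pe_coboundaries_zmod_closed k).

Lemma pe_cycles_zmod_closed k : zmod_closed (pe_cycles k).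
Proof.
split=> [|phi psi /asboolP[phiP dphi] /asboolP[psiP dpsi]]; apply/asboolP.
  by split=> [|c]; [exact: rpred0|exact: boundary0].
by split=> [|c]; [exact: rpredB|rewrite boundaryB dphi dpsi subrr].
Qed.
HB.instance Definition _ k := GRing.isZmodClosed.Build (set V -> int)
  (pe_cycles k) (pe_cycles_zmod_closed k).

Lemma pe_boundaries_zmod_closed k : zmod_closed (pe_boundaries k).
Proof.
split=> [|_ _ /asboolP[phi phiP ->] /asboolP[psi psiP ->]]; apply/asboolP.
  by exists 0; [exact: rpred0|apply/funext => c; rewrite boundary0].
exists (phi - psi); first exact: rpredB.
by apply/funext => c; rewrite boundaryB.
Qed.
HB.instance Definition _ k := GRing.isZmodClosed.Build (set V -> int)
  (pe_boundaries k) (pe_boundaries_zmod_closed k).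

Definition pe_cohomology (k : int) : zmodType :=
  subquotient (pe_cocycles k) (pe_coboundaries k).

Definition pe_homology (k : int) : zmodType :=
  subquotient (pe_cycles k) (pe_boundaries k).

End Tiling.

(* Main.v *)
(* Integer functions x(c, e) of pairs of cells with c contained in e form a
   double complex, the coboundary acting on c and the boundary on e.  A cochain
   psi defines the function psi(c) sigma(e), where sigma is the fundamental
   class of R^d, and a chain chi defines the function which is chi(e) if c is a
   vertex.  For fixed e, the coboundary is exact, since the faces of e form a
   ball; for fixed c, the cells containing c have the Borel-Moore homology of
   R^d.  These are statements about one cell, so primitives can be chosen
   compatibly with all local translations of the tiling, and they stay
   pattern-equivariant.  Hence both cohomology and homology are those of the
   pattern-equivariant total complex.

   Both kinds of local exactness follow from one contraction.  Let finitely
   many polytopes partition an open convex set U.  Intersection numbers with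
   simplices on generic points pair the cellular chains with simplicial
   cochains; the barycentric dual cells, perturbed to be generic, provide a
   left inverse of this pairing, and coning simplices off a base point gives
   the contraction.  For the cells containing c, take U to be a small ball
   around a point of the relative interior of c.  For the faces of e, take U
   to be the relative interior of e, partitioned by the pyramids on the proper
   faces of e with a common apex b in U and by b itself. *)

From HB Require Import structures.
From mathcomp Require Import all_boot all_order all_algebra ring_quotient generic_quotient finmap zify ring lra.
From mathcomp Require Import boolp classical_sets functions cardinality.
From mathcomp Require Import fsbigop reals topology normedtype.
Require Import Defs.

Set Implicit Arguments.
Unset Strict Implicit.
Unset Printing Implicit Defensive.

Import Order.TTheory GRing.Theory Num.Theory.
Import numFieldNormedType.Exports.
Local Open Scope classical_set_scope.
Local Open Scope ring_scope.

(** * Determinants of lists of row vectors *)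

(** Everything rests on one sign computation. Where the dimensions of a generic simplex and of a
    cell exceed the complementary ones by one, they meet in a segment or not at all. Each end of the
    segment lies on a facet of the cell or of the simplex, and the two ends count with opposite
    signs; this makes intersection numbers compatible with boundaries. Genericity is linear
    independence modulo the directions of cells, reached by moving points along moment curves, and
    determinants in homogeneous coordinates carry the orientations. The obstacle to equivariance is
    that exactness gives primitives without a canonical choice. A primitive is therefore chosen for
    the cell moved so that its [anchor] lies at the origin. Passing between incident cells costs two
    coronas, and since dimensions are at most [d], the elimination in the double complex takes
    boundedly many steps, so the radius stays finite. Elimination goes down in the dimension of [c]
    to reach chains, and up to reach cochains. As primitives are chosen, the duality is first a
    relation between cocycles and cycles, and becomes a map only on classes. *)

Section ListDeterminant.
Context {F : fieldType}.

(** Lists let rows be inserted and deleted without casts between matrix sizes. Missing rows are read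
    as 0 and surplus rows are ignored. *)
Definition detl q (s : seq 'rV[F]_q) : F := \det (\matrix_(i < q) s`_i).

Definition rows m q (A : 'M[F]_(m, q)) : seq 'rV[F]_q := [seq row i A | i <- enum 'I_m].

Lemma size_rows m q (A : 'M[F]_(m, q)) : size (rows A) = m.
Proof. by rewrite size_map size_enum_ord. Qed.

Lemma nth_rows m q (A : 'M[F]_(m, q)) (i : 'I_m) : (rows A)`_i = row i A.
Proof. by rewrite (nth_map i) ?size_enum_ord// nth_ord_enum. Qed.

Lemma detl_linear q (l1 l2 : seq 'rV[F]_q) a u v : (size l1 < q)%N ->
  detl (l1 ++ (a *: u + v) :: l2) = a * detl (l1 ++ u :: l2) + detl (l1 ++ v :: l2).
Proof.
move=> sq; rewrite -[detl (l1 ++ v :: l2)]mul1r.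
apply: (determinant_multilinear (i0 := Ordinal sq)).
- by rewrite !rowK /= !nth_cat ltnn subnn /= scale1r.
- apply/matrixP => i j; rewrite !mxE !nth_cat.
  case: ltnP => // h; case E: (lift _ _ - _)%N => [|k] //=.
  by move: h E; rewrite /= /bump; lia.
- apply/matrixP => i j; rewrite !mxE !nth_cat.
  case: ltnP => // h; case E: (lift _ _ - _)%N => [|k] //=.
  by move: h E; rewrite /= /bump; lia.
Qed.

Lemma detl_eq0P q (s : seq 'rV[F]_q) :
  reflect (exists2 r : 'I_q -> F, exists i, r i != 0 & \sum_i r i *: s`_i = 0)
    (detl s == 0).
Proof.
apply: (iffP (@det0P F q _)) => [[v v0 vA]|[r [i ri] rs]].
  exists (v 0); last by rewrite -[RHS]vA mulmx_sum_row; apply: eq_bigr => i _; rewrite rowK.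
  by case/rV0Pn: v0 => i; exists i.
exists (\row_i r i); first by apply/rV0Pn; exists i; rewrite mxE.
by rewrite mulmx_sum_row -[RHS]rs; apply: eq_bigr => j _; rewrite rowK mxE.
Qed.

(* The maximal minors of a matrix with one row too many are proportional to
   the coefficients of the linear relation between its rows. *)
Lemma detl_relation q (s : seq 'rV[F]_q) (r : nat -> F) (i j : nat) :
  (i <= q)%N -> (j <= q)%N -> \sum_(k < q.+1) r k *: s`_k = 0 ->
  r j * ((-1) ^+ i * detl (take i s ++ drop i.+1 s)) =
  r i * ((-1) ^+ j * detl (take j s ++ drop j.+1 s)).
Proof.
move=> iq' jq' rs; have [iq jq] : (i < q.+1)%N /\ (j < q.+1)%N by [].
set oi := Ordinal iq; set oj := Ordinal jq.
(* Bordering the rows by the indicator column of [i] turns the minors into cofactors of that column.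
   The product of the coefficients [r] with [A] has the single entry [r i], and multiplying by the
   adjugate gives the proportion. *)
pose A : 'M[F]_q.+1 := \matrix_(a, b)
  if unlift ord0 b is Some b' then s`_a 0 b' else (a == oi)%:R.
have cof a : cofactor A a ord0 = (-1) ^+ a * detl (take a s ++ drop a.+1 s).
  rewrite /cofactor addn0; congr (_ * \det _); apply/matrixP => x y.
  rewrite !mxE liftK nth_cat size_take; congr ((_ : 'rV_q) 0 y).
  have [as_|as_] := ltnP a (size s); rewrite /= /bump.
    have [xa|xa] := ltnP x a; first by rewrite add0n nth_take.
    by rewrite nth_drop add1n addSn subnKC.
  have [xs|xs] := ltnP x (size s).
    by rewrite take_oversize// leqNgt (leq_trans xs as_).
  by rewrite !nth_default ?size_drop//; [rewrite (eqP (_ : size s - a.+1 == 0)%N)// subn_eq0; exact: leq_trans as_ (leqnSn _)|exact: leq_trans xs (leq_addl _ _)].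
have rA : (\row_k r k) *m A = \row_b (if b == ord0 then r i else 0).
  apply/rowP => b; rewrite !mxE; case: (unliftP ord0 b) => [b'|] ->.
    rewrite (_ : lift _ _ == _ = false) ?eqE//=.
    have := congr1 (fun M : 'rV_q => M 0 b') rs; rewrite summxE mxE => sb.
    by rewrite -[RHS]sb; apply: eq_bigr => k _; rewrite !mxE liftK.
  rewrite eqxx (bigD1 oi)//= big1 ?addr0 => [|k /negbTE ki]; rewrite !mxE unlift_none.
    by rewrite eqxx mulr1.
  by rewrite ki mulr0.
have := congr1 (fun M => M *m \adj A) rA; rewrite -mulmxA mul_mx_adj mul_mx_scalar.
move=> /(congr1 (fun M : 'rV_q.+1 => M 0 oj)); rewrite !mxE (bigD1 ord0)//= big1 => [|b /negbTE b0]; last first.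
  by rewrite !mxE b0 mul0r.
rewrite !mxE eqxx addr0 cof => <-; rewrite mulrC; congr (_ * _).
rewrite (expand_det_col A ord0) (bigD1 oi)//= big1 ?addr0 => [|k /negbTE ki].
  by rewrite !mxE unlift_none eqxx mul1r cof.
by rewrite !mxE unlift_none ki mul0r.
Qed.

Lemma detl_dependent q (l s : seq 'rV[F]_q) (a : nat -> F) :
  (size l + (size s).+1)%N = q ->
  detl (l ++ (\sum_(k < size s) a k *: s`_k) :: s) = 0.
Proof.
move=> sz; apply/eqP/detl_eq0P.
pose r k := if (k < size l)%N then 0 else if k == size l then 1 else - a (k - (size l).+1)%N.
have lq : (size l < q)%N by move: sz; lia.
have Eq : index_iota 0 q = index_iota 0 (size l + (size s).+1) by rewrite /index_iota sz.
exists (fun i : 'I_q => r i); first by exists (Ordinal lq); rewrite /r ltnn eqxx oner_neq0.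
rewrite -(big_mkord xpredT (fun i => r i *: (l ++ _ :: s)`_i)) Eq.
rewrite (@big_cat_nat _ _ _ (size l)) ?leq_addr//= big_nat big1 ?add0r; last first.
  by move=> i /andP[_ il]; rewrite /r il scale0r.
rewrite -{1}[size l]add0n big_addn addKn big_mkord big_ord_recl.
rewrite /r add0n ltnn eqxx scale1r nth_cat ltnn subnn /= -big_split/= big1// => k _.
have [-> -> ->] : [/\ (bump 0 k + size l < size l)%N = false,
    (bump 0 k + size l == size l)%N = false & (bump 0 k + size l - (size l).+1 = k)%N].
  by rewrite /bump; split; lia.
rewrite nth_cat (_ : (bump 0 k + size l < size l)%N = false) ?addnK; last by rewrite /bump; lia.
by rewrite /= scaleNr subrr.
Qed.

Lemma detl_rows_mul q (l : seq 'rV[F]_q) m (A : 'M[F]_m) (G : 'M[F]_(m, q)) :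
  (size l + m)%N = q -> detl (l ++ rows (A *m G)) = \det A * detl (l ++ rows G).
Proof.
move Ek : (size l) => k sq; subst q.
have E (H : 'M_(m, k + m)) : \matrix_(i < k + m) (l ++ rows H)`_i =
    col_mx (\matrix_(i < k) l`_i) H.
  apply/row_matrixP => i; rewrite rowK nth_cat.
  case: (split_ordP i) => j -> /=.
    by rewrite Ek ltn_ord rowKu rowK.
  by rewrite Ek ltnNge leq_addr /= addKn nth_rows rowKd.
rewrite /detl !E.
have -> : col_mx (\matrix_(i < k) l`_i) (A *m G) =
    block_mx 1%:M 0 0 A *m col_mx (\matrix_(i < k) l`_i) G.
  by rewrite mul_block_col !mul1mx !mul0mx addr0 add0r.
by rewrite det_mulmx det_ublock det1 mul1r.
Qed.

End ListDeterminant.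

(** * Polytopes *)

Section Polytopes.
Context {R : realType} {d : nat}.
Local Notation V := 'rV[R]_d.
Implicit Types (c e f : set V) (x y z v w : V).

Lemma hull_compact n (p : 'I_n -> V) : compact (hull p).
Proof.
pose S := [set w : 'rV[R]_n | (forall i, 0 <= w 0 i) /\ \sum_i w 0 i = 1].
have -> : hull p = (fun w : 'rV[R]_n => \sum_i w 0 i *: p i) @` S.
  apply/seteqP; split=> [x [w [w0 w1 ->]]|_ [w [w0 w1] <-]].
    exists (\row_i w i); last by apply: eq_bigr => i _; rewrite mxE.
    by split=> [i|]; [rewrite mxE|rewrite -[RHS]w1; apply: eq_bigr => i _; rewrite mxE].
  by exists (w 0).
apply: continuous_compact.
  apply: continuous_subspaceT; apply: continuous_big => [|i _ w]; first exact: add_continuous.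
  have h := @coord_continuous R 1 n 0 i w.
  exact: (continuous_comp h (@scalel_continuous _ _ (p i) _)).
apply: bounded_closed_compact.
  exists 1; split=> // M M1 w [w0 w1].
  rewrite /Num.norm/= mx_normrE; apply/bigmax_leP; split=> [|[i j] _]; first lra.
  rewrite ord1/= ger0_norm//; apply: le_trans (ltW M1).
  by rewrite -w1 (bigD1 j)//= lerDl sumr_ge0.
have -> : S = (\bigcap_i [set w : 'rV[R]_n | 0 <= w 0 i]) `&`
    [set w : 'rV[R]_n | \sum_i w 0 i = 1].
  by apply/seteqP; split=> w [w0 w1]; split=> //= i; [move=> _; exact: w0|exact: w0].
apply: closedI.
  apply: closed_bigI => i _.
  by apply: (preimage_closed _ (@closed_ge R 0)) => w _; exact: (@coord_continuous R 1 n 0 i w).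
apply: (preimage_closed _ (@closed_eq R 1)) => w _.
apply: (@continuous_big _ _ _ 0 xpredT _ _ _ (fun i (w : 'rV[R]_n) => w 0 i)) => [|i _].
  exact: add_continuous.
exact: coord_continuous.
Qed.

Lemma polytope_compact c : polytope c -> compact c.
Proof. by move=> [n [p ->]]; exact: hull_compact. Qed.

Lemma polytope_closed c : polytope c -> closed c.
Proof. by move/polytope_compact/compact_closed; apply; exact: norm_hausdorff. Qed.

Lemma polytope_bounded c : polytope c -> exists K : R, forall x, c x -> `|x| <= K.
Proof.
move/polytope_compact/compact_bounded => [K [_ Kc]]; exists (K + 1) => x cx.
by apply: Kc cx; rewrite ltrDl.
Qed.

Lemma polytope_convex c x y (t : R) : polytope c -> 0 <= t -> t <= 1 ->
  c x -> c y -> c ((1 - t) *: x + t *: y).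
Proof. by move=> [n [p ->]]; exact: hull_convex. Qed.

Lemma normB_ball x y (e : R) : ball x e y = (`|x - y| < e) :> Prop.
Proof. by rewrite mx_norm_ball. Qed.

Lemma relint_nbhd c x : relint c x -> exists2 e : R, 0 < e &
  forall y, `|x - y| < e -> (y - x <= direction c)%MS -> relint c y.
Proof.
move=> [cx /nbhs_ballP[e /= e0 be]]; exists e => // y xy yd.
split; first by apply: be yd; rewrite normB_ball.
apply/nbhs_ballP; exists (e - `|x - y|); rewrite /= ?subr_gt0// => z.
rewrite normB_ball => yz zd; apply: be.
  rewrite normB_ball (_ : x - z = (x - y) + (y - z)); last by rewrite addrA subrK.
  by rewrite (le_lt_trans (ler_normD _ _))// addrC -ltrBrDr.
have -> : z - x = (z - y) + (y - x) by rewrite addrA subrK.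
exact: addmx_sub.
Qed.

Lemma relint_move c x w : relint c x -> (w <= direction c)%MS ->
  exists2 e : R, 0 < e & forall t, `|t| <= e -> relint c (x + t *: w).
Proof.
move=> /relint_nbhd[e e0 ec] wd; have w1 : 0 < `|w| + 1 by rewrite ltr_wpDl.
exists (e / (`|w| + 1)); first by rewrite divr_gt0.
move=> t te; apply: ec; last by rewrite addrC addKr scalemx_sub.
rewrite opprD addrA subrr sub0r normrN normrZ.
apply: (@le_lt_trans _ _ (e / (`|w| + 1) * `|w|)); first exact: ler_wpM2r.
by rewrite mulrAC ltr_pdivrMr// ltr_pM2l// ltrDl.
Qed.

Lemma relint_extend c x y (t : R) : polytope c -> relint c y -> 0 < t ->
  c (x + t *: (x - y)) -> relint c x.
Proof.
move=> pc ry t0 cz; have t1 : 0 < 1 + t by lra.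
have -> : x = (1 - t / (1 + t)) *: (x + t *: (x - y)) + (t / (1 + t)) *: y.
  by apply/rowP => i; rewrite !mxE; field; rewrite gt_eqF.
apply: relint_segment => //; first by rewrite divr_gt0.
by rewrite ler_pdivrMr// mul1r lerDr.
Qed.

Lemma direction_sub c e : c `<=` e -> (direction c <= direction e)%MS.
Proof. by move=> ce; apply/directionP => x y cx cy; apply: sub_direction; exact: ce. Qed.

Lemma dim_le c e : c `<=` e -> (dim c <= dim e)%N.
Proof. by move=> ce; apply: mxrankS; exact: direction_sub. Qed.

Lemma dim_max c : (dim c <= d)%N.
Proof. exact: rank_leq_col. Qed.

Lemma direction_eq c e : c `<=` e -> (dim e <= dim c)%N ->
  (direction e <= direction c)%MS.
Proof. by move=> ce ec; have [_ <-] := mxrank_leqif_sup (direction_sub ce); rewrite eqn_leq ec dim_le. Qed.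

Lemma relint_sub_dim c e x : polytope c -> polytope e -> c `<=` e ->
  (dim e <= dim c)%N -> relint c x -> relint e x.
Proof.
move=> pc pe ce ec rx; have [y ry] := polytope_relint pe.
have xy : (x - y <= direction c)%MS.
  apply: submx_trans (direction_eq ce ec); apply: sub_direction; first by case: ry.
  by apply: ce; case: rx.
have [t t0 tc] := relint_move rx xy; apply: (relint_extend pe ry t0).
by apply/ce; case: (tc t); rewrite ?gtr0_norm.
Qed.

(** Otherwise one could move from [z] away from [y] inside [f], hence inside [c], and
    [relint_extend] would put [z] into the relative interior of [c]. *)
Lemma relint_transversal f c x y z : polytope c -> f `<=` c ->
  relint f z -> ~ relint c z -> f x -> relint c y -> ~ (y - x <= direction f)%MS.
Proof.
move=> pc fc rz nrc fx ry yx.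
have zy : (z - y <= direction f)%MS.
  rewrite (_ : z - y = (z - x) - (y - x)); last by rewrite opprB addrA subrK.
  by rewrite addmx_sub ?eqmx_opp// sub_direction//; case: rz.
have [t t0 tc] := relint_move rz zy.
apply: nrc; apply: (relint_extend pc ry t0).
by apply/fc; case: (tc t); rewrite ?gtr0_norm.
Qed.

Lemma direction_split f c u w : f `<=` c -> dim c = (dim f).+1 ->
  (u <= direction c)%MS -> ~ (u <= direction f)%MS -> (w <= direction c)%MS ->
  exists (t : R) w', w = t *: u + w' /\ (w' <= direction f)%MS.
Proof.
move=> fc cf uc nuf wc.
have sub : (u + direction f <= direction c)%MS.
  by rewrite addsmx_sub uc direction_sub.
have lt : (direction f < u + direction f)%MS.
  by rewrite ltmxE addsmxSr; apply/negP => /(submx_trans (addsmxSl _ _)).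
have [_ /esym] := mxrank_leqif_sup sub.
rewrite eqn_leq (mxrankS sub) [X in (X <= _)%N]cf (rank_ltmx lt) => cu.
have /sub_addsmxP[[p q] /= ->] := submx_trans wc cu.
exists (p 0 0), (q *m direction f); split; last exact: submxMl.
by rewrite {1}(mx11_scalar p) mul_scalar_mx.
Qed.

Lemma closed_line c x w (t : R) : closed c -> ~ c (x + t *: w) ->
  exists2 e : R, 0 < e & forall s, `|s - t| < e -> ~ c (x + s *: w).
Proof.
move=> clc nc; have := open_subball (closed_openC clc) nc => -[e /= e0 be].
have w1 : 0 < `|w| + 1 by rewrite ltr_wpDl.
have e20 : 0 < e / 2 by rewrite divr_gt0.
exists (e / 2 / (`|w| + 1)); first by rewrite divr_gt0.
move=> s st; apply: (be (e / 2)) => //.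
  by rewrite /ball_/= sub0r normrN gtr0_norm//; lra.
rewrite normB_ball opprD addrACA subrr add0r -scalerBl normrZ distrC.
apply: (@le_lt_trans _ _ (e / 2 / (`|w| + 1) * `|w|)); first by rewrite ler_wpM2r// ltW.
by rewrite mulrAC ltr_pdivrMr// ltr_pM2l// ltrDl.
Qed.

(** The last hypothesis says that the complement of [P] is open, so the supremum is attained. *)
Lemma closed_max (P : R -> Prop) (K : R) : (exists t, P t) ->
  (forall t, P t -> t <= K) ->
  (forall t, ~ P t -> exists2 e : R, 0 < e & forall s, `|s - t| < e -> ~ P s) ->
  exists2 t, P t & forall s, P s -> s <= t.
Proof.
move=> [t0 P0] PK clP; pose A : set R := [set t | P t].
have hs : has_sup A by split; [exists t0|exists K => t /PK].
exists (sup A); last by move=> s Ps; apply: sup_upper_bound.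
apply: contrapT => /clP[e e0 nP].
have [s As es] := sup_adherent e0 hs.
apply: (nP s) => //; rewrite distrC ger0_norm; first by rewrite ltrBlDl -ltrBlDr.
by rewrite subr_ge0; apply: sup_upper_bound.
Qed.

Lemma relint_exit c y z : polytope c -> relint c y -> ~ c z ->
  (z - y <= direction c)%MS ->
  exists t : R, [/\ 0 < t, t < 1, c (y + t *: (z - y)) & ~ relint c (y + t *: (z - y))].
Proof.
move=> pc ry ncz zy.
pose P (t : R) := 0 <= t <= 1 /\ c (y + t *: (z - y)).
have [||t Pt|t [/andP[t0 t1] ct] tmax] := @closed_max P 1.
- by exists 0; rewrite /P scale0r addr0 lexx ler01; split=> //; case: ry.
- by move=> t [/andP[]].
- have [nct|] := pselect (~ c (y + t *: (z - y))).
    have [e e0 ne] := closed_line (polytope_closed pc) nct.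
    by exists e => // s st [_ cs]; exact: (ne s).
  move=> /contrapT ct; have nt : ~~ (0 <= t <= 1) by apply/negP => ?; apply: Pt.
  have [t0|t0] := ltP t 0.
    exists (- t); first by rewrite oppr_gt0.
    by move=> s; rewrite ltr_norml => st [/andP[s0 _] _]; lra.
  have t1 : 1 < t by move: nt; rewrite t0/= -ltNge.
  exists (t - 1); first by rewrite subr_gt0.
  by move=> s; rewrite ltr_norml => st [/andP[_ s1] _]; lra.
have t1' : t < 1.
  rewrite lt_neqAle t1 andbT; apply/eqP => te; apply: ncz.
  by move: ct; rewrite te scale1r addrC subrK.
have nr : ~ relint c (y + t *: (z - y)).
  move=> rt; have [e e0 ec] := relint_move rt zy.
  pose s := Num.min e (1 - t).
  have s0 : 0 < s by rewrite lt_min e0 subr_gt0.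
  have : t + s <= t; last by lra.
  apply: tmax; split.
    have : s <= 1 - t by rewrite ge_min lexx orbT.
    by lra.
  rewrite scalerDl addrA; case: (ec s) => //.
  by rewrite gtr0_norm// ge_min lexx.
exists t; split=> //; rewrite lt_neqAle t0 andbT eq_sym; apply/eqP => te.
by apply: nr; rewrite te scale0r addr0.
Qed.

Lemma compact_separation (K Y : set V) : compact K -> closed Y ->
  (forall x, K x -> ~ Y x) ->
  exists2 e : R, 0 < e & forall x y, K x -> `|x - y| < e -> ~ Y y.
Proof.
move=> cK cY KY.
have /compact_near_coveringP ncK := cK.
have := ncK R (0^'+) (fun (e : R) (x : V) => forall y : V, `|x - y| < e -> ~ Y y) _.
case=> [x Kx|e e0 eK].
  have [e /= e0 be] := open_subball (closed_openC cY) (KY x Kx).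
  have e20 : 0 < e / 2 by rewrite divr_gt0.
  have e40 : 0 < e / 4 by rewrite divr_gt0.
  exists ([set x' | `|x - x'| < e / 4], [set e' | e' < e / 4]).
    split => /=.
      by apply/nbhs_ballP; exists (e / 4) => // x'; rewrite normB_ball.
    exact: nbhs_right_lt.
  move=> [x' e'] /= [xx' ee'] y x'y.
  apply: (be (e / 2)) => //; first by rewrite /ball_/= sub0r normrN gtr0_norm//; lra.
  rewrite normB_ball (_ : x - y = (x - x') + (x' - y)); last by rewrite addrA subrK.
  by rewrite (le_lt_trans (ler_normD _ _))//; lra.
pose e' := e / 2; have e'0 : 0 < e' by rewrite divr_gt0.
exists e' => // x y Kx xy; apply: (eK e' _ _ x Kx y xy) => //=.
by rewrite sub0r normrN gtr0_norm// /e' ltr_pdivrMr// mulr_natr mulr2n ltrDl.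
Qed.

Lemma nonroot_near0 (p : {poly R}) (e : R) : p != 0 -> 0 < e ->
  exists t, [/\ 0 < t, t < e & p.[t] != 0].
Proof.
move=> p0 e0; apply: contrapT => np.
pose f (i : nat) : R := e / i.+2%:R.
have f0 i : 0 < f i by rewrite divr_gt0.
have fe i : f i < e by rewrite ltr_pdivrMr// ltr_pMr// ltr1n.
have := @max_poly_roots _ p [seq f i | i <- iota 0 (size p)] p0.
rewrite size_map size_iota ltnn => h; apply: notF; apply: h.
  apply/allP => _ /mapP[i _ ->]; apply: contrapT => /negP nr; apply: np.
  by exists (f i); split=> //; rewrite -rootE.
rewrite map_inj_uniq ?iota_uniq// => i j /(mulfI (lt0r_neq0 e0))/invr_inj/eqP.
by rewrite eqr_nat => /eqP[].
Qed.

(** The point is taken on a moment curve with velocities the rows of [E]. For each flat, a linear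
    form that vanishes on its direction but not on all of [E] becomes a nonzero polynomial in the
    parameter, so finitely many flats exclude finitely many parameters. *)
Lemma avoid_flats n (E : 'M[R]_(n, d)) (s : seq (V * 'M[R]_d)) x (e : R) :
  0 < e -> (forall p, p \in s -> ~~ (E <= p.2)%MS) ->
  exists y, [/\ `|x - y| < e, (y - x <= E)%MS &
                forall p, p \in s -> ~~ (y - p.1 <= p.2)%MS].
Proof.
move=> e0 Es.
pose K := \sum_(l < n) `|row l E|; have K0 : 0 <= K by rewrite sumr_ge0.
pose curve (t : R) := x + \sum_(l < n) t ^+ l.+1 *: row l E.
have /choice[Q Qp] : forall p : V * 'M[R]_d, exists Q : {poly R}, p \in s ->
    Q != 0 /\ forall t, Q.[t] != 0 -> ~~ (curve t - p.1 <= p.2)%MS.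
  move=> p; have [ps|] := boolP (p \in s); last by exists 0.
  have := Es p ps; rewrite submxE => /eqP/matrixP h.
  have [i [j ij]] : exists i j, (E *m cokermx p.2) i j != 0.
    apply: contrapT => nij; apply: h => i j; rewrite [RHS]mxE; apply: contrapT => /eqP ij.
    by apply: nij; exists i, j.
  pose phi := col j (cokermx p.2).
  pose c0 := ((x - p.1) *m phi) 0 0.
  exists (c0%:P + 'X * \poly_(l < n) (if insub l is Some l' then (row l' E *m phi) 0 0 else 0)) => _.
  split.
    apply/eqP => /(congr1 (fun q : {poly R} => q`_i.+1)).
    rewrite coefD coefC coefXM/= add0r coef_poly ltn_ord coef0 valK => /eqP.
    by rewrite /phi colE mulmxA -colE mxE -row_mul mxE (negbTE ij).
  move=> t; apply: contraNN => /submxP[D CD].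
  have : ((curve t - p.1) *m phi) 0 0 = 0.
    by rewrite CD /phi colE mulmxA -(mulmxA D) mulmx_coker mulmx0 mul0mx mxE.
  rewrite /curve addrAC mulmxDl mxE -/c0 => h0.
  rewrite hornerD hornerC hornerM hornerX -[X in _ == X]h0; apply/eqP; congr (_ + _).
  rewrite mulmx_suml summxE horner_poly mulr_sumr; apply: eq_bigr => l _.
  by rewrite valK -scalemxAl [RHS]mxE exprS mulrCA mulrC.
pose P := \prod_(p <- s) Q p.
have P0 : P != 0 by rewrite prodf_seq_neq0; apply/allP => p /Qp[].
have K1 : 0 < K + 1 by rewrite ltr_wpDl.
have eK : 0 < Num.min 1 (e / (K + 1)) by rewrite lt_min ltr01 divr_gt0.
have [t [t0]] := nonroot_near0 P0 eK; rewrite lt_min => /andP[t1 te] Pt.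
exists (curve t); split.
- rewrite /curve opprD addrA subrr sub0r normrN.
  apply: (@le_lt_trans _ _ (t * K)); last first.
    by move: te; rewrite ltr_pdivlMr//; apply: le_lt_trans; rewrite ler_pM2l// lerDl.
  rewrite (le_trans (ler_norm_sum _ _ _))// mulr_sumr ler_sum// => l _.
  rewrite normrZ ler_wpM2r// ger0_norm ?exprn_ge0 ?(ltW t0)// exprS.
  by rewrite ler_piMr ?(ltW t0)// exprn_ile1 ?(ltW t0) ?(ltW t1).
- by rewrite /curve addrC addKr summx_sub// => l _; rewrite scalemx_sub// row_sub.
- move=> p ps; have [_] := Qp p ps; apply; apply: contraNN Pt => /eqP Qt.
  by rewrite horner_prod prodf_seq_eq0; apply/hasP; exists p => //=; rewrite Qt.
Qed.

End Polytopes.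

(** * Local complexes and intersection numbers *)

Section Homogeneous.
Context {R : realType} {N n : nat}.
Variable E : 'M[R]_(n, N).
Local Notation V := 'rV[R]_N.

(** Homogeneous coordinates in the basis [E], with leading entry 0 for vectors and 1 for points.
    Affine relations between points become linear ones, so a single determinant compares a simplex
    with the frame of a cell. Only differences of points are expected in the row space of [E]. *)
Definition hvec (v : V) : 'rV[R]_(1 + n) := row_mx 0 (v *m pinvmx E).
Definition hpt (v : V) : 'rV[R]_(1 + n) := row_mx 1%:M (v *m pinvmx E).

Lemma hvec_linear a u v : hvec (a *: u + v) = a *: hvec u + hvec v.
Proof. by rewrite /hvec scale_row_mx add_row_mx scaler0 addr0 mulmxDl scalemxAl. Qed.

Lemma hvecD u v : hvec (u + v) = hvec u + hvec v.
Proof. by rewrite -[u]scale1r hvec_linear !scale1r. Qed.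

Lemma hvec_sum (J : Type) (s : seq J) (a : J -> R) (v : J -> V) :
  hvec (\sum_(j <- s) a j *: v j) = \sum_(j <- s) a j *: hvec (v j).
Proof.
elim: s => [|j s IH]; first by rewrite !big_nil /hvec mul0mx row_mx0.
by rewrite !big_cons hvec_linear IH.
Qed.

Lemma hpt_sum (J : Type) (s : seq J) (a : J -> R) (v : J -> V) :
  \sum_(j <- s) a j = 0 ->
  \sum_(j <- s) a j *: hpt (v j) = hvec (\sum_(j <- s) a j *: v j).
Proof.
move=> a0; rewrite hvec_sum; apply/eqP; rewrite -subr_eq0 -sumrB; apply/eqP.
under eq_bigr do rewrite -scalerBr opp_row_mx add_row_mx subr0 subrr.
by rewrite -scaler_suml a0 scale0r.
Qed.

Lemma hvec_eq0 v : (v <= E)%MS -> hvec v = 0 -> v = 0.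
Proof.
move=> vE /(congr1 rsubmx); rewrite row_mxKr => v0.
by rewrite -(mulmxKpV vE) v0 linear0 mul0mx.
Qed.

End Homogeneous.

(* A finite family of polytopes whose relative interiors partition a convex
   set U that is open in a translate of the row space of E.  The orientation
   is given by frames and enters only through the sign rule lc_incidence. *)
Record local_complex (R : realType) (N n : nat) (E : 'M[R]_(n, N))
    (U : set 'rV[R]_N) (I : finType) (X : I -> set 'rV[R]_N)
    (Fr : I -> seq 'rV[R]_N) (inc : I -> I -> int) : Prop := LocalComplex {
  lc_free : row_free E;
  lc_convex : forall x y t, 0 <= t -> t <= 1 -> U x -> U y ->
    U ((1 - t) *: x + t *: y);
  lc_open : forall x, U x -> exists2 e : R, 0 < e &
    forall y, `|x - y| < e -> (y - x <= E)%MS -> U y;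
  lc_span : forall x y, U x -> U y -> (y - x <= E)%MS;
  lc_polytope : forall i, polytope (X i);
  lc_meet : forall i, exists x, U x /\ X i x;
  lc_direction : forall i, (direction (X i) <= E)%MS;
  lc_disjoint : forall i j x, U x -> relint (X i) x -> relint (X j) x -> i = j;
  lc_cover : forall x, U x -> exists i, relint (X i) x;
  lc_face : forall i j x, U x -> relint (X i) x -> X j x -> X i `<=` X j;
  lc_frame_size : forall i, size (Fr i) = dim (X i);
  lc_frame_sub : forall i v, v \in Fr i -> (v <= direction (X i))%MS;
  lc_frame_span : forall i v, (v <= direction (X i))%MS ->
    exists a : nat -> R, v = \sum_(k < dim (X i)) a k *: (Fr i)`_k;
  lc_frame_free : forall i (a : nat -> R),
    \sum_(k < dim (X i)) a k *: (Fr i)`_k = 0 ->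
    forall k, (k < dim (X i))%N -> a k = 0;
  lc_incidence0 : forall f g, ~ (X f `<=` X g /\ dim (X g) = (dim (X f)).+1) ->
    inc g f = 0;
  lc_incidence_sqr : forall f g, X f `<=` X g -> dim (X g) = (dim (X f)).+1 ->
    inc g f * inc g f = 1;
  lc_incidence : forall f g x y (l : seq 'rV[R]_(1 + n)),
    X f `<=` X g -> dim (X g) = (dim (X f)).+1 ->
    X f x -> relint (X g) y -> (size l + dim (X g))%N = n.+1 ->
    sgz (detl (l ++ hvec E (x - y) :: map (hvec E) (Fr f))) =
    inc g f * sgz (detl (l ++ map (hvec E) (Fr g)))
}.

Section LocalComplexTheory.
Context {R : realType} {N n : nat} {E : 'M[R]_(n, N)} {U : set 'rV[R]_N}.
Context {I : finType} {X : I -> set 'rV[R]_N}.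
Context {Fr : I -> seq 'rV[R]_N} {inc : I -> I -> int}.
Hypothesis LC : local_complex E U X Fr inc.
Local Notation V := 'rV[R]_N.
Local Notation hv := (hvec E).
Local Notation hp := (hpt E).
Local Notation m i := (dim (X i)).

Definition lfacet f g := X f `<=` X g /\ m g = (m f).+1.

Lemma dim_lc i : (m i <= n)%N.
Proof. by have := mxrankS (lc_direction LC i); rewrite (eqP (lc_free LC)). Qed.

Lemma lc_face_dim f g x : U x -> relint (X f) x -> X g x -> f <> g ->
  (m f < m g)%N.
Proof.
move=> Ux rf gx fg; have sfg := lc_face LC Ux rf gx.
rewrite ltn_neqAle dim_le// andbT; apply/eqP => e; apply: fg.
apply: (lc_disjoint LC Ux rf); apply: relint_sub_dim rf => //; try exact: lc_polytope LC _.
by rewrite e.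
Qed.

Section Points.
Context {J : eqType}.
Variable pt : J -> V.
Implicit Types (l A Z : seq J) (a b mu : J -> R).

Definition comb a l := \sum_(j <- l) a j *: pt j.

Definition weights a l := (forall j, j \in l -> 0 <= a j) /\ \sum_(j <- l) a j = 1.

(** The points of [A], seen from a point of the cell, are independent modulo its direction. In
    particular the affine span of [A] misses that of [X f] as soon as the dimensions [size A - 1]
    and [m f] add up to less than [n]. *)
Definition generic l := forall f x A a, X f x -> uniq A -> {subset A <= l} ->
  (size A + m f <= n)%N -> ((\sum_(j <- A) a j *: (pt j - x))%R <= direction (X f))%MS ->
  forall j, j \in A -> a j = 0.

Definition orient l f := detl (map (hp \o pt) l ++ map hv (Fr f)).

Definition meets l f := exists a, weights a l /\ X f (comb a l).

(* The intersection number of the simplex spanned by the points of l with the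
   cell f; it is meaningful only for generic points. *)
Definition crossing l f : int :=
  if (size l + m f == n.+1)%N && `[< meets l f >] then sgz (orient l f) else 0.

Lemma combE a l : comb a l = \sum_(j <- l) a j *: pt j. Proof. by []. Qed.

Lemma crossingE l f : crossing l f =
  if (size l + m f == n.+1)%N && `[< meets l f >] then sgz (orient l f) else 0.
Proof. by []. Qed.

Lemma comb_line a b l (t : R) : comb (fun j => a j + t * b j) l = comb a l + t *: comb b l.
Proof.
rewrite /comb scaler_sumr -big_split/=; apply: eq_bigr => j _.
by rewrite scalerDl scalerA.
Qed.

Lemma sum_line a b l (t : R) :
  \sum_(j <- l) (a j + t * b j) = \sum_(j <- l) a j + t * \sum_(j <- l) b j.
Proof. by rewrite big_split/= mulr_sumr. Qed.

Lemma comb_eq a b l : {in l, a =1 b} -> comb a l = comb b l.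
Proof. by move=> ab; apply: eq_big_seq => j jl; rewrite ab. Qed.

Lemma comb_sub a l x : \sum_(j <- l) a j *: (pt j - x) = comb a l - (\sum_(j <- l) a j) *: x.
Proof.
by under eq_bigr do rewrite scalerBr; rewrite sumrB -scaler_suml.
Qed.

Lemma convex_comb (C : set V) a l :
  (forall x y t, 0 <= t -> t <= 1 -> C x -> C y -> C ((1 - t) *: x + t *: y)) ->
  (forall j, j \in l -> C (pt j)) -> weights a l -> C (comb a l).
Proof.
move=> convC; elim: l a => [|j l IH] a Cl [a0 a1].
  by move: a1; rewrite big_nil => /esym/eqP; rewrite oner_eq0.
have aj0 : 0 <= a j by apply: a0; rewrite mem_head.
have al i : i \in l -> 0 <= a i by move=> il; apply: a0; rewrite inE il orbT.
have Cj : C (pt j) by apply: Cl; rewrite mem_head.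
pose t := \sum_(i <- l) a i.
have t0 : 0 <= t by rewrite /t big_seq sumr_ge0.
have ajt : a j = 1 - t by rewrite -a1 big_cons addrK.
rewrite /comb big_cons ajt.
have [te0|tn0] := eqVneq t 0.
  rewrite te0 subr0 scale1r big_seq big1 ?addr0// => i il.
  have : a i <= t.
    rewrite /t (big_rem i)//= lerDl big_seq sumr_ge0// => k /mem_rem; exact: al.
  by rewrite te0 => ai; rewrite (_ : a i = 0) ?scale0r//; apply/eqP; rewrite eq_le ai al.
have -> : \sum_(i <- l) a i *: pt i = t *: comb (fun i => a i / t) l.
  rewrite /comb scaler_sumr; apply: eq_bigr => i _.
  by rewrite scalerA mulrCA divff// mulr1.
apply: convC => //; first by rewrite -subr_ge0 -ajt.
apply: IH => [i il|]; first by apply: Cl; rewrite inE il orbT.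
split; first by move=> i il; rewrite divr_ge0// al.
by rewrite -mulr_suml divff.
Qed.

Lemma weightsS a A l : uniq A -> uniq l -> {subset A <= l} -> weights a A ->
  weights (fun j => if j \in A then a j else 0) l /\
  comb (fun j => if j \in A then a j else 0) l = comb a A.
Proof.
move=> uA ul Al [a0 a1].
have E0 (T : nmodType) (F : J -> T) :
    \sum_(j <- l) (if j \in A then F j else 0) = \sum_(j <- A) F j.
  rewrite -big_mkcond/= -big_filter; apply: perm_big; apply: uniq_perm => //.
    exact: filter_uniq.
  by move=> j; rewrite mem_filter; case: (boolP (j \in A)) => // /Al ->.
split; last first.
  rewrite /comb -[RHS]E0; apply: eq_bigr => j _; case: ifP => // _.
  by rewrite scale0r.
by split=> [j _|]; [case: ifP => // /a0|rewrite E0].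
Qed.

(** An index whose coefficient is known to vanish buys one dimension: it is dropped from the list
    before genericity is applied. *)
Lemma generic_zeros l f x a Z : generic l -> uniq l -> X f x ->
  ((\sum_(j <- l) a j *: (pt j - x))%R <= direction (X f))%MS ->
  uniq Z -> {subset Z <= l} -> (forall j, j \in Z -> a j = 0) ->
  (size l + m f <= n + size Z)%N -> forall j, j \in l -> a j = 0.
Proof.
move=> gl ul fx rel uZ Zl a0 sz.
pose A := [seq j <- l | j \notin Z].
have sA : (size A + size Z = size l)%N.
  rewrite -(count_predC (mem Z) l) addnC size_filter; congr (_ + _)%N.
  rewrite -size_filter; apply/perm_size/uniq_perm => //; first exact: filter_uniq.
  by move=> j; rewrite mem_filter/=; case: (boolP (j \in Z)) => // /Zl ->.
have aA j : j \in A -> a j = 0.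
  apply: (gl f x) => //; first exact: filter_uniq.
  - by move=> k; rewrite mem_filter => /andP[].
  - by lia.
  - move: rel; rewrite (bigID (mem Z))/= big1 ?add0r; first by rewrite big_filter.
    by move=> k kZ; rewrite a0// scale0r.
move=> j jl; have [/a0//|jZ] := boolP (j \in Z).
by apply: aA; rewrite mem_filter jZ.
Qed.

(** There is one row too many, so [detl_relation] applies. The first conclusion compares the
    deletion of two points, the second the deletion of a point with that of the leading vector of
    [s]. *)
Lemma relation_minors l (s : seq 'rV[R]_(1 + n)) mu (nu : nat -> R) :
  uniq l -> (size l + size s)%N = n.+2 ->
  \sum_(j <- l) mu j *: hp (pt j) + \sum_(k < size s) nu k *: s`_k = 0 ->
  (forall i j, i \in l -> j \in l ->
    mu i * ((-1) ^+ index j l * detl (map (hp \o pt) (rem j l) ++ s)) =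
    mu j * ((-1) ^+ index i l * detl (map (hp \o pt) (rem i l) ++ s))) /\
  (forall w s' j, s = w :: s' -> j \in l ->
    nu 0%N * ((-1) ^+ index j l * detl (map (hp \o pt) (rem j l) ++ s)) =
    mu j * ((-1) ^+ size l * detl (map (hp \o pt) l ++ s'))).
Proof.
move=> ul sz rel; set s1 := map (hp \o pt) l.
case: l => [|j0 l'] in ul sz rel s1 *.
  by split=> // *.
set l := j0 :: l' in ul sz rel s1 *.
pose r k := if (k < size l)%N then mu (nth j0 l k) else nu (k - size l)%N.
have S : \sum_(k < (1 + n).+1) r k *: (s1 ++ s)`_k = 0.
  rewrite -(big_mkord xpredT (fun k => r k *: (s1 ++ s)`_k)).
  have -> : (1 + n).+1 = (size l + size s)%N by rewrite sz.
  rewrite (@big_cat_nat _ _ _ (size l)) ?leq_addr// -[RHS]rel; congr (_ + _).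
    rewrite [RHS](big_nth j0) big_nat [RHS]big_nat; apply: eq_bigr => k /andP[_ kl].
    by rewrite /r kl nth_cat size_map kl (nth_map j0).
  rewrite -{1}[size l]add0n big_addn addKn big_mkord; apply: eq_bigr => k _.
  by rewrite /r nth_cat size_map ltnNge leq_addl/= addnK.
have r1 j : j \in l -> r (index j l) = mu j.
  by move=> jl; rewrite /r index_mem jl nth_index.
have td j : j \in l -> take (index j l) (s1 ++ s) ++ drop (index j l).+1 (s1 ++ s) =
    map (hp \o pt) (rem j l) ++ s.
  move=> jl; rewrite remE map_cat map_take map_drop -/s1.
  have h : (index j l < size s1)%N by rewrite size_map index_mem.
  rewrite take_cat h drop_cat; case: ltnP => h2; first by rewrite catA.
  rewrite (eqP (_ : index j l == (size s1).-1)) ?prednK//; last 1 first.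
  - by rewrite eqn_leq -ltnS prednK ?(leq_ltn_trans _ h)// h -(leq_add2r 1) !addn1 prednK ?(leq_ltn_trans _ h).
  - by rewrite subnn drop0 drop_size cats0.
have ix j : j \in l -> (index j l <= 1 + n)%N.
  move=> jl; have := jl; rewrite -index_mem => h.
  have : (size l <= n.+2)%N by rewrite -sz leq_addr.
  by move=> /(leq_trans h).
split=> [i j il jl|w s' j es jl].
  by rewrite -!td// -!r1//; apply: detl_relation => //; exact: ix.
rewrite -td// -[mu j]r1//.
have -> : nu 0%N = r (size l) by rewrite /r ltnn subnn.
have -> : map (hp \o pt) l ++ s' = take (size l) (s1 ++ s) ++ drop (size l).+1 (s1 ++ s).
  by rewrite -(size_map (hp \o pt) l) -/s1 take_size_cat// drop_cat ltnNge leqnSn/= subSnn es drop1.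
apply: detl_relation => //; first exact: ix.
by rewrite -ltnS -[(1 + n).+1]sz es -addn1 leq_add.
Qed.

(** The leading homogeneous coordinate gives the zero sum, the others put the combination of the
    points into the span of the frame. Independence of the frame recovers the remaining
    coefficients. *)
Lemma hpt_relation l f (r : nat -> R) : (forall j, j \in l -> U (pt j)) -> uniq l ->
  \sum_(k < size l + m f) r k *: (map (hp \o pt) l ++ map hv (Fr f))`_k = 0 ->
  [/\ \sum_(j <- l) r (index j l) = 0,
      (comb (fun j => r (index j l)) l <= direction (X f))%MS &
      (forall j, j \in l -> r (index j l) = 0) ->
      forall k, (k < size l + m f)%N -> r k = 0].
Proof.
move=> ptU ul; pose mu j := r (index j l); pose nu k := r (k + size l)%N.
set s := _ ++ _ => rel0.
have rel : \sum_(j <- l) mu j *: hp (pt j) + \sum_(k < m f) nu k *: hv (Fr f)`_k = 0.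
  rewrite -[RHS]rel0 -(big_mkord xpredT (fun k => r k *: s`_k)).
  rewrite (@big_cat_nat _ _ _ (size l)) ?leq_addr//; congr (_ + _).
    rewrite /s /mu; clear -ul; case: l ul => [|j0 l'] ul'; first by rewrite big_nil big_geq.
    rewrite (big_nth j0) big_nat [RHS]big_nat; apply: eq_bigr => k /andP[_ kl].
    by rewrite index_uniq// nth_cat size_map kl (nth_map j0).
  rewrite -{1}[size l]add0n big_addn addKn big_mkord; apply: eq_bigr => k _.
  rewrite /nu nth_cat size_map ltnNge leq_addl/= addnK (nth_map 0)//.
  by rewrite (lc_frame_size LC).
have mu0 : \sum_(j <- l) mu j = 0.
  have := congr1 (fun w : 'rV[R]_(1 + n) => w 0 (lshift n ord0)) rel.
  rewrite !mxE !summxE [X in _ + X]big1 ?addr0; last first.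
    by move=> k _; rewrite mxE row_mxEl mxE mulr0.
  by move=> h; rewrite -[RHS]h; apply: eq_bigr => j _; rewrite mxE row_mxEl mxE mulr1.
have cE : (comb mu l <= E)%MS.
  have [[j0 j0l]|nl] := pselect (exists j, j \in l); last first.
    by rewrite /comb big_seq big1 ?sub0mx// => j jl; case: nl; exists j.
  have -> : comb mu l = \sum_(j <- l) mu j *: (pt j - pt j0).
    by rewrite comb_sub mu0 scale0r subr0.
  rewrite big_seq summx_sub// => j jl; rewrite scalemx_sub//.
  by apply: (lc_span LC); exact: ptU.
have cg : comb mu l = - \sum_(k < m f) nu k *: (Fr f)`_k.
  apply/eqP; rewrite -subr_eq0 opprK; apply/eqP; apply: (hvec_eq0 (E := E)).
    rewrite addmx_sub// summx_sub// => k _; rewrite scalemx_sub//.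
    apply: submx_trans (lc_direction LC f); apply: (lc_frame_sub LC).
    by rewrite mem_nth// (lc_frame_size LC).
  rewrite hvecD [X in _ + X]hvec_sum -(hpt_sum E pt mu0); exact: rel.
split=> //.
  rewrite cg eqmx_opp summx_sub// => k _; rewrite scalemx_sub//.
  by apply: (lc_frame_sub LC); rewrite mem_nth// (lc_frame_size LC).
move=> mu1 k ks; have [kl|kl] := ltnP k (size l).
  have j0 : J by case: (l) kl.
  by have := mu1 _ (mem_nth j0 kl); rewrite index_uniq.
have kg : (k - size l < m f)%N by lia.
have := lc_frame_free LC (i := f) (a := nu) _ kg; rewrite /nu subnK//; apply.
apply/eqP; rewrite -oppr_eq0 -cg; apply/eqP.
by rewrite /comb big_seq big1// => j /mu1 h; rewrite /mu h scale0r.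
Qed.

Lemma orient_neq0 l f : (forall j, j \in l -> U (pt j)) -> uniq l -> generic l ->
  (size l + m f)%N = n.+1 -> meets l f -> orient l f != 0.
Proof.
move=> ptU ul gl sz [a [wa fa]]; apply/detl_eq0P => -[r0 [i ri] rel].
pose r k := if insub k is Some i then r0 i else 0.
have [|mu0 muf rz] := @hpt_relation l f r ptU ul.
  rewrite -[RHS]rel -!(big_mkord xpredT (fun k => r k *: (_ ++ _)`_k)) sz big_mkord.
  by apply: eq_bigr => k _; rewrite /r valK.
pose mu : J -> R := fun j => r (index j l).
have [[j [jl muj]]|nj] := pselect (exists j, j \in l /\ mu j <> 0); last first.
  have := rz _ i; rewrite sz ltn_ord /r valK => h; move/negP: ri; apply; apply/eqP/h => //.
  by move=> j jl; apply: contrapT => h'; apply: nj; exists j.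
have muj0 : mu j != 0 by apply/eqP.
(* Sliding the weights along the relation until the [j]-th one vanishes keeps the combination in the
   affine hull of the cell. One zero is enough for genericity to annihilate all weights, although
   their sum is 1. *)
pose b k := a k + (- (a j / mu j)) * mu k.
have b1 : \sum_(k <- l) b k = 1 by rewrite sum_line wa.2 mu0 mulr0 addr0.
have b0 : forall k, k \in l -> b k = 0.
  apply: (generic_zeros (Z := [:: j]) gl ul fa) => //.
  - rewrite comb_sub b1 scale1r comb_line addrC addKr; exact: scalemx_sub.
  - by move=> k; rewrite inE => /eqP ->.
  - by move=> k; rewrite inE => /eqP ->; rewrite /b mulNr divfK ?subrr.
  - by rewrite sz addn1.
by move: b1; rewrite big_seq big1 => [/esym/eqP|//]; rewrite oner_eq0.
Qed.

End Points.
End LocalComplexTheory.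

Lemma sgz_sqr (R : realDomainType) (x : R) : x != 0 -> sgz x * sgz x = 1.
Proof. by rewrite neq_lt => /orP[/ltr0_sgz ->|/gtr0_sgz ->]. Qed.

(** * The boundary formula for intersection numbers *)

Section IntersectionBoundary.
Context {R : realType} {N n : nat} {E : 'M[R]_(n, N)} {U : set 'rV[R]_N}.
Context {I : finType} {X : I -> set 'rV[R]_N}.
Context {Fr : I -> seq 'rV[R]_N} {inc : I -> I -> int}.
Hypothesis LC : local_complex E U X Fr inc.
Local Notation V := 'rV[R]_N.
Local Notation hv := (hvec E).
Local Notation hp := (hpt E).
Local Notation m i := (dim (X i)).
Context {J : eqType}.
Variable pt : J -> V.
Implicit Types (a b mu : J -> R).
Variables (l : seq J) (g : I).
Hypotheses (ul : uniq l) (ptU : forall j, j \in l -> U (pt j)).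
Hypothesis gl : @generic R N n I X J pt l.
Hypothesis lg : (size l + m g)%N = n.+2.
Local Notation comb a := (comb pt a l).
Local Notation orient := (@orient R N n E I Fr J pt).
Local Notation crossing := (@crossing R N n E I X Fr J pt).
Local Notation meets := (@meets R N I X J pt).
Local Notation facet f := (lfacet (X := X) f g).

(** Since [size l + m g = n + 2], the simplex meets [X g] in a segment, if at all. [onseg] describes
    its points by barycentric coordinates, [direct] its tangent vectors, and [fwd a mu] says that
    the segment continues from [a] in the direction [mu]. *)
Let onseg a := weights a l /\ X g (comb a).
Let direct mu := [/\ \sum_(j <- l) mu j = 0, (comb mu <= direction (X g))%MS
  & exists2 j, j \in l & mu j != 0].
Let line a mu (t : R) := fun j => a j + t * mu j.
Let fwd a mu := exists2 t : R, 0 < t & onseg (line a mu t).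

Lemma weights_in a : weights a l -> U (comb a).
Proof. by move=> wa; apply: convex_comb wa => //; exact: lc_convex LC. Qed.

Lemma weights_nonzero a : weights a l -> ~ (forall j, j \in l -> a j = 0).
Proof.
by move=> [_ a1] a0; move: a1; rewrite big_seq big1 => [/esym/eqP|//]; rewrite oner_eq0.
Qed.

Lemma rel_of_weights f a mu x t : X f x -> weights a l -> \sum_(j <- l) mu j = 0 ->
  (comb mu <= direction (X f))%MS -> comb a = x ->
  ((\sum_(j <- l) (line a mu t) j *: (pt j - x))%R <= direction (X f))%MS.
Proof.
move=> fx [_ a1] mu0 muf ax.
rewrite comb_sub sum_line a1 mu0 mulr0 addr0 scale1r comb_line ax addrC addKr.
exact: scalemx_sub.
Qed.

Lemma line_nonzero a mu t : weights a l -> \sum_(j <- l) mu j = 0 ->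
  ~ (forall j, j \in l -> line a mu t j = 0).
Proof.
move=> [_ a1] mu0 h; have : \sum_(j <- l) line a mu t j = 1.
  by rewrite sum_line a1 mu0 mulr0 addr0.
by rewrite big_seq big1 => [/esym/eqP|//]; rewrite oner_eq0.
Qed.

(** If [mu j = 0], sliding along [mu] creates a second zero weight while the [j]-th stays zero, and
    two zeros force all weights to vanish. *)
Lemma direction_nonzero a mu j : onseg a -> direct mu -> j \in l -> a j = 0 -> mu j != 0.
Proof.
move=> [wa ga] [mu0 mug [i il mui]] jl aj; apply/eqP => muj.
have ij : i != j by apply: contraNneq mui => ->; apply/eqP.
apply: (line_nonzero (t := - (a i / mu i)) wa mu0).
apply: (generic_zeros (Z := [:: i; j]) gl ul ga).
- exact: rel_of_weights.
- by rewrite /= inE ij.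
- by move=> k; rewrite !inE => /orP[]/eqP ->.
- move=> k; rewrite !inE /line => /orP[]/eqP ->; first by rewrite mulNr divfK ?subrr.
  by rewrite aj muj mulr0 addr0.
- by rewrite lg addn2.
Qed.

Lemma direction_transversal a mu f : onseg a -> direct mu -> facet f -> X f (comb a) ->
  ~ (comb mu <= direction (X f))%MS.
Proof.
move=> [wa ga] [mu0 mug [i il mui]] [fg dfg] fa muf.
apply: (line_nonzero (t := - (a i / mu i)) wa mu0).
apply: (generic_zeros (Z := [:: i]) gl ul fa) => //.
- exact: rel_of_weights.
- by move=> k; rewrite !inE => /eqP ->.
- by move=> k; rewrite !inE /line => /eqP ->; rewrite mulNr divfK ?subrr.
- by move: lg; rewrite dfg /= addn1 addnS => -[->].
Qed.

(** A zero weight and a drop in the dimension of the cell around the point each cost one dimension;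
    the segment has room for only one of them. *)
Lemma onseg_cases a : onseg a ->
  [\/ (forall j, j \in l -> 0 < a j) /\ relint (X g) (comb a),
      exists j, [/\ j \in l, a j = 0, (forall i, i \in l -> i != j -> 0 < a i)
                  & relint (X g) (comb a)]
    | (forall j, j \in l -> 0 < a j) /\ exists f, facet f /\ relint (X f) (comb a)].
Proof.
move=> [wa ga]; have Ux := weights_in wa.
have [f rf] := lc_cover LC Ux; have fx : X f (comb a) by case: rf.
have rel i : ((\sum_(j <- l) a j *: (pt j - comb a))%R <= direction (X i))%MS.
  by rewrite comb_sub wa.2 scale1r subrr sub0mx.
have [a0 a1] := wa.
have [fg|fg] := pselect (f = g); last first.
  have mfg := lc_face_dim LC Ux rf ga fg.
  have apos j : j \in l -> 0 < a j.
    move=> jl; rewrite lt_neqAle a0// andbT eq_sym; apply/eqP => aj.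
    apply: (weights_nonzero wa); apply: (generic_zeros (Z := [:: j]) gl ul fx) => //.
    - by move=> k; rewrite !inE => /eqP ->.
    - by move=> k; rewrite !inE => /eqP ->.
    - by move: lg mfg => /=; lia.
  have sfg := lc_face LC Ux rf ga.
  constructor 3; split=> //; exists f; split=> //; split=> //.
  apply/eqP; rewrite eqn_leq mfg andbT leqNgt; apply/negP => mfg2.
  apply: (weights_nonzero wa); apply: (generic_zeros (Z := [::]) gl ul fx) => //=.
  by move: lg mfg2; lia.
subst f.
have [[j [jl aj]]|na] := pselect (exists j, j \in l /\ a j = 0); last first.
  constructor 1; split=> // j jl; rewrite lt_neqAle a0// andbT eq_sym.
  by apply/eqP => aj; apply: na; exists j.
constructor 2; exists j; split=> // i il ij.
rewrite lt_neqAle a0// andbT eq_sym; apply/eqP => ai.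
apply: (weights_nonzero wa); apply: (generic_zeros (Z := [:: i; j]) gl ul fx) => //.
- by rewrite /= inE ij.
- by move=> k; rewrite !inE => /orP[]/eqP ->.
- by move=> k; rewrite !inE => /orP[]/eqP ->.
- by rewrite lg addn2.
Qed.

Lemma line_pos a mu (s : seq J) :
  (forall j, j \in s -> 0 < a j \/ (a j = 0 /\ 0 <= mu j)) ->
  exists2 e, 0 < e & forall t, 0 <= t -> t <= e -> forall j, j \in s -> 0 <= line a mu t j.
Proof.
elim: s => [|i s IH] h; first by exists 1.
have [|e e0 es] := IH; first by move=> j js; apply: h; rewrite inE js orbT.
have m1 : 0 < `|mu i| + 1 by rewrite ltr_wpDl.
have [e1 e10 e1i] : exists2 e1, 0 < e1 & forall t, 0 <= t -> t <= e1 -> 0 <= line a mu t i.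
  case: (h i (mem_head _ _)) => [ai|[ai mui]]; last first.
    by exists 1 => // t t0 _; rewrite /line ai add0r mulr_ge0.
  exists (a i / (`|mu i| + 1)) => [|t t0 te]; first by rewrite divr_gt0.
  have : t * (`|mu i| + 1) <= a i by rewrite -ler_pdivlMr.
  have := ler_wpM2l t0 (lerNnormlW (lexx `|mu i|)).
  by rewrite /line; lra.
exists (Num.min e e1); first by rewrite lt_min e0.
move=> t t0; rewrite le_min => /andP[te te1] j; rewrite inE => /orP[/eqP ->|js].
  exact: e1i.
exact: es.
Qed.

Lemma line_weights a mu t : \sum_(j <- l) mu j = 0 -> weights a l ->
  (forall j, j \in l -> 0 <= line a mu t j) -> weights (line a mu t) l.
Proof. by move=> mu0 [_ a1] h; split=> //; rewrite sum_line mu0 a1 mulr0 addr0. Qed.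

Lemma fwd_relint a mu : onseg a -> direct mu -> relint (X g) (comb a) ->
  (forall j, j \in l -> 0 < a j \/ (a j = 0 /\ 0 <= mu j)) -> fwd a mu.
Proof.
move=> [wa ga] [mu0 mug _] ra /line_pos[e e0 es].
have [e1 e10 e1g] := relint_move ra mug.
have t0 : 0 < Num.min e e1 by rewrite lt_min e0.
exists (Num.min e e1) => //; split.
  by apply: line_weights => // j jl; apply: es; rewrite // ?ge_min ?lexx // ltW.
rewrite comb_line; case: (e1g (Num.min e e1)) => //.
by rewrite gtr0_norm// ge_min lexx orbT.
Qed.

(** The vector [comb a - y] points outward at the facet, so [th < 0] means inward: a small step ends
    at a convex combination of [y] and a point of [X f]. *)
Lemma fwd_facet a mu f y (th : R) w : onseg a -> direct mu -> facet f ->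
  relint (X f) (comb a) -> relint (X g) y -> comb mu = th *: (comb a - y) + w ->
  (w <= direction (X f))%MS -> (forall j, j \in l -> 0 < a j) -> th < 0 -> fwd a mu.
Proof.
move=> [wa ga] [mu0 mug _] [fg dfg] rf ry muE wf apos th0.
have [|e e0 es] := @line_pos a mu l; first by move=> j jl; left; exact: apos.
have [e1 e10 e1f] := relint_move rf wf.
have nt0 : 0 < - th by rewrite oppr_gt0.
have c0 : 0 < (2 * - th)^-1 by rewrite invr_gt0 mulr_gt0.
(* The three bounds keep the weights nonnegative, keep the point moved along [w] in [X f], and make
   the coefficient [t * - th] of [y] at most one half. *)
pose t := Num.min e (Num.min (e1 / 2) (2 * - th)^-1).
have t0 : 0 < t by rewrite !lt_min e0 divr_gt0.
have te : t <= e by rewrite ge_min lexx.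
have te1 : t <= e1 / 2 by rewrite !ge_min lexx !orbT.
have tth : t * - th <= 1 / 2.
  have : t <= (2 * - th)^-1 by rewrite !ge_min lexx !orbT.
  by rewrite -[_^-1]div1r ler_pdivlMr ?mulr_gt0// => h; lra.
exists t => //; split; first by apply: line_weights => // j jl; apply: es; rewrite // ltW.
have s0 : 0 < t * - th by rewrite mulr_gt0.
have s1 : 0 < 1 - t * - th by lra.
rewrite comb_line.
have -> : comb a + t *: comb mu =
    (1 - t * - th) *: (comb a + (t / (1 - t * - th)) *: w) + (t * - th) *: y.
  rewrite muE; apply/rowP => k; rewrite !mxE.
  have h : 1 - t * - th != 0 by rewrite gt_eqF.
  by field.
apply: polytope_convex; [exact: lc_polytope LC g|exact: ltW|lra| |by case: ry].
apply/fg; case: (e1f (t / (1 - t * - th))) => //.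
rewrite gtr0_norm ?divr_gt0// ler_pdivrMr//.
have := ler_wpM2l (ltW e10) tth; lra.
Qed.

(** A forward step mixed with a backward step along the facet, in proportions that cancel [w], would
    prolong the segment from [y] beyond [comb a] inside [X g]. Then [comb a] would be relatively
    interior to both [X f] and [X g]. *)
Lemma nfwd_facet a mu f y (th : R) w : onseg a -> direct mu -> facet f ->
  relint (X f) (comb a) -> relint (X g) y -> comb mu = th *: (comb a - y) + w ->
  (w <= direction (X f))%MS -> 0 < th -> ~ fwd a mu.
Proof.
move=> [wa ga] [mu0 mug _] [fg dfg] rf ry muE wf th0 [t t0 [_ gt]].
have Ux := weights_in wa; have pg := lc_polytope LC g.
have [e e0 ef] := relint_move rf wf.
have te : 0 < t + e by rewrite addr_gt0.
pose s := t / (t + e).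
have s1 : 0 < 1 - s by rewrite subr_gt0 /s ltr_pdivrMr// mul1r ltrDl.
have s0 : 0 < s by rewrite divr_gt0.
suff rg : relint (X g) (comb a).
  by have := lc_disjoint LC Ux rf rg => fgE; move: dfg; rewrite fgE; lia.
apply: (relint_extend pg ry (t := (1 - s) * t * th)); first by rewrite !mulr_gt0.
have -> : comb a + ((1 - s) * t * th) *: (comb a - y) =
    (1 - s) *: comb (line a mu t) + s *: (comb a + (- e) *: w).
  rewrite comb_line muE; apply/rowP => k; rewrite !mxE /s.
  have h : t + e != 0 by rewrite gt_eqF.
  by field.
apply: polytope_convex => //; [exact: ltW|lra|].
by apply/fg; case: (ef (- e)); rewrite ?normrN ?gtr0_norm.
Qed.

Let minor j := (-1) ^+ index j l * orient (rem j l) g.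

Lemma minor_prop mu i j : direct mu -> i \in l -> j \in l ->
  mu i * minor j = mu j * minor i.
Proof.
move=> [mu0 mug _] il jl.
have [a aE] := lc_frame_span LC mug.
have [||] := @relation_minors R N n E J pt l (map hv (Fr g)) mu (fun k => - a k) ul.
- by rewrite size_map (lc_frame_size LC).
- rewrite (hpt_sum E pt mu0) -/(comb mu) aE hvec_sum size_map (lc_frame_size LC).
  rewrite -big_split/= big1// => k _.
  by rewrite (nth_map 0) ?(lc_frame_size LC)// scaleNr subrr.
by move=> + _; apply.
Qed.

(** In the relation between the points, the tangent and the frame of [f], deleting the point [j] is
    compared with deleting the tangent. The part [w] does not affect the determinant, and
    [lc_incidence] turns the outward vector followed by the frame of [f] into the frame of [g]. *)
Lemma minor_facet mu f x y (th : R) w j : direct mu -> facet f -> X f x ->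
  relint (X g) y -> comb mu = th *: (x - y) + w -> (w <= direction (X f))%MS ->
  j \in l ->
  sgz th * inc g f * sgz (minor j) = sgz (mu j) * ((-1) ^+ (size l).-1 * sgz (orient l f)).
Proof.
move=> [mu0 mug _] [fg dfg] fx ry muE wf jl.
have l0 : (0 < size l)%N by case: (l) jl.
have [a aE] := lc_frame_span LC wf.
have [| |_ h] := @relation_minors R N n E J pt l (hv (comb mu) :: map hv (Fr f)) mu
    (fun k => if k is 0%N then -1 else 0) ul.
- by rewrite /= size_map (lc_frame_size LC) -dfg.
- rewrite (hpt_sum E pt mu0) -/(comb mu) big_ord_recl/= big1 ?addr0 ?scaleN1r ?subrr//.
  by move=> k _; rewrite scale0r.
have := h _ _ j erefl jl; rewrite muE hvec_linear detl_linear; last first.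
  by rewrite size_map size_rem//; move: lg l0; rewrite dfg; lia.
have sr : (size (rem j l) + m g)%N = n.+1.
  by rewrite size_rem//; move: lg l0; lia.
have -> : hv w = \sum_(k < size (map hv (Fr f))) a k *: (map hv (Fr f))`_k.
  rewrite aE hvec_sum size_map (lc_frame_size LC); apply: eq_bigr => k _.
  by rewrite (nth_map 0) ?(lc_frame_size LC).
rewrite detl_dependent ?addr0; last first.
  by rewrite !size_map (lc_frame_size LC) -dfg sr.
move=> /(congr1 (fun z : R => sgz z)).
have es : (-1 : int) ^+ size l = - (-1) ^+ (size l).-1.
  by rewrite -[in LHS](prednK l0) exprS mulN1r.
rewrite !sgzM !sgzX !sgzN1 es (lc_incidence LC fg dfg fx ry) ?size_map// => hs.
transitivity (- (-1 * ((-1) ^+ index j l * (sgz th * (inc g f * sgz (orient (rem j l) g)))))).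
  by ring.
by rewrite hs; ring.
Qed.

(** By [minor_prop] the vector of minors is proportional to the tangent, so it orients the segment;
    [kappa mu] compares [mu] with this orientation. *)
Let kappa mu := sgz (\sum_(j <- l) mu j * minor j).

Lemma kappaE mu j : direct mu -> j \in l -> mu j != 0 ->
  kappa mu = sgz (mu j) * sgz (minor j).
Proof.
move=> dm jl muj; pose S := \sum_(i <- l) mu i ^+ 2.
have S0 : 0 < S.
  rewrite /S (big_rem j)//= ltr_pwDl ?sumr_ge0//; last by move=> i _; exact: sqr_ge0.
  by rewrite exprn_even_gt0.
have : (\sum_(i <- l) mu i * minor i) * mu j = minor j * S.
  rewrite mulr_suml mulr_sumr big_seq [RHS]big_seq; apply: eq_bigr => i il.
  by rewrite -mulrA [minor i * _]mulrC (minor_prop dm jl il) mulrA -expr2 mulrC.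
move=> /(congr1 (fun z : R => sgz z)); rewrite !sgzM [sgz S]gtr0_sgz// mulr1 => <-.
by rewrite mulrCA -/(kappa mu) sgz_sqr// mulr1.
Qed.

Lemma directN mu : direct mu -> direct (fun j => - mu j).
Proof.
move=> [mu0 mug [j jl muj]]; split; first by rewrite sumrN mu0 oppr0.
  rewrite (_ : comb _ = - comb mu) ?eqmx_opp// !combE -sumrN.
  by apply: eq_bigr => i _; rewrite scaleNr.
by exists j; rewrite ?oppr_eq0.
Qed.

Lemma kappaN mu : kappa (fun j => - mu j) = - kappa mu.
Proof. by rewrite /kappa -sgzN -sumrN; under eq_bigr do rewrite mulNr. Qed.

Let ind (P : Prop) : int := if `[<P>] then 1 else 0.

(** The share of the point [a] in the difference between the two sides of [crossing_boundary], up to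
    the common sign. *)
Let contrib a : int :=
  (-1) ^+ (size l).-1 * (\sum_f inc g f * (ind (X f (comb a)) * sgz (orient l f))) -
  \sum_(j <- l) (-1) ^+ index j l * (ind (a j = 0) * sgz (orient (rem j l) g)).

Lemma indT (P : Prop) : P -> ind P = 1.
Proof. by move=> p; rewrite /ind asboolT. Qed.

Lemma indF (P : Prop) : ~ P -> ind P = 0.
Proof. by move=> p; rewrite /ind asboolF. Qed.

Lemma nonfacet_sum (F : I -> int) : (forall f, facet f -> F f = 0) ->
  \sum_f inc g f * F f = 0.
Proof.
move=> F0; apply: big1 => f _; have [ff|nf] := pselect (facet f).
  by rewrite F0// mulr0.
by rewrite (lc_incidence0 LC)// mul0r.
Qed.

Lemma relint_no_facet a : onseg a -> relint (X g) (comb a) ->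
  forall f, facet f -> ~ X f (comb a).
Proof.
move=> [wa ga] ra f [fg dfg] fa; have := lc_face LC (weights_in wa) ra fa.
by move/dim_le; rewrite dfg ltnn.
Qed.

(** Interior points of the segment contribute nothing. An end contributes [kappa mu] or [- kappa mu]
    according to the side from which it bounds the segment, whether it comes from a vanishing weight
    or from a facet of the cell. *)
Lemma contrib_cases a mu : onseg a -> direct mu ->
  [\/ [/\ contrib a = 0, fwd a mu & (forall j, j \in l -> a j != 0) /\
        forall f, facet f -> ~ X f (comb a)],
      [/\ contrib a = kappa mu, ~ fwd a mu & fwd a (fun j => - mu j)] |
      [/\ contrib a = - kappa mu, fwd a mu & ~ fwd a (fun j => - mu j)]].
Proof.
move=> sa dm; have [wa ga] := sa; have dn := directN dm.
case: (onseg_cases sa) => [[apos rg]|[j [jl aj apos rg]]|[apos [f [ff rf]]]].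
- constructor 1; split; last 1 first.
  + by split=> [j /apos/lt0r_neq0//|]; exact: relint_no_facet.
  + rewrite /contrib nonfacet_sum; last first.
      by move=> f ff; rewrite indF ?mul0r//; exact: relint_no_facet.
    rewrite mulr0 big_seq big1 ?subr0// => j jl.
    by rewrite indF ?mul0r ?mulr0//; apply/eqP/lt0r_neq0/apos.
  + by apply: fwd_relint => // j /apos; left.
- have muj := direction_nonzero sa dm jl aj.
  have nfwd mu' : direct mu' -> mu' j < 0 -> ~ fwd a mu'.
    move=> dm' mj [t t0 [[wt _] _]]; have := wt j jl.
    by rewrite /line aj add0r pmulr_rge0// leNgt mj.
  have yfwd mu' : direct mu' -> 0 < mu' j -> fwd a mu'.
    move=> dm' mj; apply: fwd_relint => // i il.
    have [->|ij] := eqVneq i j; first by right; rewrite aj ltW.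
    by left; exact: apos.
  have Ta : contrib a = - sgz (minor j).
    rewrite /contrib nonfacet_sum; last first.
      by move=> f ff; rewrite indF ?mul0r//; exact: relint_no_facet.
    rewrite mulr0 sub0r; congr (- _); rewrite (big_rem j)//= big_seq big1 ?addr0.
      by rewrite indT// mul1r /minor sgzM sgzX sgzN1.
    move=> i; rewrite mem_rem_uniq// !inE => /andP[ij il].
    by rewrite indF ?mul0r ?mulr0//; apply/eqP/lt0r_neq0/apos.
  rewrite (kappaE dm jl muj) Ta.
  have [mj|mj|mj] := ltrgtP (mu j) 0; last by rewrite mj eqxx in muj.
  + constructor 2; rewrite (ltr0_sgz mj) mulN1r; split=> //; first exact: nfwd.
    by apply: yfwd => //; rewrite oppr_gt0.
  + constructor 3; rewrite (gtr0_sgz mj) mul1r; split=> //; first exact: yfwd.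
    by apply: nfwd => //; rewrite oppr_lt0.
- have Ux := weights_in wa; have fa : X f (comb a) by case: rf.
  have [fg dfg] := ff.
  have [y ry] := polytope_relint (lc_polytope LC g).
  have [_ mug [j jl muj]] := dm.
  have nrg : ~ relint (X g) (comb a).
    by move=> rg; exact: (relint_no_facet sa rg ff fa).
  have nxy : ~ (comb a - y <= direction (X f))%MS.
    rewrite -(opprB y) eqmx_opp.
    exact: (relint_transversal (lc_polytope LC g) fg rf nrg fa ry).
  have xyg : (comb a - y <= direction (X g))%MS by apply: sub_direction => //; case: ry.
  have [th [w [muE wf]]] := direction_split fg dfg xyg nxy mug.
  have th0 : th != 0.
    apply/eqP => th0; apply: (direction_transversal sa dm ff fa).
    by rewrite muE th0 scale0r add0r.
  have muEN : comb (fun j => - mu j) = (- th) *: (comb a - y) + (- w).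
    rewrite scaleNr -opprD -muE !combE -sumrN.
    by apply: eq_bigr => i _; rewrite scaleNr.
  have wfN : (- w <= direction (X f))%MS by rewrite eqmx_opp.
  have Ta : contrib a = sgz th * kappa mu.
    rewrite /contrib [X in _ - X]big_seq [X in _ - X]big1 ?subr0; last first.
      by move=> i il; rewrite indF ?mul0r ?mulr0//; apply/eqP/lt0r_neq0/apos.
    rewrite (bigD1 f)//= big1 ?addr0; last first.
      move=> f' f'f; have [ff'|nf'] := pselect (facet f'); last first.
        by rewrite (lc_incidence0 LC)// mul0r.
      rewrite indF ?mul0r ?mulr0// => f'a.
      have := lc_face_dim LC Ux rf f'a; case: ff' => _; rewrite dfg => -[->].
      by rewrite ltnn => h; have : f <> f' by [move=> e; rewrite e eqxx in f'f]; move/h.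
    rewrite indT// mul1r (kappaE dm jl muj).
    have := minor_facet dm ff fa ry muE wf jl => hs.
    have inc2 := lc_incidence_sqr LC fg dfg.
    have mj2 : sgz (mu j) * sgz (mu j) = 1 by rewrite sgz_sqr.
    transitivity (inc g f * (sgz (mu j) * sgz (mu j)) * ((-1) ^+ (size l).-1 * sgz (orient l f))).
      by rewrite mj2; ring.
    transitivity (inc g f * sgz (mu j) * (sgz th * inc g f * sgz (minor j))).
      by rewrite hs; ring.
    transitivity (inc g f * inc g f * sgz th * (sgz (mu j) * sgz (minor j))); first by ring.
    by rewrite inc2; ring.
  have [mj|mj|mj] := ltrgtP th 0; last by rewrite mj eqxx in th0.
  + constructor 3; rewrite Ta (ltr0_sgz mj) mulN1r; split=> //.
      exact: (fwd_facet sa dm ff rf ry muE).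
    by apply: (nfwd_facet sa dn ff rf ry muEN) => //; rewrite oppr_gt0.
  + constructor 2; rewrite Ta (gtr0_sgz mj) mul1r; split=> //.
      exact: (nfwd_facet sa dm ff rf ry muE).
    by apply: (fwd_facet sa dn ff rf ry muEN) => //; rewrite oppr_lt0.
Qed.

Lemma weights_le1 a j : weights a l -> j \in l -> a j <= 1.
Proof.
move=> [a0 a1] jl; rewrite -a1 (big_rem j)//= lerDl big_seq sumr_ge0// => i.
by move/mem_rem; exact: a0.
Qed.

Lemma line_end a mu : onseg a -> direct mu ->
  exists2 t, onseg (line a mu t) & forall s, onseg (line a mu s) -> s <= t.
Proof.
move=> [wa ga] [mu0 mug [i il mui]].
(* The parameter is bounded because the weight at [i], where [mu] is nonzero, stays between 0 and
   1. *)
apply: (@closed_max _ (fun t => onseg (line a mu t)) ((1 + `|a i|) / `|mu i|)).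
- exists 0; rewrite (_ : line a mu 0 = a)//.
  by apply/funext => j; rewrite /line mul0r addr0.
- move=> t [wt _]; rewrite ler_pdivlMr ?normr_gt0//.
  apply: le_trans (ler_norm _) _; rewrite normrM normr_id -normrM.
  have := weights_le1 wt il; have := wt.1 i il; rewrite /line.
  set p := t * mu i => p0 p1; have := ler_norm (a i); have := ler_norm (- a i).
  rewrite normrN ler_norml; lra.
- move=> t nt.
  have [[j [jl aj]]|na] := pselect (exists j, j \in l /\ line a mu t j < 0).
    have m1 : 0 < `|mu j| + 1 by rewrite ltr_wpDl.
    exists (- line a mu t j / (`|mu j| + 1)); first by rewrite divr_gt0// oppr_gt0.
    move=> s st [[ws _] _]; have := ws j jl; rewrite leNgt => /negP; apply.
    have -> : line a mu s j = line a mu t j + (s - t) * mu j by rewrite /line; ring.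
    rewrite -ltrBrDl sub0r; apply: le_lt_trans (ler_norm _) _; rewrite normrM.
    apply: (@le_lt_trans _ _ (`|s - t| * (`|mu j| + 1))).
      by rewrite ler_wpM2l// lerDl.
    by rewrite -ltr_pdivlMr.
  have ng : ~ X g (comb a + t *: comb mu).
    move=> gt; apply: nt; split; last by rewrite comb_line.
    apply: line_weights => // j jl; rewrite leNgt; apply/negP => aj.
    by apply: na; exists j.
  have [e e0 es] := closed_line (polytope_closed (lc_polytope LC g)) ng.
  by exists e => // s st [_]; rewrite comb_line; exact: es.
Qed.

(** A second, independent tangent would make it possible to annihilate two weights at once, against
    genericity. *)
Lemma line_unique a b mu : onseg a -> onseg b -> direct mu ->
  exists t, forall j, j \in l -> b j = line a mu t j.
Proof.
move=> [wa ga] [wb gb] dm; have [mu0 mug [i il mui]] := dm.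
pose t := (b i - a i) / mu i; exists t => k kl; apply: contrapT => bk.
pose nu j := b j - line a mu t j.
have nui : nu i = 0 by rewrite /nu /line /t divfK//; ring.
have nuk : nu k != 0 by rewrite subr_eq0; apply/eqP.
have ik : i != k by apply: contraNneq nuk => <-; rewrite nui.
pose a' := line a mu (- (a i / mu i)).
pose s := - (a' k / nu k).
have a'i : a' i = 0 by rewrite /a' /line mulNr divfK ?subrr.
have nu0 : \sum_(j <- l) nu j = 0.
  by rewrite sumrB wb.2 sum_line wa.2 mu0 mulr0 addr0 subrr.
have w1 : \sum_(j <- l) line a' nu s j = 1.
  by rewrite sum_line nu0 mulr0 addr0 sum_line wa.2 mu0 mulr0 addr0.
have h : forall j, j \in l -> line a' nu s j = 0.
  apply: (generic_zeros (Z := [:: i; k]) gl ul ga).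
  - rewrite comb_sub w1 scale1r comb_line comb_line.
    have -> : comb nu = (comb b - comb a) - t *: comb mu.
      rewrite -addrA -opprD -comb_line !combE -sumrB; apply: eq_bigr => j _.
      by rewrite scalerBl.
    rewrite addrAC (addrC (comb a)) addrK addmx_sub ?scalemx_sub//.
    by rewrite addmx_sub ?eqmx_opp ?scalemx_sub// sub_direction.
  - by rewrite /= inE ik.
  - by move=> j; rewrite !inE => /orP[]/eqP ->.
  - move=> j; rewrite !inE => /orP[]/eqP ->; first by rewrite /line -/(a' i) a'i nui mulr0 addr0.
    by rewrite /line /s mulNr divfK ?subrr.
  - by rewrite lg addn2.
by move: w1; rewrite big_seq big1 => [/esym/eqP|//]; rewrite oner_eq0.
Qed.

(** The points and the frame of [g] give [n + 2] rows in dimension [n + 1]; the coefficients of the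
    points in a linear relation form a tangent. *)
Lemma direct_exists a : onseg a -> exists mu, direct mu.
Proof.
move=> [wa ga].
pose s := map (hp \o pt) l ++ map hv (Fr g).
pose A : 'M[R]_(n.+2, 1 + n) := \matrix_(i < n.+2) s`_i.
have : kermx A != 0.
  rewrite kermx_eq0; apply/negP => /eqP rA.
  by have := rank_leq_col A; rewrite rA add1n ltnn.
move=> /rowV0Pn[v] /sub_kermxP vA v0.
pose r k := if insub k is Some i then v 0 i else 0.
have [|mu0 muf rz] := @hpt_relation _ _ _ _ _ _ _ _ _ LC _ pt l g r ptU ul.
  rewrite -[RHS]vA mulmx_sum_row -(big_mkord xpredT (fun k => r k *: s`_k)) lg big_mkord.
  by apply: eq_bigr => k _; rewrite /r valK rowK.
exists (fun j => r (index j l)); split=> //; apply: contrapT => nmu.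
have [i vi] : exists i, v 0 i != 0 by apply/rV0Pn.
move/negP: vi; apply; apply/eqP.
have := rz _ i; rewrite lg ltn_ord /r valK; apply=> // j jl.
by apply/eqP/negP => /negP h; apply: nmu; exists j.
Qed.

Lemma meets_line f a mu : X f `<=` X g -> onseg a -> direct mu ->
  meets l f <-> exists t, onseg (line a mu t) /\ X f (comb (line a mu t)).
Proof.
move=> fg sa dm; split=> [[b [wb fb]]|[t [[wt _] ft]]]; last by exists (line a mu t).
have sb : onseg b by split=> //; exact: fg.
have [t bt] := line_unique sa sb dm; exists t.
have cb : comb (line a mu t) = comb b by apply: comb_eq => j /bt.
split; last by rewrite cb.
split; last by rewrite cb; apply: fg.
split=> [j jl|]; first by rewrite -bt//; exact: wb.1.
by rewrite -wb.2 big_seq [RHS]big_seq; apply: eq_bigr => j /bt.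
Qed.

Lemma meets_rem_line j a mu : j \in l -> onseg a -> direct mu ->
  meets (rem j l) g <-> exists t, onseg (line a mu t) /\ line a mu t j = 0.
Proof.
move=> jl sa dm.
have rl : {subset rem j l <= l} by exact: mem_rem.
have ur : uniq (rem j l) by rewrite rem_uniq.
split=> [[b [wb gb]]|[t [[[w0 w1] gt] tj]]].
  have [wb' cb'] := weightsS pt ur ul rl wb.
  set b' := fun i => if i \in rem j l then b i else 0 in wb' cb'.
  have sb : onseg b' by split=> //; rewrite cb'.
  have [t bt] := line_unique sa sb dm; exists t.
  have cb : comb (line a mu t) = comb b' by apply: comb_eq => i /bt.
  split; last by rewrite -bt// /b' mem_rem_uniq// !inE eqxx.
  split; last by rewrite cb cb'.
  split=> [i il|]; first by rewrite -bt//; exact: wb'.1.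
  by rewrite -wb'.2 big_seq [RHS]big_seq; apply: eq_bigr => i /bt.
exists (line a mu t); split.
  split=> [i /rl|]; first exact: w0.
  by rewrite -w1 [RHS](big_rem j)//= tj add0r.
by move: gt; rewrite !combE (big_rem j)//= tj scale0r add0r.
Qed.

(** If [Q] held at both ends it would hold at their midpoint, which is neither. So the number of
    ends in [Q] is 0 or 1 and tells whether [Q] occurs at all. *)
Lemma endpoint_count (Q : R -> Prop) (al be : R) : al < be ->
  (forall t, Q t -> t = al \/ t = be) ->
  (forall s t, Q s -> Q t -> Q ((s + t) / 2)) ->
  ind (exists t, Q t) = ind (Q al) + ind (Q be).
Proof.
move=> ab Qe Qm; have [qa|nqa] := pselect (Q al).
  rewrite (indT qa) indT; last by exists al.
  rewrite indF// => qb; case: (Qe _ (Qm _ _ qa qb)); lra.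
rewrite (indF nqa) add0r; have [qb|nqb] := pselect (Q be).
  by rewrite (indT qb) indT//; exists be.
by rewrite (indF nqb) indF// => -[t qt]; case: (Qe _ qt) => e; rewrite e in qt.
Qed.

Lemma line_line a mu s t : line (line a mu s) mu t = line a mu (s + t).
Proof. by apply/funext => j; rewrite /line mulrDl addrA. Qed.

Lemma line_mid a mu s t j : line a mu ((s + t) / 2) j = (line a mu s j + line a mu t j) / 2.
Proof. by rewrite /line; field. Qed.

Lemma comb_mid a mu s t :
  comb (line a mu ((s + t) / 2)) = (1 - 2^-1) *: comb (line a mu s) + 2^-1 *: comb (line a mu t).
Proof. by rewrite !comb_line; apply/rowP => k; rewrite !mxE; field. Qed.

Lemma convex_mid f a mu s t : X f (comb (line a mu s)) -> X f (comb (line a mu t)) ->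
  X f (comb (line a mu ((s + t) / 2))).
Proof.
move=> fs ft; rewrite comb_mid; apply: polytope_convex => //; first exact: (lc_polytope LC).
  by lra.
by lra.
Qed.

Lemma onseg_mid a mu s t : onseg (line a mu s) -> onseg (line a mu t) ->
  onseg (line a mu ((s + t) / 2)).
Proof.
move=> [[s0 s1] sg] [[t0 t1] tg]; split; last exact: convex_mid.
split=> [j jl|]; first by rewrite line_mid; have := s0 j jl; have := t0 j jl; lra.
by under eq_bigr do rewrite line_mid; rewrite -mulr_suml big_split/= s1 t1; field.
Qed.

(** Both sides count ends of the segment in which the simplex meets [X g]: the left side those on
    facets of the cell, the right side those on facets of the simplex. The contributions of the two
    ends cancel. *)
Lemma crossing_boundary :
  \sum_f inc g f * crossing l f =
  (-1) ^+ (size l).-1 * \sum_(j <- l) (-1) ^+ index j l * crossing (rem j l) g.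
Proof.
have [[a sa]|na] := pselect (exists a, onseg a); last first.
  rewrite nonfacet_sum; last first.
    move=> f [fg dfg]; rewrite !crossingE asboolF ?andbF// => -[a [wa fa]].
    by apply: na; exists a; split=> //; exact: fg.
  rewrite big_seq big1 ?mulr0// => j jl.
  rewrite !crossingE asboolF ?andbF ?mulr0// => -[a [wa ga]].
  have [wa' ca'] := weightsS pt (rem_uniq j ul) ul (@mem_rem _ j l) wa.
  by apply: na; eexists; split; [exact: wa'|rewrite ca'].
have [mu dm] := direct_exists sa; have dn := directN dm.
have [be sbe bmax] := line_end sa dm.
have [na sna amin] := line_end sa dn.
have lineN s : line a (fun j => - mu j) s = line a mu (- s).
  by apply/funext => j; rewrite /line mulrN mulNr.
pose al := - na.
have sal : onseg (line a mu al) by rewrite -lineN.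
have almin s : onseg (line a mu s) -> al <= s.
  by rewrite -[s]opprK -lineN => /amin; rewrite /al lerN2 lerNl.
have nfb : ~ fwd (line a mu be) mu.
  by move=> [t t0]; rewrite line_line => /bmax; rewrite gerDl leNgt t0.
have nfa : ~ fwd (line a mu al) (fun j => - mu j).
  move=> [t t0]; rewrite (_ : line _ _ t = line a mu (al - t)).
    by move/almin; rewrite lerDl oppr_ge0 leNgt t0.
  by apply/funext => j; rewrite /line; ring.
(* The segment is not a single point: by [contrib_cases], where it does not continue forward it
   continues backward. *)
have ab : al < be.
  have := contrib_cases sbe dm => -[[_ //]|[_ _ [t t0]]|[_ //]].
  rewrite (_ : line _ _ t = line a mu (be - t)).
    by move/almin => h; apply: le_lt_trans h _; rewrite ltrBlDr ltrDl.
  by apply/funext => j; rewrite /line; ring.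
have Tb : contrib (line a mu be) = kappa mu.
  have := contrib_cases sbe dm => -[[_ //]|[-> //]|[_ //]].
have Ta : contrib (line a mu al) = - kappa mu.
  have := contrib_cases sal dn => -[[_ //]|[-> _ _]|[_ //]].
  exact: kappaN.
have ends t : onseg (line a mu t) ->
    (exists f, facet f /\ X f (comb (line a mu t))) \/
    (exists2 j, j \in l & line a mu t j = 0) -> t = al \/ t = be.
  move=> st bd; apply: contrapT => nt.
  have [ta tb] : al < t /\ t < be.
    rewrite !lt_neqAle almin ?bmax// !andbT; split; apply/eqP => e; apply: nt.
      by left.
    by right.
  have fw : fwd (line a mu t) mu.
    by exists (be - t); rewrite ?subr_gt0// line_line addrC subrK.
  have bw : fwd (line a mu t) (fun j => - mu j).
    exists (t - al); first by rewrite subr_gt0.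
    by rewrite (_ : line _ _ _ = line a mu al)//; apply/funext => j; rewrite /line; ring.
  have := contrib_cases st dm => -[[_ _ [n1 n2]]|[_ nf _]|[_ _ nf]] //.
  by case: bd => [[f [ff]]|[j jl]]; [exact: n2|move/eqP; rewrite (negbTE (n1 j jl))].
have hf f : facet f -> crossing l f =
    (ind (X f (comb (line a mu al))) + ind (X f (comb (line a mu be)))) * sgz (orient l f).
  move=> ff; have [fg dfg] := ff.
  pose Q t := onseg (line a mu t) /\ X f (comb (line a mu t)).
  have -> : ind (X f (comb (line a mu al))) = ind (Q al).
    by congr ind; apply/propext; split=> [|[]].
  have -> : ind (X f (comb (line a mu be))) = ind (Q be).
    by congr ind; apply/propext; split=> [|[]].
  rewrite -(endpoint_count ab); last 2 first.
  - by move=> t [st ft]; apply: ends => //; left; exists f.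
  - move=> t1 t2 [s1 f1] [s2 f2]; split; first exact: onseg_mid.
    exact: convex_mid.
  have -> : (exists t, Q t) = meets l f.
    by apply/propext; split; [move/(meets_line fg sa dm)|move/(meets_line fg sa dm)].
  rewrite !crossingE /ind (_ : size l + m f == n.+1)%N; last by move: lg; rewrite dfg; lia.
  by case: asboolP => _; rewrite ?mul1r ?mul0r.
have hj j : j \in l -> crossing (rem j l) g =
    (ind (line a mu al j = 0) + ind (line a mu be j = 0)) * sgz (orient (rem j l) g).
  move=> jl; pose Q t := onseg (line a mu t) /\ line a mu t j = 0.
  have -> : ind (line a mu al j = 0) = ind (Q al).
    by congr ind; apply/propext; split=> [|[]].
  have -> : ind (line a mu be j = 0) = ind (Q be).
    by congr ind; apply/propext; split=> [|[]].
  rewrite -(endpoint_count ab); last 2 first.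
  - by move=> t [st ft]; apply: ends => //; right; exists j.
  - move=> t1 t2 [s1 f1] [s2 f2]; split; first exact: onseg_mid.
    by rewrite line_mid f1 f2 addr0 mul0r.
  have -> : (exists t, Q t) = meets (rem j l) g.
    by apply/propext; split; [move/(meets_rem_line jl sa dm)|move/(meets_rem_line jl sa dm)].
  rewrite !crossingE /ind (_ : size (rem j l) + m g == n.+1)%N; last first.
    by rewrite size_rem//; move: lg jl; case: (l) => //= j1 l1; lia.
  by case: asboolP => _; rewrite ?mul1r ?mul0r.
have : contrib (line a mu al) + contrib (line a mu be) = 0 by rewrite Ta Tb addNr.
rewrite /contrib addrACA -opprD -mulrDr -!big_split/= => /eqP; rewrite subr_eq0 => /eqP h.
have sgn2 : (-1 : int) ^+ (size l).-1 * (-1) ^+ (size l).-1 = 1.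
  by rewrite -exprD addnn -mul2n exprM sqrrN !expr1n.
have -> : \sum_(j <- l) (-1) ^+ index j l * crossing (rem j l) g =
    (-1) ^+ (size l).-1 * \sum_f inc g f * crossing l f.
  transitivity (\sum_(j <- l) ((-1) ^+ index j l * (ind (line a mu al j = 0) * sgz (orient (rem j l) g)) +
     (-1) ^+ index j l * (ind (line a mu be j = 0) * sgz (orient (rem j l) g)))).
    by rewrite big_seq [RHS]big_seq; apply: eq_bigr => j jl; rewrite hj// mulrDl mulrDr.
  rewrite -h; congr (_ * _); apply: eq_bigr => f _.
  have [ff|nf] := pselect (facet f); last by rewrite (lc_incidence0 LC)// !mul0r addr0.
  by rewrite hf// mulrDl mulrDr.
by rewrite mulrA sgn2 mul1r.
Qed.

End IntersectionBoundary.

(** * Existence of generic points *)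

Section GenericPoints.
Context {R : realType} {N n : nat} {E : 'M[R]_(n, N)} {U : set 'rV[R]_N}.
Context {I : finType} {X : I -> set 'rV[R]_N}.
Context {Fr : I -> seq 'rV[R]_N} {inc : I -> I -> int}.
Hypothesis LC : local_complex E U X Fr inc.
Local Notation V := 'rV[R]_N.
Local Notation m i := (dim (X i)).
Local Notation generic := (@generic R N n I X _).
Context {J : eqType}.
Implicit Types (pt : J -> V) (l A B : seq J).

Definition lspan (s : seq V) : 'M[R]_(size s, N) := \matrix_(k < size s) s`_k.

Lemma lspan_sub (s : seq V) v : v \in s -> (v <= lspan s)%MS.
Proof.
move=> vs; have vi : (index v s < size s)%N by rewrite index_mem.
by have := row_sub (Ordinal vi) (lspan s); rewrite rowK/= nth_index.
Qed.

Lemma lspan_mul (K : eqType) (k0 : K) (g : K -> V) (l : seq K) D : uniq l ->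
  exists2 a, D *m lspan [seq g j | j <- l] = \sum_(j <- l) a j *: g j &
    forall i, D 0 i = a (nth k0 l i).
Proof.
move=> ul; pose a j := if insub (index j l) is Some i then D 0 i else 0.
have aD i : D 0 i = a (nth k0 l i).
  have il : (i < size l)%N by rewrite -(size_map g).
  by rewrite /a index_uniq// valK.
exists a => //; rewrite mulmx_sum_row (big_nth k0).
rewrite -(size_map g) big_mkord; apply: eq_bigr => i _.
have il : (i < size l)%N by rewrite -(size_map g).
by rewrite rowK aD (nth_map k0).
Qed.

Lemma lc_near x (e : R) : U x -> 0 < e -> exists2 r : R, 0 < r &
  forall y, `|x - y| < r -> (y - x <= E)%MS -> U y /\ `|x - y| < e.
Proof.
move=> Ux e0; have [r r0 rU] := lc_open LC Ux.
exists (Num.min r e) => [|y]; first by rewrite lt_min r0.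
by rewrite lt_min => /andP[xr xe] yE; split=> //; exact: rU.
Qed.

Lemma generic_sub pt l B : {subset l <= B} -> generic pt B -> generic pt l.
Proof. by move=> lB gB f x A a fx uA Al; apply: (gB f x A a fx uA) => j /Al /lB. Qed.

(** The new point has to avoid finitely many flats: for each cell [f] and each small subset [A] of
    [B], the flat through a point of [X f] spanned by its direction and by the points of [A]. Each
    has dimension less than [n], so [avoid_flats] applies. *)
Lemma generic_extend pt B j x (e : R) : uniq B -> generic pt B -> U x -> 0 < e -> j \notin B ->
  exists y, [/\ `|x - y| < e, U y &
    generic (fun k => if k == j then y else pt k) (j :: B)].
Proof.
move=> uB gB Ux e0 jB.
have /choice[q qP] : forall f, exists y, X f y.
  by move=> f; have [y [_ fy]] := lc_meet LC f; exists y.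
pose subs := [seq mask (tval b) B | b <- enum {: (size B).-tuple bool}].
pose S f A := (direction (X f) + lspan [seq pt a - q f | a <- A])%MS.
pose F := [seq p <- [seq (f, A) | f <- enum I, A <- subs] | (size p.2 + m p.1 < n)%N].
pose s := [seq (q p.1, S p.1 p.2) | p <- F].
have [r r0 rU] := lc_near Ux e0.
have [|y [xy yE ys]] := @avoid_flats _ _ _ E s x r r0.
  move=> _ /mapP[p pF ->] /=; apply/negP => /mxrankS.
  rewrite (eqP (lc_free LC)) leqNgt => /negP; apply.
  have [+ _] := mxrank_adds_leqif (direction (X p.1)) (lspan [seq pt a - q p.1 | a <- p.2]).
  move/leq_ltn_trans; apply.
  have : (\rank (lspan [seq (pt a - q p.1)%R | a <- p.2]) <= size p.2)%N.
    by apply: leq_trans (rank_leq_row _) _; rewrite size_map.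
  move=> h; apply: (@leq_ltn_trans (m p.1 + size p.2)); first by rewrite leq_add2l.
  by move: pF; rewrite mem_filter addnC => /andP[].
have [Uy xe] := rU y xy yE; exists y; split=> // f z A a fz uA Al sz.
pose pt' : J -> V := fun k => if k == j then y else pt k.
rewrite (_ : \sum_(k <- A) _ = \sum_(k <- A) a k *: (pt' k - z))//.
have ptE k : k != j -> pt' k = pt k by rewrite /pt' => /negbTE ->.
have [jA|jA] := boolP (j \in A); last first.
  move=> rel; apply: (gB f z A a fz uA) => //.
    by move=> k kA; have := Al k kA; rewrite inE => /orP[/eqP kj|//]; rewrite -kj kA in jA.
  rewrite (_ : \sum_(k <- A) _ = \sum_(k <- A) a k *: (pt' k - z))//.
  rewrite big_seq [RHS]big_seq; apply: eq_bigr => k kA; rewrite ptE//.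
  by apply: contraNneq jA => <-.
pose A0 := rem j A.
have uA0 : uniq A0 by rewrite rem_uniq.
have A0B : {subset A0 <= B}.
  move=> k; rewrite mem_rem_uniq// !inE => /andP[kj kA].
  by have := Al k kA; rewrite inE (negbTE kj).
have sA0 : (size A0).+1 = size A by rewrite size_rem// prednK//; case: (A) jA.
rewrite (big_rem j)//= -/A0 {1}/pt' eqxx.
have -> : \sum_(k <- A0) a k *: (pt' k - z) = \sum_(k <- A0) a k *: (pt k - z).
  rewrite big_seq [RHS]big_seq; apply: eq_bigr => k; rewrite mem_rem_uniq// !inE => /andP[kj _].
  by rewrite ptE.
move=> rel.
have aj : a j = 0.
  apply: contrapT => /eqP aj.
  (* [A1] lists [A0] in the order of [B], the form in which [subs] enumerates the subsets. *)
  pose A1 := mask (map (mem A0) B) B.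
  have A1E : A1 =i A0.
    move=> k; rewrite /A1 -filter_mask mem_filter/=.
    by case: (boolP (k \in A0)) => //= /A0B ->.
  have sA1 : size A1 = size A0.
    by apply/perm_size/uniq_perm => //; rewrite /A1 -filter_mask filter_uniq.
  have pF : (f, A1) \in F.
    rewrite mem_filter/= sA1; apply/andP; split; first by rewrite -sA0 in sz.
    apply/allpairsP; exists (f, A1); split; rewrite ?mem_enum//.
    have sB : size (map (mem A0) B) == size B by rewrite size_map.
    by apply/mapP; exists (Tuple sB); rewrite ?mem_enum.
  have hs : (q f, S f A1) \in s by apply/mapP; exists (f, A1).
  have /negP := ys _ hs; apply => /=.
  have zq : (z - q f <= S f A1)%MS.
    by apply: submx_trans (addsmxSl _ _); exact: sub_direction.
  have -> : y - q f = (a j)^-1 *: ((a j *: (y - z) + \sum_(k <- A0) a k *: (pt k - z)) -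
      \sum_(k <- A0) a k *: (pt k - z)) + (z - q f).
    by rewrite addrK scalerA mulVf// scale1r addrA subrK.
  rewrite addmx_sub// scalemx_sub// addmx_sub ?eqmx_opp//.
    exact: submx_trans rel (addsmxSl _ _).
  rewrite big_seq summx_sub// => k kA0; rewrite scalemx_sub//.
  have -> : pt k - z = (pt k - q f) - (z - q f) by rewrite opprB addrA subrK.
  rewrite addmx_sub ?eqmx_opp//; apply: submx_trans (addsmxSr _ _).
  by apply: lspan_sub; apply/mapP; exists k; rewrite ?A1E.
move: rel; rewrite aj scale0r add0r => rel k kA.
have [->//|kj] := eqVneq k j.
have kA0 : k \in A0 by rewrite mem_rem_uniq// !inE kj.
by apply: (gB f z A0 a fz uA0 A0B _ rel k kA0); apply: leq_trans sz; rewrite -sA0 addSn.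
Qed.

Lemma generic_choice (c : J -> V) (e : R) l : uniq l -> 0 < e -> (forall j, U (c j)) ->
  exists pt, (forall j, j \in l -> `|c j - pt j| < e /\ U (pt j)) /\ generic pt l.
Proof.
move=> + e0 Uc; elim: l => [|j l IH] /=.
  move=> _; exists c; split=> // f x A a fx uA Al sz rel j jA.
  by have := Al j jA.
move=> /andP[jl ul]; have [pt [ptc gpt]] := IH ul.
have [y [cy Uy gy]] := generic_extend ul gpt (Uc j) e0 jl.
exists (fun k => if k == j then y else pt k); split=> // k.
by rewrite inE; case: eqVneq => [-> //|_ /= /ptc].
Qed.

End GenericPoints.

(** * Simplices that detect a single cell *)

Section LocalSimplex.
Context {R : realType} {N n : nat} {E : 'M[R]_(n, N)} {U : set 'rV[R]_N}.
Context {I : finType} {X : I -> set 'rV[R]_N}.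
Context {Fr : I -> seq 'rV[R]_N} {inc : I -> I -> int}.
Hypothesis LC : local_complex E U X Fr inc.
Local Notation V := 'rV[R]_N.
Local Notation m i := (dim (X i)).
Local Notation generic := (@generic R N n I X _).
Local Notation crossing := (@crossing R N n E I X Fr _).
Local Notation meets := (@meets R N I X _).

Lemma relint_meet f : exists x, U x /\ relint (X f) x.
Proof.
have [x [Ux fx]] := lc_meet LC f.
have [e e0 eU] := lc_open LC Ux.
have [y ry xy] := relint_near (lc_polytope LC f) fx e0.
exists y; split=> //; apply: eU; first by rewrite -normB_ball.
by apply: submx_trans (lc_direction LC f); apply: sub_direction => //; case: ry.
Qed.

Lemma lc_star_ball x : U x -> exists2 r : R, 0 < r & forall y, `|x - y| < r ->
  (y - x <= E)%MS -> U y /\ forall h, X h y -> X h x.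
Proof.
move=> Ux; have [e e0 eU] := lc_open LC Ux.
have /choice[r rP] : forall h, exists r : R, 0 < r /\ forall y, `|x - y| < r -> X h y -> X h x.
  move=> h; have [hx|nhx] := pselect (X h x); first by exists 1.
  have [r r0 rh] := compact_separation (@compact_set1 _ x)
    (polytope_closed (lc_polytope LC h)) (fun z => ltac:(move=> ->; exact: nhx)).
  by exists r; split=> // y xy hy; have := rh x y erefl xy.
pose r0 := \big[Num.min/e]_h r h.
have r00 : 0 < r0.
  rewrite /r0; elim/big_ind: _ => // [a b a0 b0|h _]; first by rewrite lt_min a0.
  by have [] := rP h.
exists r0 => // y xy yE; split.
  by apply: eU => //; apply: lt_le_trans xy _; exact: bigmin_le_id.
move=> h; have [_] := rP h; apply; apply: lt_le_trans xy _.
exact: bigmin_le_cond.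
Qed.

(** A small generic simplex of complementary dimension is placed around a relative interior point
    [x0] of [X f]. Any cell it meets contains [x0], so every such cell except [f] has larger
    dimension than [f]. Intersection numbers with it read off the coefficient of [f], which reduces
    identities between chains to simplicial ones. *)
Lemma local_simplex f : exists (pt : nat -> V) l (s : int),
  [/\ uniq l, (size l + m f)%N = n.+1, forall j, j \in l -> U (pt j),
      generic pt l & s != 0 /\ forall chi : I -> int,
        \sum_h chi h * crossing pt l h = s * chi f].
Proof.
have [x0 [Ux rx]] := relint_meet f.
have [r r0 rball] := lc_star_ball Ux.
have [e e0 ef] := relint_nbhd rx.
have fx : X f x0 by case: rx.
pose k := (n - m f)%N; pose B := iota 1 k.
have uB : uniq B by exact: iota_uniq.
have kf : (k + m f)%N = n by rewrite subnK// (dim_lc LC).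
(* With this bound the [k] displacements [u j] add up to at most [r / 2], so that [z0] below stays
   in the ball of radius [r]. *)
pose rho := r / 2 / k.+1%:R.
have rho0 : 0 < rho by rewrite !divr_gt0.
have rho_r : rho * k.+1%:R = r / 2 by rewrite divfK// pnatr_eq0.
have rhor : rho < r.
  rewrite (@le_lt_trans _ _ (r / 2))//; last by lra.
  by rewrite -rho_r ler_peMr ?(ltW rho0)// ler1n.
have [pt [ptc gpt]] := generic_choice LC (c := fun=> x0) uB rho0 (fun=> Ux).
pose u j := pt j - x0.
have uE j : j \in B -> (u j <= E)%MS.
  by move=> /ptc[_ Uj]; exact: (lc_span LC Ux Uj).
pose L := lspan [seq u j | j <- B].
pose G := col_mx (direction (X f)) L.
have indep (a : nat -> R) : ((\sum_(j <- B) a j *: u j)%R <= direction (X f))%MS ->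
    forall j, j \in B -> a j = 0.
  by move=> h; apply: (gpt f x0 B a fx uB) => //; rewrite size_iota kf.
have EG : (E <= G)%MS.
  have sG : (G <= E)%MS.
    rewrite -addsmxE addsmx_sub (lc_direction LC).
    apply/row_subP => i; rewrite rowK.
    have /mapP[j jB ->] := mem_nth 0 (ltn_ord i); exact: uE.
  have [_ <-] := mxrank_leqif_sup sG.
  rewrite eqn_leq mxrankS//= (eqP (lc_free LC)) /G -addsmxE mxrank_disjoint_sum; last first.
    apply/eqP; apply/rowV0P => v; rewrite sub_capmx => /andP[vW /submxP[D vD]].
    have [a aE _] := @lspan_mul R N nat 0%N u B D uB.
    rewrite vD aE in vW *; rewrite big_seq big1// => j jB.
    by rewrite (indep a vW j jB) scale0r.
  have -> : \rank L = k.
    rewrite -[RHS](size_iota 1 k) -(size_map u B); apply/eqP/inj_row_free => v v0.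
    have [a aE aD] := @lspan_mul R N nat 0%N u B v uB.
    apply/rowP => i; rewrite mxE aD; apply: indep.
      by rewrite -aE v0 sub0mx.
    by apply: mem_nth; rewrite -(size_map u).
  by rewrite addnC kf.
(* With [z0] as the last vertex, the barycenter of the simplex would be exactly [x0]. The generic
   vertex [y] near [z0] adds an error [w] along the cell and a combination of the [u j]. *)
pose z0 := x0 - \sum_(j <- B) u j.
have uB_small : `|\sum_(j <- B) u j| <= r / 2.
  apply: le_trans (ler_norm_sum _ _ _) _.
  apply: (@le_trans _ _ (\sum_(j <- B) rho)).
    rewrite big_seq [leRHS]big_seq; apply: ler_sum => j /ptc[h _].
    by rewrite /u distrC ltW.
  rewrite big_const_seq count_predT size_iota iter_addr addr0 -[_ *+ k]mulr_natr.
  by rewrite -rho_r ler_wpM2l ?(ltW rho0)// ler_nat.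
have z0E : (z0 - x0 <= E)%MS.
  rewrite /z0 addrAC subrr add0r eqmx_opp big_seq summx_sub// => j; exact: uE.
have xz0 : `|x0 - z0| <= r / 2 by rewrite /z0 opprB addrC subrK.
have Uz0 : U z0 by apply: (proj1 (rball z0 _ z0E)); apply: le_lt_trans xz0 _; lra.
pose M1 := lsubmx (pinvmx G) *m direction (X f).
have h2 : 0 < 2^-1 :> R by rewrite invr_gt0.
have e2 : 0 < e / 2 by rewrite divr_gt0.
have := near_mulmx_small (pinvmx G) z0 h2.
have := near_mulmx_small M1 z0 e2.
move=> /nbhs_ballP[eta1 /= eta10 ball1] /nbhs_ballP[eta2 /= eta20 ball2].
pose eta := Num.min (r / 2) (Num.min eta1 eta2).
have eta0 : 0 < eta by rewrite !lt_min divr_gt0// eta10.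
have B0 : 0%N \notin B by rewrite mem_iota.
have [y [+ Uy gy]] := generic_extend LC uB gpt Uz0 eta0 B0.
rewrite !lt_min => /and3P[yr y1 y2].
pose pt' : nat -> V := fun k => if k == 0%N then y else pt k.
rewrite -/pt' in gy; pose l := (0 :: B)%N.
have ptB j : j \in B -> pt' j = pt j.
  by rewrite mem_iota /pt'; case: j.
pose w := (y - z0) *m M1.
have [b bE bD] := @lspan_mul R N nat 0%N u B (rsubmx ((y - z0) *m pinvmx G)) uB.
have yE : y - z0 = w + \sum_(j <- B) b j *: u j.
  have yz0 : (y - z0 <= G)%MS by apply: submx_trans EG; exact: (lc_span LC Uz0 Uy).
  rewrite -{1}(mulmxKpV yz0) -{1}(hsubmxK ((y - z0) *m pinvmx G)) mul_row_col bE.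
  have -> // : w = lsubmx ((y - z0) *m pinvmx G) *m direction (X f).
  rewrite /w /M1 mulmxA; congr (_ *m _).
  by apply/rowP => i; rewrite !mxE; apply: eq_bigr => i' _; rewrite !mxE.
have b2 j : j \in B -> b j <= 2^-1.
  move=> jB; have jl : (index j B < size [seq u j | j <- B])%N.
    by rewrite size_map index_mem.
  have := bD (Ordinal jl); rewrite /= nth_index// => <-.
  rewrite mxE; apply: le_trans (ler_norm _) _; apply: ball2.
  by rewrite normB_ball.
have w2 : `|w| <= e / 2.
  rewrite /Num.norm/= mx_normrE; apply/bigmax_leP; split=> [|[i j] _]; first exact: ltW.
  by rewrite ord1; apply: ball1; rewrite normB_ball.
have wW : (w <= direction (X f))%MS by rewrite /w /M1 mulmxA submxMl.
(* The unnormalized weights 1 at [y] and [1 - b j] at [pt j] cancel all components along the [u j].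
   They are positive because [b j] is at most one half, and the remaining [w] is too small to leave
   the cell. *)
pose S := 1 + \sum_(j <- B) (1 - b j).
have S1 : 1 <= S.
  rewrite lerDl big_seq sumr_ge0// => j /b2; lra.
have S0 : 0 < S by lra.
pose a j := if j == 0%N then S^-1 else S^-1 * (1 - b j).
have aB j : j \in B -> a j = S^-1 * (1 - b j).
  by rewrite mem_iota /a; case: j.
have wa : weights a l.
  split=> [j|].
    rewrite inE => /orP[/eqP ->|jB]; first by rewrite invr_ge0 ltW.
    rewrite aB// mulr_ge0// ?invr_ge0 ?(ltW S0)//; have := b2 j jB; lra.
  rewrite big_cons (_ : \sum_(j <- B) a j = S^-1 * \sum_(j <- B) (1 - b j)).
    by rewrite /a eqxx -[X in X + _]mulr1 -mulrDr mulVf// gt_eqF.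
  by rewrite mulr_sumr big_seq [RHS]big_seq; apply: eq_bigr => j /aB.
have ca : comb pt' a l = x0 + S^-1 *: w.
  have -> : comb pt' a l = x0 + \sum_(j <- l) a j *: (pt' j - x0).
    by rewrite comb_sub wa.2 scale1r addrC subrK.
  congr (_ + _); rewrite big_cons {1}/pt' {1}/a !eqxx.
  have -> : \sum_(j <- B) a j *: (pt' j - x0) = S^-1 *: \sum_(j <- B) (u j - b j *: u j).
    rewrite scaler_sumr big_seq [RHS]big_seq; apply: eq_bigr => j jB.
    by rewrite aB// ptB// -/(u j) -scalerA scalerBl scale1r.
  rewrite -scalerDr sumrB; congr (_ *: _).
  have -> : y - x0 = (y - z0) + (z0 - x0) by rewrite addrA subrK.
  rewrite yE /z0 (addrAC x0) subrr add0r.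
  by rewrite addrA subrK addrK.
have fa : X f (comb pt' a l).
  suff: relint (X f) (comb pt' a l) by case.
  rewrite ca; apply: ef; last by rewrite addrC addKr scalemx_sub.
  rewrite opprD addrA subrr sub0r normrN normrZ ger0_norm ?invr_ge0 ?(ltW S0)//.
  apply: (@le_lt_trans _ _ (1 * (e / 2))); last by lra.
  by apply: ler_pM => //; rewrite ?invr_ge0 ?(ltW S0)// invf_le1.
have ptU j : j \in l -> U (pt' j).
  by rewrite inE => /orP[/eqP -> //|jB]; rewrite ptB//; case: (ptc j jB).
have ptr j : j \in l -> `|x0 - pt' j| < r.
  rewrite inE => /orP[/eqP ->|jB]; last by rewrite ptB//; apply: lt_trans (ptc j jB).1 rhor.
  rewrite /pt' eqxx (_ : x0 - y = (x0 - z0) + (z0 - y)); last by rewrite addrA subrK.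
  by apply: le_lt_trans (ler_normD _ _) _; lra.
have ul : uniq l by rewrite /= mem_iota uB.
have sl : (size l + m f)%N = n.+1 by rewrite /= size_iota addSn kf.
have mf : meets pt' l f by exists a.
exists pt', l, (sgz (@orient R N n E I Fr _ pt' l f)); split=> //.
split; first by rewrite sgz_eq0 (orient_neq0 LC).
move=> chi; rewrite (bigD1 f)//= big1 ?addr0; last first.
  move=> h hf; rewrite !crossingE.
  case: eqP => /= sh; last by rewrite mulr0.
  case: asboolP => [[c [wc hc]]|]; last by rewrite mulr0.
  have mh : m h = m f by apply: (@addnI (size l)); rewrite sl.
  pose C z := `|x0 - z| < r /\ U z.
  have [cr cU] : C (comb pt' c l).
    apply: (convex_comb (C := C)) => [x y' t t0 t1 [xr xU] [yr' yU]|j jl|//]; last first.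
      by split; [exact: ptr|exact: ptU].
    split; last exact: (lc_convex LC).
    have -> : x0 - ((1 - t) *: x + t *: y') = (1 - t) *: (x0 - x) + t *: (x0 - y').
      by apply/rowP => i; rewrite !mxE; ring.
    apply: le_lt_trans (ler_normD _ _) _; rewrite !normrZ ger0_norm ?subr_ge0// ger0_norm//.
    have [->|t0'] := eqVneq t 0; first by rewrite subr0 mul1r mul0r addr0.
    have : t * `|x0 - y'| < t * r by rewrite ltr_pM2l// lt_neqAle eq_sym t0'.
    have : (1 - t) * `|x0 - x| <= (1 - t) * r by rewrite ler_wpM2l ?subr_ge0// ltW.
    lra.
  have [_ /(_ h hc) hx] := rball _ cr (lc_span LC Ux cU).
  have fh : f <> h by move=> e'; rewrite e' eqxx in hf.
  by have := lc_face_dim LC Ux rx hx fh; rewrite mh ltnn.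
by rewrite mulrC !crossingE sl eqxx asboolT.
Qed.

End LocalSimplex.

(** * The contraction of a local complex *)

Section SimplicialCoboundary.
Context {J : eqType}.
Implicit Types (w : seq J -> int) (l : seq J).

Definition scobound w l := \sum_(j <- l) (-1) ^+ index j l * w (rem j l).

Lemma scobound_cons w x l : x \notin l ->
  scobound w (x :: l) = w l - scobound (fun l' => w (x :: l')) l.
Proof.
move=> xl; rewrite /scobound big_cons /= eqxx mul1r -sumrN; congr (_ + _).
rewrite big_seq [RHS]big_seq; apply: eq_bigr => j jl.
have xj : x == j = false by apply: contraNF xl => /eqP ->.
by rewrite xj exprS mulN1r mulNr.
Qed.

Lemma eq_scobound w w' l : (forall j, j \in l -> w (rem j l) = w' (rem j l)) ->
  scobound w l = scobound w' l.
Proof. by move=> h; rewrite /scobound big_seq [RHS]big_seq; apply: eq_bigr => j /h ->. Qed.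

Lemma scoboundB w w' l : scobound (fun l' => w l' - w' l') l = scobound w l - scobound w' l.
Proof. by rewrite /scobound -sumrB; apply: eq_bigr => j _; rewrite mulrBr. Qed.

Lemma scobound_sum (K : finType) (a : K -> int) (w : K -> seq J -> int) l :
  scobound (fun l' => \sum_k a k * w k l') l = \sum_k a k * scobound (w k) l.
Proof.
rewrite /scobound; under eq_bigr do rewrite mulr_sumr.
rewrite exchange_big; apply: eq_bigr => k _; rewrite mulr_sumr.
by apply: eq_bigr => j _; rewrite mulrCA.
Qed.

Lemma scobound_sqr w l : uniq l -> scobound (scobound w) l = 0.
Proof.
elim: l w => [|x l IH] w /=; first by rewrite /scobound big_nil.
move=> /andP[xl ul]; rewrite scobound_cons//.
rewrite (@eq_scobound (fun l' => scobound w (x :: l')) (fun l' => w l' - scobound (fun l'' => w (x :: l'')) l')); last first.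
  by move=> j jl; rewrite scobound_cons//; apply: contra xl => /mem_rem.
by rewrite scoboundB IH// subr0 subrr.
Qed.

End SimplicialCoboundary.

(** * Boundary, fundamental class and cofacets in a local complex *)

Section LocalBoundary.
Context {R : realType} {N n : nat} {E : 'M[R]_(n, N)} {U : set 'rV[R]_N}.
Context {I : finType} {X : I -> set 'rV[R]_N}.
Context {Fr : I -> seq 'rV[R]_N} {inc : I -> I -> int}.
Hypothesis LC : local_complex E U X Fr inc.
Local Notation V := 'rV[R]_N.
Local Notation hv := (hvec E).
Local Notation hp := (hpt E).
Local Notation m i := (dim (X i)).
Local Notation generic := (@generic R N n I X _).
Local Notation crossing := (@crossing R N n E I X Fr _).
Local Notation meets := (@meets R N I X _).
Local Notation lfacet := (@lfacet R N I X).

Lemma inc_neq0 g f : inc g f != 0 -> lfacet f g.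
Proof. by move=> h; apply: contrapT => nf; rewrite (lc_incidence0 LC)// eqxx in h. Qed.

Lemma crossing_scobound (J : eqType) (pt : J -> V) l g : uniq l ->
  (forall j, j \in l -> U (pt j)) -> generic pt l -> (0 < size l)%N ->
  \sum_f inc g f * crossing pt l f =
  (-1) ^+ (size l).-1 * scobound (fun l' => crossing pt l' g) l.
Proof.
move=> ul ptU gl l0; have [lg|lg] := eqVneq (size l + m g)%N n.+2.
  exact: (crossing_boundary LC ul ptU gl lg).
rewrite /scobound big1 => [|f _].
  rewrite big_seq big1 ?mulr0// => j jl; rewrite !crossingE size_rem//.
  case: eqP => //= e; last by rewrite mulr0.
  by case/eqP: lg; rewrite -(prednK l0) addSn e.
have [[_ dfg]|nf] := pselect (lfacet f g); last by rewrite (lc_incidence0 LC)// mul0r.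
rewrite !crossingE; case: eqP => /= [e|_]; last by rewrite mulr0.
by case/eqP: lg; rewrite dfg addnS e.
Qed.

(** Pairing with the simplex that detects [f] turns the double boundary into a double simplicial
    coboundary. *)
Lemma boundary_sqr h f : \sum_g inc h g * inc g f = 0.
Proof.
have [pt [l [s [ul sl ptU gl [s0 det]]]]] := local_simplex LC f.
apply: (mulfI s0); rewrite mulr0 -(det (fun f' => \sum_g inc h g * inc g f')).
have [mh|mh] := eqVneq (m h) (m f).+2; last first.
  apply: big1 => f' _; rewrite !crossingE; case: eqP => /= [e|_]; last by rewrite mulr0.
  rewrite big1 ?mul0r// => g _.
  have [h1|/inc_neq0[_ e1]] := eqVneq (inc h g) 0; first by rewrite h1 mul0r.
  have [h2|/inc_neq0[_ e2]] := eqVneq (inc g f') 0; first by rewrite h2 mulr0.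
  by case/eqP: mh; rewrite e1 e2; congr _.+2; apply: (@addnI (size l)); rewrite e sl.
have l0 : (0 < size l)%N.
  by have := dim_lc LC h; rewrite mh => hn; clear -hn sl; lia.
under eq_bigr do rewrite mulr_suml.
rewrite exchange_big /=.
under eq_bigr => g _ do under eq_bigr => f' _ do rewrite -mulrA.
under eq_bigr => g _ do rewrite -mulr_sumr crossing_scobound// mulrCA.
rewrite -mulr_sumr -scobound_sum; apply/eqP; rewrite mulf_eq0; apply/orP; right.
rewrite (@eq_scobound _ _ (fun l' => (-1) ^+ (size l).-2 * scobound (fun l' => crossing pt l' h) l')).
  rewrite (_ : scobound _ l = (-1) ^+ (size l).-2 * scobound (scobound (fun l' => crossing pt l' h)) l).
    by rewrite scobound_sqr// mulr0.
  by rewrite {1 2}/scobound mulr_sumr; apply: eq_bigr => j _; rewrite mulrCA.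
move=> j jl; rewrite crossing_scobound ?size_rem// ?rem_uniq//.
- by move=> k /mem_rem; exact: ptU.
- by apply: generic_sub gl => k /mem_rem.
- by have := dim_lc LC h; rewrite mh; move=> hn; clear -hn sl; lia.
Qed.

(** The fundamental class of [U]: the sign compares the frame of a top cell with the basis [E]. *)
Definition lsigma f : int := if m f == n then sgz (detl (hp 0 :: map hv (Fr f))) else 0.

Lemma top_direction f : m f = n -> (E <= direction (X f))%MS.
Proof.
move=> mf; have [_ <-] := mxrank_leqif_sup (lc_direction LC f).
by rewrite (eqP (lc_free LC)); apply/eqP.
Qed.

Lemma orient_top (J : eqType) (pt : J -> V) j f : m f = n ->
  @orient R N n E I Fr J pt [:: j] f = detl (hp 0 :: map hv (Fr f)).
Proof.
move=> mf; rewrite /orient /= -[X in X :: _](_ : 1 *: hv (pt j) + hp 0 = _); last first.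
  by rewrite scale1r /hvec /hpt mul0mx add_row_mx add0r addr0.
rewrite -[LHS]/(detl ([::] ++ _ :: _)) detl_linear//= mul1r.
(* The point itself need not lie in the row space of [E]; [p] does, and it has the same
   coordinates. *)
pose p := pt j *m pinvmx E *m E.
have hpE : hv p = hv (pt j).
  by rewrite /hvec /p mulmxKp ?(lc_free LC).
have [a aE] := lc_frame_span LC (submx_trans (submxMl (pt j *m pinvmx E) E) (top_direction mf)).
rewrite -hpE /p aE hvec_sum.
have -> : \sum_(k < m f) a k *: hv (Fr f)`_k =
    \sum_(k < size (map hv (Fr f))) a k *: (map hv (Fr f))`_k.
  rewrite size_map (lc_frame_size LC); apply: eq_bigr => k _.
  by rewrite (nth_map 0) ?(lc_frame_size LC).
have -> : detl (\sum_(k < size (map hv (Fr f))) a k *: (map hv (Fr f))`_k :: map hv (Fr f)) = 0.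
  by apply: (@detl_dependent _ _ [::]); rewrite size_map (lc_frame_size LC) mf.
by rewrite add0r.
Qed.

Lemma crossing_top (J : eqType) (pt : J -> V) j f : m f = n -> X f (pt j) ->
  crossing pt [:: j] f = lsigma f.
Proof.
move=> mf fj; rewrite !crossingE /= mf eqxx asboolT ?orient_top// /lsigma ?mf ?eqxx//.
exists (fun=> 1); rewrite /comb big_seq1 scale1r; split=> //.
by split=> [//|]; rewrite big_seq1.
Qed.

Lemma crossing_top0 (J : eqType) (pt : J -> V) j f : ~ X f (pt j) -> crossing pt [:: j] f = 0.
Proof.
move=> nf; rewrite !crossingE asboolF ?andbF// => -[a [[_ a1] fa]]; apply: nf.
by move: fa a1; rewrite /comb !big_seq1 => fa a1; rewrite a1 scale1r in fa.
Qed.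

Lemma lsigma_sqr f : m f = n -> lsigma f * lsigma f = 1.
Proof.
move=> mf; have [pt [l [s [ul sl ptU gl [s0 det]]]]] := local_simplex LC f.
have := det (fun h => (h == f)%:R); rewrite (bigD1 f)//= eqxx mul1r mulr1 big1 ?addr0; last first.
  by move=> h /negbTE ->; rewrite mul0r.
have : size l = 1%N by move: sl; rewrite mf; lia.
case: (l) => [//|j [|//]] _ h; move: s0; rewrite -h !crossingE /= mf eqxx /=.
case: ifP => //= _; rewrite orient_top// sgz_eq0 => /sgz_sqr.
by rewrite /lsigma mf eqxx.
Qed.

Lemma lsigma_top f : lsigma f != 0 -> m f = n.
Proof.
by move=> h; apply/eqP/negPn/negP => /negbTE mf; move: h; rewrite /lsigma mf eqxx.
Qed.

(** By genericity the point lies in no cell below the top dimension, hence in exactly one cell,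
    where its crossing number is the coefficient of the fundamental class. *)
Lemma sum_crossing_top (J : eqType) (pt : J -> V) j : generic pt [:: j] -> U (pt j) ->
  \sum_f lsigma f * crossing pt [:: j] f = 1.
Proof.
move=> gj Uj; have [f rf] := lc_cover LC Uj; have fj : X f (pt j) by case: rf.
have mf : m f = n.
  apply/eqP; rewrite eqn_leq (dim_lc LC) leqNgt; apply/negP => mf.
  have := gj f (pt j) [:: j] (fun=> 1) fj isT (fun=> id) mf.
  rewrite big_seq1 subrr scaler0 sub0mx => /(_ isT j (mem_head _ _))/eqP.
  by rewrite oner_eq0.
rewrite (bigD1 f)//= crossing_top// lsigma_sqr// big1 ?addr0// => h hf.
have [hj|hj] := pselect (X h (pt j)); last by rewrite crossing_top0// mulr0.
have fh : f <> h by move=> e; rewrite e eqxx in hf.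
have := lc_face_dim LC Uj rf hj fh; have := dim_lc LC h; rewrite mf => h1 h2.
by have := leq_trans h2 h1; rewrite ltnn.
Qed.

(** In the only relevant dimension the simplex detecting [f] is an edge, and each of its ends has
    total intersection number 1 with the fundamental class. *)
Lemma boundary_sigma f : \sum_g lsigma g * inc g f = 0.
Proof.
have [pt [l [s [ul sl ptU gl [s0 det]]]]] := local_simplex LC f.
apply: (mulfI s0); rewrite mulr0 -(det (fun f' => \sum_g lsigma g * inc g f')).
have [mf|mf] := eqVneq n (m f).+1; last first.
  apply: big1 => f' _; rewrite !crossingE; case: eqP => /= [e|_]; last by rewrite mulr0.
  rewrite big1 ?mul0r// => g _.
  have [h1|/lsigma_top e1] := eqVneq (lsigma g) 0; first by rewrite h1 mul0r.
  have [h2|/inc_neq0[_ e2]] := eqVneq (inc g f') 0; first by rewrite h2 mulr0.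
  case/eqP: mf; rewrite -e1 e2; congr _.+1; apply: (@addnI (size l)); by rewrite e sl.
under eq_bigr do rewrite mulr_suml.
rewrite exchange_big /=.
under eq_bigr => g _ do under eq_bigr => f' _ do rewrite -mulrA.
have l0 : (0 < size l)%N.
  by move: sl; rewrite mf; case: (size l) => // /eqP; rewrite add0n -addn2 -{1}[m f]addn0 eqn_add2l.
under eq_bigr => g _ do rewrite -mulr_sumr crossing_scobound// mulrCA.
rewrite -mulr_sumr -scobound_sum; apply/eqP; rewrite mulf_eq0; apply/orP; right.
have : size l = 2%N by apply: (@addIn (m f)); rewrite sl mf.
case: (l) ul ptU gl => [|i [|j [|]]]// ul ptU gl _.
have ij : i \notin [:: j] by move: ul; rewrite /= andbT.
rewrite scobound_cons// /scobound big_seq1 /= !eqxx mul1r !sum_crossing_top ?subrr//.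
all: first [by apply: ptU; rewrite !inE eqxx ?orbT
  | by apply: generic_sub gl => k; rewrite !inE => ->; rewrite ?orbT].
Qed.

(** A proper coface [h] of minimal dimension is a cofacet. If the dimension jumped by two or more, a
    segment in general position leaving [h] near [x0] would exit through a smaller coface of [f]. By
    minimality that coface is [f] itself, but the exit point can be kept out of the affine hull of
    [X f]. *)
Lemma cofacet_exists f : (m f < n)%N -> exists g, lfacet f g.
Proof.
move=> mf; have [x0 [Ux rx]] := relint_meet LC f.
have [r r0 rball] := lc_star_ball LC Ux.
have fx : X f x0 by case: rx.
have [h0 [fh0 h0f]] : exists h, X f `<=` X h /\ h <> f.
  have [|y [xy yE yf]] := @avoid_flats _ _ _ E [:: (x0, direction (X f))] x0 r r0.
    move=> p; rewrite inE => /eqP -> /=; apply/negP => /mxrankS.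
    by rewrite (eqP (lc_free LC)) leqNgt mf.
  have [Uy hyx] := rball y xy yE; have [h rh] := lc_cover LC Uy.
  have hy : X h y by case: rh.
  exists h; split; first by apply: (lc_face LC Ux rx); exact: hyx.
  move=> e; have := yf _ (mem_head _ _) => /negP; apply => /=.
  by apply: sub_direction => //; rewrite -e.
pose P h := `[< X f `<=` X h >] && (h != f).
have P0 : P h0 by rewrite /P asboolT//; apply/eqP.
case: (arg_minnP (fun h => m h) P0) => h /andP[/asboolP fh /eqP hf] hmin.
have hx : X h x0 by exact: fh.
have fh' : f <> h by move=> e; exact: hf.
have mfh := lc_face_dim LC Ux rx hx fh'.
exists h; split=> //; apply/eqP; rewrite eqn_leq mfh andbT leqNgt; apply/negP => mfh2.
have ph := lc_polytope LC h.
have [y ry xy] := relint_near ph hx r0; rewrite normB_ball in xy.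
have hy : X h y by case: ry.
(* The reflection of [y] in [x0] is outside [X h], because [x0] is not relatively interior to
   [X h]. *)
pose z0 := x0 + 1 *: (x0 - y).
have nz0 : ~ X h z0.
  move=> hz; have rhx := relint_extend ph ry ltr01 hz.
  exact: fh' (lc_disjoint LC Ux rx rhx).
have xz0 : `|x0 - z0| < r by rewrite /z0 scale1r opprD addrA subrr sub0r normrN.
have [e e0 ez] := compact_separation (@compact_set1 _ z0) (polytope_closed ph)
    (fun z => ltac:(move=> ->; exact: nz0)).
have xyh : (x0 - y <= direction (X h))%MS by exact: sub_direction.
pose e' := Num.min e (r - `|x0 - z0|).
have e'0 : 0 < e' by rewrite lt_min e0 subr_gt0.
(* If the segment from [y] to [z] meets the hull of [X f], then [z - y] lies in the span of
   [direction (X f)] and [x0 - y]. In codimension at least two this is a proper subspace of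
   [direction (X h)]. *)
have [|z [+ zz0 zf]] := @avoid_flats _ _ _ (direction (X h))
    [:: (y, (direction (X f) + (x0 - y))%MS)] z0 e' e'0.
  move=> p; rewrite inE => /eqP -> /=; apply/negP => /mxrankS; apply/negP.
  rewrite -ltnNge; apply: leq_ltn_trans mfh2.
  have [+ _] := mxrank_adds_leqif (direction (X f)) (x0 - y).
  by move/leq_trans; apply; rewrite -[(m f).+1]addn1 leq_add2l rank_leq_row.
rewrite lt_min => /andP[ze zr].
have nz : ~ X h z by exact: (ez z0 z erefl ze).
have zyh : (z - y <= direction (X h))%MS.
  have -> : z - y = (z - z0) + 2 *: (x0 - y).
    by rewrite /z0; apply/rowP => i; rewrite !mxE; ring.
  by rewrite addmx_sub// scalemx_sub.
have [t [t0 t1 ht nrt]] := relint_exit ph ry nz zyh.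
set xs := y + t *: (z - y) in ht nrt.
have xxs : `|x0 - xs| < r.
  have -> : x0 - xs = (1 - t) *: (x0 - y) + t *: (x0 - z).
    by rewrite /xs; apply/rowP => i; rewrite !mxE; ring.
  have xz : `|x0 - z| < r.
    rewrite (_ : x0 - z = (x0 - z0) + (z0 - z)); last by rewrite addrA subrK.
    by apply: le_lt_trans (ler_normD _ _) _; lra.
  apply: le_lt_trans (ler_normD _ _) _; rewrite !normrZ !gtr0_norm ?subr_gt0//.
  have : t * `|x0 - z| < t * r by rewrite ltr_pM2l.
  have : (1 - t) * `|x0 - y| < (1 - t) * r by rewrite ltr_pM2l// subr_gt0.
  lra.
have xsE : (xs - x0 <= E)%MS.
  by apply: submx_trans (lc_direction LC h); exact: sub_direction.
have [Uxs xsx] := rball xs xxs xsE.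
have [k rk] := lc_cover LC Uxs; have kxs : X k xs by case: rk.
have kh : k <> h by move=> ekh; apply: nrt; rewrite -ekh.
have mkh := lc_face_dim LC Uxs rk ht kh.
have fk : X f `<=` X k by apply: (lc_face LC Ux rx); exact: xsx.
have [ekf|/eqP kf] := pselect (k = f); last first.
  have := hmin k; rewrite /P asboolT// kf => /(_ isT) h1.
  by have := leq_trans mkh h1; rewrite ltnn.
have := zf _ (mem_head _ _) => /negP; apply => /=.
have -> : z - y = t^-1 *: ((xs - x0) + (x0 - y)).
  by rewrite /xs; apply/rowP => i; rewrite !mxE; field; rewrite gt_eqF.
rewrite scalemx_sub// addmx_sub//; last exact: addsmxSr.
by apply: submx_trans (addsmxSl _ _); apply: sub_direction => //; rewrite -ekf.
Qed.

End LocalBoundary.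

(** * Dual cells, cones and the homotopy *)

Section LocalHomotopy.
Context {R : realType} {N n : nat} {E : 'M[R]_(n, N)} {U : set 'rV[R]_N}.
Context {I : finType} {X : I -> set 'rV[R]_N}.
Context {Fr : I -> seq 'rV[R]_N} {inc : I -> I -> int}.
Hypothesis LC : local_complex E U X Fr inc.
Local Notation V := 'rV[R]_N.
Local Notation m i := (dim (X i)).
Local Notation generic := (@generic R N n I X _).
Local Notation crossing := (@crossing R N n E I X Fr _).
Local Notation lfacet := (@lfacet R N I X).
Local Notation sigma := (@lsigma R N n E I X Fr).

(* The dual cell of f as a chain of simplices b_f, b_g1, b_g2, and so on, over
   the flags f < g1 < g2 < ..., here as a functional on simplicial cochains. *)
Fixpoint dual k (w : seq (option I) -> int) f : int :=
  if k is k'.+1 then \sum_g inc g f * dual k' (fun l => w (Some f :: l)) g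
  else sigma f * w [:: Some f].

Fixpoint flag k f (l : seq I) : Prop :=
  if k is k'.+1 then exists g l', [/\ l = f :: l', lfacet f g & flag k' g l']
  else l = [:: f].

Lemma flag_facts k f l : flag k f l ->
  [/\ forall h, h \in l -> X f `<=` X h /\ (m f <= m h)%N, uniq l,
      size l = k.+1 & f \in l].
Proof.
elim: k f l => [|k IH] f l /=.
  move=> ->; split=> //; last exact: mem_head.
  by move=> h; rewrite inE => /eqP ->; split.
move=> [g [l' [-> [fg dfg] /IH[l'f ul' sl' gl']]]]; split.
- move=> h; rewrite inE => /orP[/eqP ->|/l'f[gh mgh]]; first by split.
  by split; [exact: subset_trans gh|rewrite (leq_trans _ mgh)// dfg].
- rewrite /= ul' andbT; apply/negP => /l'f[_]; by rewrite dfg ltnn.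
- by rewrite /= sl'.
- by rewrite mem_head.
Qed.

Lemma eq_dual k w w' f : (forall l, flag k f l -> w (map Some l) = w' (map Some l)) ->
  dual k w f = dual k w' f.
Proof.
elim: k w w' f => [|k IH] w w' f h /=; first by rewrite (h [:: f]).
apply: eq_bigr => g _; have [->|/(inc_neq0 LC) fg] := eqVneq (inc g f) 0.
  by rewrite !mul0r.
congr (_ * _); apply: IH => l gl; apply: (h (f :: l)).
by exists g, l.
Qed.

Lemma dual_sub k w w' f : dual k (fun l => w l - w' l) f = dual k w f - dual k w' f.
Proof.
elim: k w w' f => [|k IH] w w' f /=; first by rewrite mulrBr.
rewrite -sumrB; apply: eq_bigr => g _.
by rewrite (IH (fun l => w (Some f :: l)) (fun l => w' (Some f :: l))) mulrBr.
Qed.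

Lemma dual_sum (K : finType) (a : K -> int) (w : K -> seq (option I) -> int) k f :
  dual k (fun l => \sum_i a i * w i l) f = \sum_i a i * dual k (w i) f.
Proof.
elim: k w f => [|k IH] w f /=.
  by rewrite mulr_sumr; apply: eq_bigr => i _; rewrite mulrCA.
under eq_bigr do rewrite (IH (fun i l => w i (Some f :: l))) mulr_sumr.
rewrite exchange_big; apply: eq_bigr => i _; rewrite mulr_sumr.
by apply: eq_bigr => g _; rewrite mulrCA.
Qed.

Lemma dual_eq0 k w f : (forall l, flag k f l -> w (map Some l) = 0) -> dual k w f = 0.
Proof.
move=> h; rewrite (@eq_dual k w (fun l => w l - w l)) => [|l /h ->]; last by rewrite subrr.
by rewrite dual_sub subrr.
Qed.

(** Stokes for dual cells: deleting the first vertex of the flags leaves the dual cells of the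
    cofacets. Deleting an inner vertex cancels by [boundary_sqr], deleting the last one by
    [boundary_sigma]. *)
Lemma dual_scobound k w f : (m f + k.+1)%N = n ->
  dual k.+1 (scobound w) f = \sum_g inc g f * dual k w g.
Proof.
elim: k w f => [|k IH] w f mf.
  transitivity (\sum_g (inc g f * (sigma g * w [:: Some g]) -
      w [:: Some f] * (sigma g * inc g f))).
    apply: eq_bigr => g _; have [->|/(inc_neq0 LC)[_ dfg]] := eqVneq (inc g f) 0.
      by rewrite !(mul0r, mulr0) subr0.
    have fg : Some f \notin [:: Some g].
      by rewrite inE; apply/eqP => -[e]; move: dfg; rewrite e => /eqP; rewrite -addn1 -{1}[m g]addn0 eqn_add2l.
    by rewrite /= scobound_cons// /scobound big_seq1 /= eqxx; ring.
  rewrite sumrB -mulr_sumr (boundary_sigma LC) mulr0 subr0.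
  by apply: eq_bigr => g _.
have E1 g : inc g f != 0 -> dual k.+1 (fun l => scobound w (Some f :: l)) g =
    dual k.+1 w g - dual k.+1 (scobound (fun l => w (Some f :: l))) g.
  move=> /(inc_neq0 LC)[fg dfg]; rewrite -dual_sub; apply: eq_dual => l /flag_facts[lf _ _ _].
  rewrite scobound_cons//; apply/negP => /mapP[h hl [e]].
  by have [_] := lf h hl; rewrite -e dfg ltnn.
have -> : dual k.+2 (scobound w) f =
    \sum_g (inc g f * dual k.+1 w g -
    inc g f * \sum_h inc h g * dual k (fun l => w (Some f :: l)) h).
  rewrite -[LHS]/(\sum_g inc g f * dual k.+1 (fun l => scobound w (Some f :: l)) g).
  apply: eq_bigr => g _; have [->|h] := eqVneq (inc g f) 0; first by rewrite !mul0r subrr.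
  have [_ dfg] := inc_neq0 LC h.
  by rewrite -mulrBr -IH ?dfg ?addSnnS// -E1.
rewrite sumrB [X in _ - X](_ : _ = 0) ?subr0//.
under eq_bigr do rewrite mulr_sumr.
rewrite exchange_big big1// => h _.
under eq_bigr do rewrite mulrA [inc _ _ * _]mulrC.
by rewrite -mulr_suml (boundary_sqr LC) mul0r.
Qed.

Section Simplices.
(** [pt (Some i)] plays the perturbed barycenter of the cell [i], and [pt None] the base point of
    the cones. *)
Variable pt : option I -> V.
Hypothesis ptU : forall j, U (pt j).
Hypothesis ptG : generic pt (enum [set: option I]).
Hypothesis pt_avoid : forall k f f' l, flag k f l -> m f' = m f -> f' <> f ->
  crossing pt (map Some l) f' = 0.
Hypothesis pt_top : forall f, m f = n -> X f (pt (Some f)).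

Definition sgnbin k : int := (-1) ^+ 'C(k, 2).

Lemma sgnbinS k : sgnbin k.+1 = (-1) ^+ k * sgnbin k.
Proof. by rewrite /sgnbin binS bin1 exprD mulrC. Qed.

(* The sign turns the boundary of chains into the simplicial coboundary. *)
Definition pairing (chi : I -> int) l : int :=
  sgnbin (size l) * \sum_f chi f * crossing pt l f.

Lemma pairing_sum (K : finType) (a : K -> int) (chi : K -> I -> int) l :
  pairing (fun f => \sum_i a i * chi i f) l = \sum_i a i * pairing (chi i) l.
Proof.
rewrite /pairing; under eq_bigr do rewrite mulr_suml.
rewrite exchange_big mulr_sumr; apply: eq_bigr => i _.
by rewrite mulrCA; congr (_ * _); rewrite mulr_sumr; apply: eq_bigr => f _; rewrite mulrA.
Qed.

Lemma pairing_boundary chi l : uniq l -> (0 < size l)%N ->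
  pairing (fun f => \sum_g chi g * inc g f) l = scobound (pairing chi) l.
Proof.
move=> ul l0; rewrite /pairing.
under eq_bigr do rewrite mulr_suml.
rewrite exchange_big /=.
under eq_bigr => g _ do under eq_bigr => f _ do rewrite -mulrA.
have cs g : \sum_f inc g f * crossing pt l f =
    (-1) ^+ (size l).-1 * scobound (fun l' => crossing pt l' g) l.
  apply: (crossing_scobound LC) => //.
  by apply: generic_sub ptG => j; rewrite mem_enum inE.
under eq_bigr do rewrite -mulr_sumr cs.
rewrite (@eq_scobound _ _ (fun l' => \sum_f (sgnbin (size l).-1 * chi f) * crossing pt l' f)); last first.
  move=> j jl; rewrite size_rem// mulr_sumr; apply: eq_bigr => f _; by rewrite mulrA.
rewrite scobound_sum mulr_sumr; apply: eq_bigr => g _.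
rewrite -{1}(prednK l0) sgnbinS.
have s2 : (-1 : int) ^+ (size l).-1 * (-1) ^+ (size l).-1 = 1.
  by rewrite -exprD addnn -mul2n exprM sqrrN !expr1n.
transitivity (((-1) ^+ (size l).-1 * (-1) ^+ (size l).-1) * (sgnbin (size l).-1 * chi g *
  scobound (fun l' => crossing pt l' g) l)); first by ring.
by rewrite s2 mul1r.
Qed.

Let delta f : I -> int := fun h => (h == f)%:R.

Lemma pairing_delta f l : pairing (delta f) l = sgnbin (size l) * crossing pt l f.
Proof.
rewrite /pairing /delta (bigD1 f)//= eqxx mul1r big1 ?addr0// => h /negbTE ->.
by rewrite mul0r.
Qed.

(** The sign is found by induction on the codimension. For a cofacet [g] of [f], pair the boundary
    of [g] with the dual cell of [f]: by Stokes the result is [inc g f]. On the other hand [f] is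
    the only facet of [g] met by that dual cell, so the factor [inc g f] can be cancelled. *)
Lemma pairing_dual k f f' : (m f + k)%N = n -> dual k (pairing (delta f')) f = (f' == f)%:R.
Proof.
elim: k f f' => [|k IH] f f' mf; have [->|ff] := eqVneq f' f.
- rewrite addn0 in mf; rewrite /= pairing_delta /= (crossing_top LC)//; last exact: pt_top.
  by rewrite /sgnbin bin_small// expr0 mul1r (lsigma_sqr LC).
- rewrite (@eq_dual _ _ (fun=> 0)) /= ?mulr0// => l lf; rewrite pairing_delta.
  have [e|e] := eqVneq (m f') (m f).
    by rewrite (pt_avoid (k := 0%N) lf)// ?mulr0//; apply/eqP.
  rewrite !crossingE; case: eqP; rewrite ?mulr0//= size_map => h; exfalso; move/eqP: e; apply.
  by move: h mf; rewrite lf /=; lia.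
- have [|g fg] := cofacet_exists LC (f := f); first by rewrite -mf addnS ltnS leq_addr.
  have [sfg dfg] := fg; have i2 := lc_incidence_sqr LC sfg dfg.
  have mg : (m g + k)%N = n by rewrite dfg addSnnS.
  have i0 : inc g f != 0 by apply: contra_eq_neq i2 => ->; rewrite mul0r eq_sym oner_neq0.
  have E1 : dual k.+1 (pairing (fun h => \sum_g' delta g g' * inc g' h)) f = inc g f.
    rewrite (@eq_dual _ _ (scobound (pairing (delta g)))); last first.
      move=> l /flag_facts[_ ul sl _]; rewrite pairing_boundary//; last by rewrite size_map sl.
      by rewrite map_inj_uniq// => ? ? [].
    rewrite dual_scobound// (bigD1 g)//= IH// eqxx mulr1 big1 ?addr0// => g' g'g.
    have [->|/(inc_neq0 LC)[_ dfg']] := eqVneq (inc g' f) 0; first by rewrite mul0r.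
    by rewrite IH ?dfg' ?addSnnS// eq_sym (negbTE g'g) mulr0.
  have E2 : dual k.+1 (pairing (fun h => \sum_g' delta g g' * inc g' h)) f =
      \sum_h inc g h * dual k.+1 (pairing (delta h)) f.
    rewrite -dual_sum; apply: eq_dual => l _; rewrite -pairing_sum.
    rewrite /pairing; congr (_ * _); apply: eq_bigr => h _; congr (_ * _).
    rewrite (bigD1 g)//= /delta eqxx mul1r big1 ?addr0; last first.
      by move=> g' /negbTE ->; rewrite mul0r.
    rewrite (bigD1 h)//= eqxx mulr1 big1 ?addr0// => h' /negbTE.
    by rewrite eq_sym => ->; rewrite mulr0.
  apply: (mulfI i0); rewrite mulr1 -[RHS]E1 E2 (bigD1 f)// [X in _ = _ + X]big1 ?addr0//.
  move=> h hf; have [->|/(inc_neq0 LC)[_ dh]] := eqVneq (inc g h) 0; first by rewrite mul0r.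
  have mh : m h = m f by apply: succn_inj; rewrite -dh dfg.
  rewrite dual_eq0 ?mulr0// => l lf.
  by rewrite pairing_delta (pt_avoid lf)// ?mulr0//; exact/eqP.
- apply: dual_eq0 => l lf; rewrite pairing_delta.
  have [e|e] := eqVneq (m f') (m f).
    by rewrite (pt_avoid lf)// ?mulr0//; apply/eqP.
  rewrite !crossingE; case: eqP; rewrite ?mulr0//= size_map => h; exfalso; move/eqP: e; apply.
  by have [_ _ sl _] := flag_facts lf; move: h mf; rewrite sl; lia.
Qed.

(** The intersection number of [f] with the cone from the base point over the dual cell of [g]. *)
Definition hmatrix g f : int := dual (n - m g) (fun l => pairing (delta f) (None :: l)) g.

Lemma hmatrix_dim g f : hmatrix g f != 0 -> m g = (m f).+1.
Proof.
move=> h; apply: contrapT => /eqP e; move/negP: h; apply; apply/eqP.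
apply: dual_eq0 => l /flag_facts[_ _ sl _]; rewrite pairing_delta !crossingE.
case: eqP; rewrite ?mulr0//= size_map sl => h; exfalso; move/eqP: e; apply.
by have := dim_lc LC g; move: h; lia.
Qed.

(** [scobound_cons] splits the value on a dual cell into the coboundary evaluated on the cone and
    the coboundary of the coned cochain. By [pairing_boundary] the first part is [hmatrix] after the
    boundary. By Stokes the second is the boundary after [hmatrix], except for a top cell, where
    only the base point is left. *)
Lemma hmatrix_homotopy f f0 : (f == f0)%:R =
  \sum_g inc g f * hmatrix g f0 + \sum_g hmatrix f g * inc f0 g +
  sigma f * pairing (delta f0) [:: None].
Proof.
have mfn := dim_lc LC f.
have kf : (m f + (n - m f))%N = n by rewrite subnKC.
rewrite -[LHS](_ : (f0 == f)%:R = _); last by rewrite eq_sym.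
rewrite -(pairing_dual f0 kf).
set w := pairing (delta f0).
have uN l : flag (n - m f) f l -> uniq (None :: map Some l) /\ None \notin map Some l.
  move=> /flag_facts[_ ul _ _]; rewrite /= map_inj_uniq ?ul ?andbT; last by move=> ? ? [].
  by have -> : None \notin map Some l by apply/negP => /mapP[].
have E1 : dual (n - m f) w f = dual (n - m f) (fun l => scobound w (None :: l)) f +
    dual (n - m f) (scobound (fun l => w (None :: l))) f.
  apply/eqP; rewrite -subr_eq0 opprD addrA -!dual_sub; apply/eqP.
  by apply: dual_eq0 => l /uN[_ lN]; rewrite scobound_cons//; ring.
have E2 : dual (n - m f) (fun l => scobound w (None :: l)) f =
    \sum_g hmatrix f g * inc f0 g.
  under [RHS]eq_bigr do rewrite mulrC.
  rewrite /hmatrix -(dual_sum (fun g => inc f0 g) (fun g l => pairing (delta g) (None :: l))).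
  apply: eq_dual => l /uN[ul _]; rewrite -pairing_boundary// -pairing_sum.
  rewrite /pairing; congr (_ * _); apply: eq_bigr => h _; congr (_ * _).
  rewrite (bigD1 f0)//= /delta eqxx mul1r big1 ?addr0; last first.
    by move=> g' /negbTE ->; rewrite mul0r.
  rewrite (bigD1 h)//= eqxx mulr1 big1 ?addr0// => h' /negbTE.
  by rewrite eq_sym => ->; rewrite mulr0.
rewrite E1 E2 addrC addrAC; congr (_ + _).
case ek : (n - m f)%N => [|k].
  have mf : m f = n by rewrite -[RHS]kf ek addn0.
  rewrite big1 ?add0r; last first.
    move=> g _; have [->|/(inc_neq0 LC)[_ dfg]] := eqVneq (inc g f) 0; first by rewrite mul0r.
    by have := dim_lc LC g; rewrite dfg mf ltnn.
  by rewrite /= /scobound big_seq1 /= eqxx expr0 mul1r.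
rewrite dual_scobound -?ek//.
have -> : sigma f = 0.
  by rewrite /lsigma; case: eqP => // mf; move: ek; rewrite mf subnn.
rewrite mul0r addr0; apply: eq_bigr => g _.
have [->|/(inc_neq0 LC)[_ dfg]] := eqVneq (inc g f) 0; first by rewrite !mul0r.
by congr (_ * _); rewrite /hmatrix; congr dual; rewrite dfg; lia.
Qed.

End Simplices.

(** [h] is the last cell of the flag with positive weight: joining a point of a face to a relative
    interior point of [h] stays relatively interior. *)
Lemma flag_relint (c : option I -> V) k f l (a : option I -> R) :
  (forall i, U (c (Some i)) /\ relint (X i) (c (Some i))) -> flag k f l ->
  weights a (map Some l) ->
  exists2 h, h \in l & U (comb c a (map Some l)) /\ relint (X h) (comb c a (map Some l)).
Proof.
move=> cP; elim: k f l a => [|k IH] f l a /=.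
  move=> -> [_ a1]; exists f; rewrite ?mem_head// /comb /= !big_seq1 in a1 *.
  by rewrite a1 scale1r.
move=> [g [l' [-> [fg dfg] gl']]] wa.
have [a0 a1] := wa.
have Uc : U (comb c a (map Some (f :: l'))).
  apply: (convex_comb _ _ wa); first exact: (lc_convex LC).
  by move=> j /mapP[i _ ->]; case: (cP i).
pose t := \sum_(j <- map Some l') a j.
have aft : a (Some f) = 1 - t by rewrite -a1 /= big_cons addrK.
have al j : j \in map Some l' -> 0 <= a j by move=> jl; apply: a0; rewrite inE jl orbT.
have t0 : 0 <= t by rewrite /t big_seq sumr_ge0.
have cE : comb c a (map Some (f :: l')) = (1 - t) *: c (Some f) + comb c a (map Some l').
  by rewrite /comb /= big_cons aft.
have [te|tn] := eqVneq t 0.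
  exists f; rewrite ?mem_head//; split=> //.
  rewrite cE te subr0 scale1r (_ : comb _ _ _ = 0) ?addr0; first by case: (cP f).
  rewrite /comb big_seq big1// => j jl.
  have : a j <= t.
    rewrite /t (big_rem j)//= lerDl big_seq sumr_ge0// => i /mem_rem; exact: al.
  by rewrite te => aj; rewrite (_ : a j = 0) ?scale0r//; apply/eqP; rewrite eq_le aj al.
have tp : 0 < t by rewrite lt_neqAle eq_sym tn.
have [|h hl' [Uh rh]] := IH g l' (fun j => a j / t) gl'.
  split=> [j jl|]; first by rewrite divr_ge0// al.
  by rewrite -mulr_suml divff.
exists h; first by rewrite inE hl' orbT.
split=> //; rewrite cE.
have -> : comb c a (map Some l') = t *: comb c (fun j => a j / t) (map Some l').
  rewrite /comb scaler_sumr; apply: eq_bigr => j _.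
  by rewrite scalerA mulrCA divff// mulr1.
apply: relint_segment => //; first exact: (lc_polytope LC).
  have [lg _ _ _] := flag_facts gl'; have [gh _] := lg h hl'.
  by apply: gh; apply: fg; case: (cP f) => _ [].
by rewrite -subr_ge0 -aft a0// mem_head.
Qed.

Lemma avoid_near (c : I -> V) (S : {set I}) f' :
  (forall a : I -> R, (forall i, i \in S -> 0 <= a i) -> \sum_(i in S) a i = 1 ->
    ~ X f' (\sum_(i in S) a i *: c i)) ->
  exists2 e : R, 0 < e & forall p : I -> V, (forall i, i \in S -> `|c i - p i| < e) ->
    forall a : I -> R, (forall i, i \in S -> 0 <= a i) -> \sum_(i in S) a i = 1 ->
    ~ X f' (\sum_(i in S) a i *: p i).
Proof.
move=> nX; pose q (k : 'I_#|S|) := c (enum_val k).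
have sumE (F : I -> V) : \sum_(k < #|S|) F (enum_val k) = \sum_(i in S) F i.
  by rewrite [RHS]big_enum_val.
have sumR (F : I -> R) : \sum_(k < #|S|) F (enum_val k) = \sum_(i in S) F i.
  by rewrite [RHS]big_enum_val.
have hullE (a : I -> R) : (forall i, i \in S -> 0 <= a i) -> \sum_(i in S) a i = 1 ->
    hull q (\sum_(i in S) a i *: c i).
  move=> a0 a1; exists (fun k => a (enum_val k)); split.
  - by move=> k; apply: a0; exact: enum_valP.
  - by rewrite (sumR a).
  - by rewrite -(sumE (fun i => a i *: c i)).
have [|e e0 eP] := compact_separation (hull_compact (p := q))
    (polytope_closed (lc_polytope LC f')).
  move=> x [w [w0 w1 ->]].
  have [S0|/set0Pn[i0 i0S]] := eqVneq S finset.set0.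
    move: w1; rewrite big1 => [/esym/eqP|k _]; first by rewrite oner_eq0.
    by have := ltn_ord k; rewrite [X in (_ < X)%N](_ : _ = 0%N)// S0 cards0.
  pose a i := w (enum_rank_in i0S i).
  have aw k : a (enum_val k) = w k by rewrite /a enum_valK_in.
  have := nX a; rewrite -sumE -sumR.
  under eq_bigr do rewrite aw.
  rewrite (eq_bigr (fun k => w k *: q k)) => [|k _]; last by rewrite aw.
  by move=> h; apply: h => // i iS; exact: w0.
exists (e / 2) => [|p pc a a0 a1]; first by rewrite divr_gt0.
apply: (eP _ _ (hullE a a0 a1)).
rewrite -sumrB; under eq_bigr do rewrite -scalerBr.
apply: le_lt_trans (ler_norm_sum _ _ _) _.
apply: (@le_lt_trans _ _ (\sum_(i in S) a i * (e / 2))).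
  apply: ler_sum => i iS; rewrite normrZ ger0_norm ?a0// ler_wpM2l ?a0// ltW//.
  exact: pc.
by rewrite -mulr_suml a1 mul1r; lra.
Qed.

Lemma flag_sum k f l (T : nmodType) (F : option I -> T) : flag k f l ->
  \sum_(j <- map Some l) F j = \sum_(i in [set i in l]) F (Some i).
Proof.
move=> /flag_facts[_ ul _ _]; rewrite big_map big_uniq//=.
by apply: eq_bigl => i; rewrite inE.
Qed.

(* In matrix form: id is homotopic to sigma tau, so that every cycle bounds
   below the top degree, and is a multiple of sigma in the top degree. *)
Theorem local_homotopy : exists (h : I -> I -> int) (tau : I -> int),
  (forall g f, h g f != 0 -> m g = (m f).+1) /\
  forall f f0, (f == f0)%:R = \sum_g inc g f * h g f0 + \sum_g h f g * inc f0 g +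
    sigma f * tau f0.
Proof.
have [[i0 _]|nI] := pselect (exists i : I, True); last first.
  by exists (fun _ _ => 0), (fun=> 0); split=> [g|f]; case: nI; [exists g|exists f].
have /choice[c cP] := relint_meet LC.
pose c' (j : option I) := if j is Some i then c i else c i0.
have c'P i : U (c' (Some i)) /\ relint (X i) (c' (Some i)) by exact: cP.
have /choice[e1 e1P] : forall p : {set I} * I, exists e : R, 0 < e /\
    ((forall a : I -> R, (forall i, i \in p.1 -> 0 <= a i) -> \sum_(i in p.1) a i = 1 ->
      ~ X p.2 (\sum_(i in p.1) a i *: c i)) ->
    forall q : I -> V, (forall i, i \in p.1 -> `|c i - q i| < e) ->
    forall a : I -> R, (forall i, i \in p.1 -> 0 <= a i) -> \sum_(i in p.1) a i = 1 ->
    ~ X p.2 (\sum_(i in p.1) a i *: q i)).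
  move=> [S f'] /=; have [h|h] := pselect (forall a : I -> R,
      (forall i, i \in S -> 0 <= a i) -> \sum_(i in S) a i = 1 ->
      ~ X f' (\sum_(i in S) a i *: c i)); last by exists 1.
  by have [e e0 eP] := avoid_near h; exists e.
have /choice[e2 e2P] : forall f, exists e : R, 0 < e /\
    forall y, `|c f - y| < e -> (y - c f <= direction (X f))%MS -> X f y.
  move=> f; have [e e0 eP] := relint_nbhd (cP f).2.
  by exists e; split=> // y cy yf; case: (eP y cy yf).
(* Moving the points by less than [e] keeps flag simplices away from the cells they missed and keeps
   the barycenters of top cells in their cells. *)
pose e := Num.min (\big[Num.min/1]_p e1 p) (\big[Num.min/1]_f e2 f).
have e0 : 0 < e.
  rewrite lt_min; apply/andP; split.
    elim/big_ind: _ => // [a b a0 b0|i _]; first by rewrite lt_min a0.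
    by case: (e1P i).
  elim/big_ind: _ => // [a b a0 b0|i _]; first by rewrite lt_min a0.
  by case: (e2P i).
have c'U j : U (c' j) by case: j => [i|]; [case: (cP i)|case: (cP i0)].
have [pt [ptc ptG]] := generic_choice LC (l := enum [set: option I]) (enum_uniq _) e0 c'U.
have ptc' j : `|c' j - pt j| < e /\ U (pt j) by apply: ptc; rewrite mem_enum inE.
have ptU j : U (pt j) by case: (ptc' j).
have pt_top f : m f = n -> X f (pt (Some f)).
  move=> mf; have [_ h] := e2P f; apply: h.
    apply: lt_le_trans (ptc' (Some f)).1 _; rewrite /e ge_min; apply/orP; right.
    exact: bigmin_le_cond.
  apply: submx_trans (top_direction LC mf).
  by apply: (lc_span LC) => //; case: (cP f).
(* Before perturbation, the flag simplex consists of relative interior points of cells containing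
   [X f]. If it met [X f'], then [X f'] would contain [X f], which is impossible for another cell of
   the same dimension. *)
have pt_avoid k f f' l : flag k f l -> m f' = m f -> f' <> f ->
    crossing pt (map Some l) f' = 0.
  move=> lf mff ff; rewrite !crossingE asboolF ?andbF// => -[a [[a0 a1] fa]].
  have [fl ul sl fl'] := flag_facts lf.
  have [_ h] := e1P ([set i in l], f').
  move: fa; rewrite /comb (flag_sum _ lf); apply: (h _ (fun i => pt (Some i))).
  - move=> b b0 b1 fb.
    pose b' (j : option I) := if j is Some i then b i else 0.
    have wb : weights b' (map Some l).
      split; last by rewrite (flag_sum _ lf).
      by move=> j /mapP[i il ->]; apply: b0; rewrite inE.
    have [k' kl [Uk rk]] := flag_relint c'P lf wb.
    move: fb => /=; rewrite -(flag_sum (fun j => b' j *: c' j) lf) -/(comb c' b' _) => fb.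
    have kf' := lc_face LC Uk rk fb.
    have [fk _] := fl _ kl.
    have ff' : X f `<=` X f' by exact: subset_trans fk kf'.
    have [Uf rf] := cP f.
    have := lc_face_dim LC Uf rf (ff' _ rf.1) (fun e => ff (esym e)).
    by rewrite mff ltnn.
  - move=> i il; apply: lt_le_trans (ptc' (Some i)).1 _.
    by rewrite /e ge_min; apply/orP; left; exact: bigmin_le_cond.
  - by move=> i; rewrite inE => il; apply: a0; rewrite map_f.
  - by rewrite -a1 (flag_sum _ lf).
exists (hmatrix pt), (fun f0 => pairing pt (fun h => (h == f0)%:R) [:: None]).
split=> [g f|f f0]; first exact: hmatrix_dim.
exact: hmatrix_homotopy.
Qed.

End LocalHomotopy.

(** * Cells of a tiling and their stars *)

Lemma detl_rows (R : realType) q (A : 'M[R]_q) : detl (rows A) = \det A.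
Proof. by congr (\det _); apply/row_matrixP => i; rewrite rowK nth_rows. Qed.

Section Frames.
Context {R : realType} {N : nat}.
Local Notation V := 'rV[R]_N.

Definition frame_of (s : seq V) (D : 'M[R]_N) k := [/\ size s = k,
  forall v, v \in s -> (v <= D)%MS,
  forall v, (v <= D)%MS -> exists a : nat -> R, v = \sum_(i < k) a i *: s`_i &
  forall a : nat -> R, \sum_(i < k) a i *: s`_i = 0 -> forall i, (i < k)%N -> a i = 0].

Lemma rows_sum m (A : 'M[R]_(m, N)) (a : nat -> R) :
  \sum_(i < m) a i *: (rows A)`_i = (\row_(i < m) a i) *m A.
Proof.
by rewrite mulmx_sum_row; apply: eq_bigr => i _; rewrite nth_rows mxE.
Qed.

Lemma frame_of_rows m (A : 'M[R]_(m, N)) (D : 'M[R]_N) : row_free A ->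
  (A :=: D)%MS -> frame_of (rows A) D m.
Proof.
move=> fA AD; split.
- exact: size_rows.
- by move=> _ /mapP[i _ ->]; rewrite -AD row_sub.
- move=> v; rewrite -AD => /submxP[u ->]; pose a k := if (insub k : option 'I_m) is Some i then u 0 i else 0.
  exists a; rewrite (rows_sum A a); congr (_ *m _); apply/rowP => i; rewrite mxE.
  by rewrite /a valK.
- move=> a; rewrite rows_sum => /eqP; rewrite mulmx_free_eq0// => /eqP/rowP h i im.
  by have := h (Ordinal im); rewrite !mxE.
Qed.

Lemma frame_of_cons v s (D D' : 'M[R]_N) k : frame_of s D k ->
  ~ (v <= D)%MS -> (D <= D')%MS -> (v <= D')%MS -> (D' <= v + D)%MS ->
  frame_of (v :: s) D' k.+1.
Proof.
move=> [sk sD sp fr] vD DD' vD' D'D.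
have sumE (a : nat -> R) : \sum_(i < k.+1) a i *: (v :: s)`_i =
    a 0%N *: v + \sum_(i < k) a i.+1 *: s`_i.
  by rewrite big_ord_recl.
have sub (a : nat -> R) : ((\sum_(i < k) a i *: s`_i)%R <= D)%MS.
  apply: summx_sub => i _; apply: scalemx_sub; apply: sD.
  by rewrite mem_nth// sk.
split.
- by rewrite /= sk.
- by move=> w; rewrite inE => /orP[/eqP -> //|/sD wD]; exact: submx_trans DD'.
- move=> w wD'; have /sub_addsmxP[[u1 u2] /= we] := submx_trans wD' D'D.
  have [|a ae] := sp (u2 *m D); first exact: submxMl.
  exists (fun i => if i is i'.+1 then a i' else u1 0 0).
  by rewrite (sumE (fun i => if i is i'.+1 then a i' else u1 0 0)) -ae we {1}[u1]mx11_scalar mul_scalar_mx.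
- move=> a; rewrite sumE => h.
  have a0 : a 0%N = 0.
    apply/eqP/negP => /negP a0; apply: vD; have : (a 0%N *: v <= D)%MS.
      by rewrite (canRL (addrK _) h) sub0r eqmx_opp; exact: (sub (fun i => a i.+1)).
    by move=> /(scalemx_sub (a 0%N)^-1); rewrite scalerA mulVf// scale1r.
  move: h; rewrite a0 scale0r add0r => /(fr (fun i => a i.+1)) h [//|i]; exact: h.
Qed.

End Frames.

Section Outward.
Context {R : realType} {N : nat}.
Local Notation V := 'rV[R]_N.
Implicit Types f g : set V.

(* This makes the sign of an incidence number independent of the points that
   are used to define it. *)
Lemma outward_unique f g x y x1 y1 : polytope f -> polytope g -> f `<=` g ->
  dim g = (dim f).+1 -> (exists2 z, relint f z & ~ relint g z) ->
  f x -> relint g y -> f x1 -> relint g y1 ->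
  exists (t : R) w, [/\ x - y = t *: (x1 - y1) + w, 0 < t & (w <= direction f)%MS].
Proof.
move=> pf pg fg dfg [z rz nz] fx ry fx1 ry1.
have g1 : g y by case: ry.
have g2 : g y1 by case: ry1.
have tr x' y' : f x' -> relint g y' -> ~ (x' - y' <= direction f)%MS.
  move=> fx' ry' h; apply: (relint_transversal pg fg rz nz fx' ry').
  by rewrite -opprB eqmx_opp.
have [| |t [w [e wf]]] := direction_split fg dfg _ (tr _ _ fx1 ry1) (w := x - y).
- by apply: sub_direction => //; exact: fg.
- by apply: sub_direction => //; exact: fg.
(* If [t <= 0], averaging [x] with [x1] and [y] with [y1] by the same weights gives a point of [f]
   and a relative interior point of [g] whose difference is parallel to [f]. *)
exists t, w; split=> //; rewrite ltNge; apply/negP => t0.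
have t1 : 0 < 1 - t by lra.
apply: (tr ((1 - t)^-1 *: (x - t *: x1)) ((1 - t)^-1 *: (y - t *: y1))).
- rewrite (_ : _ *: _ = (1 - (- t / (1 - t))) *: x + (- t / (1 - t)) *: x1); last first.
    by apply/rowP => i; rewrite !mxE; field; rewrite gt_eqF.
  apply: polytope_convex => //; first by rewrite divr_ge0 ?oppr_ge0// ltW.
  by rewrite ler_pdivrMr//; lra.
- have [t00|t00] := eqVneq t 0.
    by rewrite t00 !(subr0, scale0r) invr1 scale1r.
  rewrite (_ : _ *: _ = (1 - (- t / (1 - t))) *: y + (- t / (1 - t)) *: y1); last first.
    by apply/rowP => i; rewrite !mxE; field; rewrite gt_eqF.
  apply: relint_segment => //; first by rewrite divr_gt0// oppr_gt0 lt_neqAle t00.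
  by rewrite ler_pdivrMr//; lra.
- rewrite -scalerBr (_ : x - _ - _ = w); last first.
    by rewrite addrAC -[w](addKr (t *: (x1 - y1))) -e; apply/rowP => i; rewrite !mxE; ring.
  exact: scalemx_sub.
Qed.

Lemma detl_outward q (h : {linear V -> 'rV[R]_q}) (l : seq 'rV[R]_q) s (D : 'M[R]_N) k u w t :
  frame_of s D k -> (w <= D)%MS -> (size l + k.+1)%N = q ->
  detl (l ++ h (t *: u + w) :: map h s) = t * detl (l ++ h u :: map h s).
Proof.
move=> [sk _ sp _] /sp[a ->] sq; rewrite linearD linearZ /= detl_linear; last first.
  by rewrite -[X in (_ < X)%N]sq addnS ltnS leq_addr.
rewrite [X in _ + X](_ : _ = 0) ?addr0// linear_sum /=.
have := @detl_dependent _ q l (map h s) a; rewrite size_map sk => <- //.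
congr (detl (_ ++ _ :: _)); apply: eq_bigr => i _; rewrite linearZ /=.
by rewrite (nth_map 0) ?sk.
Qed.

End Outward.

HB.instance Definition _ (R : realType) (N n : nat) (E : 'M[R]_(n, N)) :=
  GRing.isLinear.Build R 'rV[R]_N 'rV[R]_(1 + n) *:%R (hvec E) (hvec_linear E).

(** * Faces, neighbourhoods and incidence numbers of tiling cells *)

Section TilingGeometry.
Context {R : realType} {d : nat} {L : Type} (T : polytopal_tiling R d L).
Local Notation V := 'rV[R]_d.
Implicit Types (c e f g t : set V) (v x y : V).
Local Notation cell := (cells T).

Lemma relint_face f g x : cell f -> cell g -> relint f x -> g x -> f `<=` g.
Proof.
have [n] := ubnP (dim g); elim: n g => // n IH g /ltnSE gn cf cg rf gx.
have [rx|nrx] := pselect (relint g x); first by rewrite (relint_inj cf cg rf rx).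
have [F [_ Fc] bdF] := cells_boundary cg.
have : (g `\` relint g) x by [].
rewrite bdF => -[e Fe ex]; have [ce eg] := Fc e Fe.
apply: (@subset_trans _ e); first by apply: IH => //; exact: leq_trans eg gn.
by move=> y ey; have : (g `\` relint g) y; [rewrite bdF; exists e|case].
Qed.

Lemma point_cell x : exists2 f, cell f & relint f x.
Proof. by have [f [[cf rf] _]] := cells_partition T x; exists f. Qed.

Lemma face_not_relint f g x : cell f -> cell g -> f <> g -> f `<=` g -> f x -> ~ relint g x.
Proof.
move=> cf cg fg sfg fx rgx; have := relint_face cg cf rgx fx => gf.
by apply: fg; apply/seteqP.
Qed.

Lemma face_dim f g : cell f -> cell g -> f <> g -> f `<=` g -> (dim f < dim g)%N.
Proof.
move=> cf cg fg sfg; rewrite ltn_neqAle dim_le// andbT; apply/eqP => e.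
have [x rx] := polytope_relint (cells_polytope cf).
apply: (face_not_relint cf cg fg sfg (x := x)); first by case: rx.
by apply: relint_sub_dim rx; rewrite ?e//; apply: (cells_polytope (p := T)).
Qed.

Lemma face_eq f g : cell f -> cell g -> f `<=` g -> dim f = dim g -> f = g.
Proof.
move=> cf cg fg e; apply: contrapT => ne.
by have := face_dim cf cg ne fg; rewrite e ltnn.
Qed.

(** The union of the cells that miss [x] is closed in the weak topology, since inside each cell it
    is a finite union of faces. *)
Lemma star_nbhd x : exists2 e : R, 0 < e &
  forall y c, `|x - y| < e -> cell c -> c y -> c x.
Proof.
pose A : set V := \bigcup_(c in [set c | cell c /\ ~ c x]) c.
have clA : closed A.
  apply: (@cells_weak_topology _ _ _ T) => c cc.
  rewrite (_ : A `&` c = \bigcup_(f in [set f | (cell f /\ f `<=` c) /\ ~ f x]) f).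
    apply: closed_bigcup => [|f [[cf _] _]]; last first.
      exact: polytope_closed (cells_polytope cf).
    by apply: sub_finite_set (finite_faces cc) => f [].
  apply/seteqP; split=> [y [[g [cg ngx] gy] cy]|y [f [[cf fc] nfx] fy]]; last first.
    by split; [exists f|exact: fc].
  have [f cf rf] := point_cell y; exists f; last by case: rf.
  split; first by split=> //; exact: relint_face cc rf cy.
  by move=> fx; apply: ngx; exact: relint_face cg rf gy _ fx.
have nAx : ~ A x by move=> [c [cc ncx] cx].
have := open_subball (closed_openC clA) nAx => -[e /= e0 be].
exists (e / 2) => [|y c xy cc cy]; first by rewrite divr_gt0.
apply: contrapT => ncx; apply: (be (e / 2) _ _ y) => //.
- by rewrite /ball_ /= sub0r normrN gtr0_norm ?divr_gt0//; lra.
- by rewrite divr_gt0.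
- by rewrite normB_ball.
- by exists c.
Qed.

Lemma finite_cofaces c : cell c -> finite_set [set e | cell e /\ c `<=` e].
Proof.
move=> cc; have [x cx] := cell_nonempty cc.
by apply: sub_finite_set (finite_star T x) => e [ce se]; split=> //; exact: se.
Qed.

(** A cell of positive dimension is bounded, so a ray from its relative interior leaves it through a
    proper face; descend. *)
Lemma cell_vertex c : cell c -> exists w, [/\ cell w, w `<=` c & dim w = 0%N].
Proof.
have [n] := ubnP (dim c); elim: n c => // n IH c /ltnSE cn cc.
have [c0|c0] := eqVneq (dim c) 0%N; first by exists c; split.
have [y ry] := polytope_relint (cells_polytope cc).
have [z zc ncz] : exists2 z, (z - y <= direction c)%MS & ~ c z.
  have [K cK] := polytope_bounded (cells_polytope cc).
  have /rowV0Pn[w wd w0] : direction c != 0 by rewrite -mxrank_eq0.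
  exists (y + ((K + `|y| + 1) / `|w|) *: w).
    by rewrite addrC addKr scalemx_sub.
  move=> /cK; apply/negP; rewrite -ltNge.
  have wn : 0 < `|w| by rewrite normr_gt0.
  have K0 : 0 <= K by apply: le_trans (cK y ry.1).
  have : `|((K + `|y| + 1) / `|w|) *: w| = K + `|y| + 1.
    rewrite normrZ ger0_norm ?divfK ?gt_eqF//.
    by rewrite divr_ge0// ?addr_ge0.
  set u := _ *: w => un.
  have : `|u| <= `|y + u| + `|y|.
    by have := ler_normB (y + u) y; rewrite addrAC subrr add0r.
  by rewrite un; lra.
have [t [_ _ ct nt]] := relint_exit (cells_polytope cc) ry ncz zc.
have [F [_ Fc] bdF] := cells_boundary cc.
have : (c `\` relint c) (y + t *: (z - y)) by [].
rewrite bdF => -[e Fe _]; have [ce ec] := Fc e Fe.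
have [|//|w [cw we w0]] := IH e; first exact: leq_trans ec cn.
exists w; split=> //; apply: (subset_trans we) => p ep.
by have : (c `\` relint c) p; [rewrite bdF; exists e|case].
Qed.

Variable o : orientation T.
Local Notation frame := (frame o).

Definition cframe c : seq V := rows (frame (dim c) c).

Lemma frame_free c m : cell c -> dim c = m -> row_free (frame m c) /\ (frame m c :=: direction c)%MS.
Proof.
move=> cc <-; have h := frame_basis o cc; split=> //.
by rewrite -row_leq_rank h.
Qed.

Lemma frame_of_cframe c : cell c -> frame_of (cframe c) (direction c) (dim c).
Proof. by move=> cc; have [] := frame_free cc erefl; exact: frame_of_rows. Qed.

Lemma map_rows q m (h : {linear V -> 'rV[R]_q}) (A : 'M[R]_(m, d)) :
  map h (rows A) = rows (A *m lin1_mx h).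
Proof.
rewrite /rows -map_comp; apply: eq_map => i /=.
by rewrite row_mul mul_rV_lin1.
Qed.

Lemma rows_col q m (u : 'rV[R]_q) (A : 'M[R]_(m, q)) : rows (col_mx u A) = u :: rows A.
Proof.
apply: (@eq_from_nth _ 0); first by rewrite /= !size_rows.
rewrite size_rows => i im; rewrite -[i]/(val (Ordinal im)) nth_rows.
have [j|j] := split_ordP (Ordinal im) => e; rewrite e.
  by rewrite (ord1 j) rowKu /= row_id.
by rewrite rowKd /= nth_rows.
Qed.

Lemma facet_relint f g : facet T f g -> exists2 z, relint f z & ~ relint g z.
Proof.
move=> [cf cg fg dfg]; have [z rz] := polytope_relint (cells_polytope cf).
exists z => //; apply: (face_not_relint cf cg _ fg); last by case: rz.
by move=> e; move: dfg; rewrite e; lia.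
Qed.

(** An arbitrary linear map [h] and prefix [l] make the rule usable in stars, in pyramids and for
    translated cells alike. *)
Lemma outward_incidence f g x y q (h : {linear V -> 'rV[R]_q}) (l : seq 'rV[R]_q) :
  facet T f g -> f x -> relint g y -> (size l + dim g)%N = q ->
  sgz (detl (l ++ h (x - y) :: map h (cframe f))) =
  incidence o g f * sgz (detl (l ++ map h (cframe g))).
Proof.
move=> fg fx ry sq; have [cf cg sfg dfg] := fg.
pose x1 := xget 0 f; pose y1 := xget 0 (relint g).
have fx1 : f x1 by rewrite /x1; case: xgetP => // /(_ x).
have ry1 : relint g y1 by rewrite /y1; case: xgetP => // /(_ y).
have [t [w [-> t0 wf]]] := outward_unique (cells_polytope cf) (cells_polytope cg) sfg dfg
  (facet_relint fg) fx ry fx1 ry1.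
rewrite (detl_outward h (x1 - y1) t (frame_of_cframe cf) wf); last by rewrite -dfg.
rewrite sgzM gtr0_sgz// mul1r.
have [_ G] := frame_free (m := (1 + dim f)%N) cg dfg.
pose A := col_mx (x1 - y1) (frame (dim f) f) *m pinvmx (frame (1 + dim f) g).
have AG : A *m frame (1 + dim f) g = col_mx (x1 - y1) (frame (dim f) f).
  apply: mulmxKpV; rewrite col_mx_sub G; apply/andP; split.
    by apply: sub_direction; [case: ry1|exact: sfg].
  by rewrite (frame_basis o cf) G direction_sub.
have -> : h (x1 - y1) :: map h (cframe f) =
    rows (A *m (frame (1 + dim f) g *m lin1_mx h)).
  by rewrite mulmxA AG -map_rows rows_col.
rewrite detl_rows_mul; last by rewrite -[RHS]sq dfg.
rewrite sgzM -map_rows; congr (_ * sgz (detl (_ ++ map h _))).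
by rewrite /cframe dfg.
Qed.

Lemma incidence_sqr f g : facet T f g -> incidence o g f * incidence o g f = 1.
Proof.
move=> fg; have [cf cg sfg dfg] := fg.
pose x1 := xget 0 f; pose y1 := xget 0 (relint g).
have fx1 : f x1.
  by have [x [fx _]] := polytope_relint (cells_polytope cf); rewrite /x1; case: xgetP => // /(_ x).
have ry1 : relint g y1.
  by have [y ry] := polytope_relint (cells_polytope cg); rewrite /y1; case: xgetP => // /(_ y).
have [G1 G] := frame_free (m := (1 + dim f)%N) cg dfg.
have [F1 F] := frame_free cf erefl.
rewrite /incidence; set A := _ *m _.
have AG : A *m frame (1 + dim f) g = col_mx (x1 - y1) (frame (dim f) f).
  apply: mulmxKpV; rewrite col_mx_sub G; apply/andP; split.
    by apply: sub_direction; [case: ry1|exact: sfg].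
  by rewrite F G direction_sub.
suff A0 : \det A != 0 by case: (sgzP (\det A)) A0 => // ->; rewrite eqxx.
have [z rz nz] := facet_relint fg.
have nt := relint_transversal (cells_polytope cg) sfg rz nz fx1 ry1.
rewrite -unitfE -[_ \is a _]/(A \in unitmx) -row_free_unit -row_leq_rank.
apply: (@leq_trans (\rank (A *m frame (1 + dim f) g))); last exact: mxrankM_maxl.
have : (frame (dim f) f < (x1 - y1)%R + frame (dim f) f)%MS.
  rewrite ltmxE addsmxSr /=; apply/negP => h; apply: nt.
  by rewrite -opprB eqmx_opp -F; exact: submx_trans (addsmxSl _ _) h.
by move/rank_ltmx; rewrite addsmxE -AG F.
Qed.


(** This is [lsigma] for the standard basis, so a single global function restricts to the
    fundamental class of every star. *)
Definition tsigma c : int :=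
  if dim c == d then sgz (detl (hpt 1%:M 0 :: map (hvec 1%:M) (cframe c))) else 0.

Lemma relint_shift v c x : relint c x -> relint (shift v c) (x + v).
Proof.
move=> rx; have [e e0 ec] := relint_nbhd rx; split; first by exists x => //; case: rx.
apply/nbhs_ballP; exists e => // y; rewrite normB_ball => xy yd.
exists (y - v); last by rewrite subrK.
have [| |//] := ec (y - v).
  by rewrite opprB addrA.
apply: submx_trans (direction_shift v c); rewrite -addrA -opprD [v + x]addrC.
exact: yd.
Qed.

Lemma shift_sub v c e : shift v c `<=` shift v e -> c `<=` e.
Proof. by move=> h x cx; have [|y ey /addIr <-] := h (x + v); [exists x|]. Qed.

Lemma cframe_shift v c : cell c -> cell (shift v c) ->
  exists2 B : 'M[R]_(dim c), 0 < \det B &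
    frame (dim c) (shift v c) = B *m frame (dim c) c.
Proof.
move=> cc cv; exists (frame (dim c) (shift v c) *m pinvmx (frame (dim c) c)).
  exact: frame_translate.
rewrite mulmxKpV//; have := frame_basis o cv; rewrite dim_shift => ->.
by rewrite (frame_basis o cc) direction_shift.
Qed.

Lemma detl_shift v c q (h : {linear V -> 'rV[R]_q}) l : cell c -> cell (shift v c) ->
  (size l + dim c)%N = q ->
  sgz (detl (l ++ map h (cframe (shift v c)))) = sgz (detl (l ++ map h (cframe c))).
Proof.
move=> cc cv sq; have [B B0 e] := cframe_shift cc cv.
rewrite /cframe dim_shift e !map_rows -mulmxA detl_rows_mul//.
by rewrite sgzM gtr0_sgz// mul1r.
Qed.

Lemma tsigma_shift v c : cell c -> cell (shift v c) -> tsigma (shift v c) = tsigma c.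
Proof.
move=> cc cv; rewrite /tsigma dim_shift; case: eqP => // dc.
by apply: (@detl_shift v c _ (hvec 1%:M) [:: hpt 1%:M 0] cc cv) => //=; rewrite dc.
Qed.

Lemma facet_shift v f g : cell (shift v f) -> cell (shift v g) ->
  facet T f g -> facet T (shift v f) (shift v g).
Proof.
move=> cf cg [_ _ fg dfg]; split=> //; last by rewrite !dim_shift.
exact: image_subset.
Qed.

(** In the coordinates given by the frame of [g], both numbers are signs of determinants with the
    same outward vector, and translation changes frames by positive determinants only. *)
Lemma incidence_shift v f g : cell (shift v f) -> cell (shift v g) -> facet T f g ->
  incidence o (shift v g) (shift v f) = incidence o g f.
Proof.
move=> cfv cgv fg; have [cf cg _ dfg] := fg.
have [x [fx _]] := polytope_relint (cells_polytope cf).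
have [y ry] := polytope_relint (cells_polytope cg).
pose G := frame (dim g) g; pose h := mulmxr (pinvmx G) : {linear V -> 'rV[R]_(dim g)}.
have fv : shift v f (x + v) by exists x.
have g1 : sgz (detl ([::] ++ map h (cframe g))) = 1.
  rewrite /= (_ : map h _ = rows 1%:M) ?detl_rows ?det1 ?sgz1//.
  rewrite -(mulmxVp (frame_free cg erefl).1) /rows -map_comp; apply: eq_map => i /=.
  by rewrite row_mul.
have e1 := outward_incidence h (l := [::]) fg fx ry erefl.
have e2 := outward_incidence h (l := [::]) (facet_shift cfv cgv fg) fv (relint_shift v ry) (dim_shift v g).
move: e1 e2; rewrite (@detl_shift v g _ h [::] cg cgv erefl) g1 !mulr1 => <- <-.
rewrite opprD addrACA subrr addr0.
by apply: (@detl_shift v f _ h [:: _] cf cfv); rewrite [RHS]dfg.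
Qed.

End TilingGeometry.

(** * Exactness in the star of a cell *)

Section Exactness.
Context {R : realType} {d : nat} {L : Type} (T : polytopal_tiling R d L) (o : orientation T).
Local Notation V := 'rV[R]_d.
Implicit Types (c e f g t : set V) (v x y : V).
Local Notation cell := (cells T).
Local Notation sigma := (tsigma o).

(** Extension by 0 allows sums over any finite list that contains the relevant facets. *)
Definition tinc g f : int := if `[< facet T f g >] then incidence o g f else 0.

Lemma tinc_facet g f : tinc g f != 0 -> facet T f g.
Proof. by rewrite /tinc; case: asboolP => //; rewrite eqxx. Qed.

Lemma fsbig_seq (A : set (set V)) (F : set V -> int) (r : seq (set V)) : uniq r ->
  (forall f, A f -> F f != 0 -> f \in r) ->
  \sum_(f \in A) F f = \sum_(f <- r) (if `[< A f >] then F f else 0).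
Proof.
move=> ur Ar; rewrite (@fsbigE _ _ _ _ _ [seq f <- r | `[< A f >]])//; last first.
- move=> f Af; rewrite mem_filter asboolT//= => fr.
  by apply/eqP; apply: contraNT fr => /Ar; exact.
- by move=> f /=; rewrite mem_filter => /andP[/asboolP].
- exact: filter_uniq.
rewrite big_filter_cond [LHS]big_mkcond; apply: eq_bigr => f _.
by rewrite /in_mem /= /in_set /= andbb.
Qed.

Lemma coboundary_seq psi c r : uniq r ->
  (forall f, facet T f c -> psi f != 0 -> f \in r) ->
  coboundary o psi c = \sum_(f <- r) tinc c f * psi f.
Proof.
move=> ur cr; rewrite /coboundary (fsbig_seq ur); last first.
  by move=> f fc h; apply: cr => //; apply: contraNneq h => ->; rewrite mulr0.
by apply: eq_bigr => f _; rewrite /tinc; case: ifP => //; rewrite mul0r.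
Qed.

Lemma boundary_seq chi f r : uniq r ->
  (forall c, facet T f c -> chi c != 0 -> c \in r) ->
  boundary o chi f = \sum_(c <- r) tinc c f * chi c.
Proof.
move=> ur cr; rewrite /boundary (fsbig_seq ur); last first.
  by move=> c fc h; apply: cr => //; apply: contraNneq h => ->; rewrite mulr0.
by apply: eq_bigr => c _; rewrite /tinc; case: ifP => //; rewrite mul0r.
Qed.

Section Star.
Variable c : set V.
Hypothesis cc : cell c.
Let S := fset_set [set e | cell e /\ c `<=` e].

Lemma in_star e : (e \in S) = `[< cell e /\ c `<=` e >].
Proof. by rewrite in_fset_set//; exact: finite_cofaces. Qed.

Lemma starP (i : S) : cell (val i) /\ c `<=` val i.
Proof. by apply/asboolP; rewrite -in_star; exact: valP. Qed.

Lemma star_complex : exists U : set V, local_complex (1%:M : 'M[R]_d) U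
  (fun i : S => val i) (fun i : S => cframe o (val i)) (fun i j : S => tinc (val i) (val j)).
Proof.
have [x0 r0] := polytope_relint (cells_polytope cc); have cx0 : c x0 by case: r0.
have [r rpos rball] := star_nbhd T x0.
exists [set x | `|x0 - x| < r]; split.
- by rewrite row_free_unit unitmx1.
- move=> x y t t0 t1 /= xr yr.
  rewrite (_ : x0 - _ = (1 - t) *: (x0 - x) + t *: (x0 - y)); last first.
    by apply/rowP => i; rewrite !mxE; ring.
  apply: le_lt_trans (ler_normD _ _) _; rewrite !normrZ ger0_norm ?subr_ge0// ger0_norm//.
  have [->|tp] := eqVneq t 0; first by rewrite subr0 mul1r mul0r addr0.
  have {}tp : 0 < t by rewrite lt_neqAle eq_sym tp.
  have h1 : (1 - t) * `|x0 - x| <= (1 - t) * r by rewrite ler_wpM2l ?subr_ge0// ltW.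
  have h2 : t * `|x0 - y| < t * r by rewrite ltr_pM2l.
  lra.
- move=> x /= xr; exists (r - `|x0 - x|); first by rewrite subr_gt0.
  move=> y xy _; have -> : x0 - y = (x0 - x) + (x - y) by rewrite addrA subrK.
  by rewrite (le_lt_trans (ler_normD _ _))// -ltrBrDl.
- by move=> x y _ _; exact: submx1.
- by move=> i; have [ci _] := starP i; exact: cells_polytope ci.
- move=> i; exists x0; split; first by rewrite /= subrr normr0.
  by have [_] := starP i; apply.
- by move=> i; exact: submx1.
- move=> i j x _ ri rj; apply: val_inj.
  have [ci _] := starP i; have [cj _] := starP j; exact: relint_inj ci cj ri rj.
- move=> x xr; have [e ce re] := point_cell T x.
  have eS : e \in S.
    rewrite in_star; apply/asboolP; split=> //; apply: (relint_face cc ce r0).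
    by apply: rball xr ce _; case: re.
  by exists [` eS]%fset.
- move=> i j x _ ri xj; have [ci _] := starP i; have [cj _] := starP j.
  exact: relint_face ci cj ri xj.
- by move=> i; rewrite size_rows.
- by move=> i; have [ci _] := starP i; have [_ + _ _] := frame_of_cframe o ci.
- by move=> i; have [ci _] := starP i; have [_ _ + _] := frame_of_cframe o ci.
- by move=> i; have [ci _] := starP i; have [_ _ _] := frame_of_cframe o ci.
- move=> f g nfg; have [->//|/tinc_facet[_ _ fg dfg]] := eqVneq (tinc (val g) (val f)) 0.
  by case: nfg.
- move=> f g fg dfg; have [cf _] := starP f; have [cg _] := starP g.
  by rewrite /tinc asboolT; [exact: incidence_sqr|split].
- move=> f g x y l fg dfg fx gy sl; have [cf _] := starP f; have [cg _] := starP g.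
  have h : facet T (val f) (val g) by split.
  by rewrite /tinc asboolT//; apply: outward_incidence.
Qed.

Lemma sum_star (F : set V -> int) : \sum_(i : S) F (val i) = \sum_(e <- S) F e.
Proof. by rewrite big_seq_fsetE. Qed.

Lemma boundary_star (x : set V -> int) (f : S) : boundary o x (val f) = \sum_(g : S) tinc (val g) (val f) * x (val g).
Proof.
rewrite (sum_star (fun g => tinc g (val f) * x g)); apply: boundary_seq; first exact: fset_uniq.
move=> g [_ cg fg _] _; rewrite in_star; apply/asboolP; split=> //.
by have [_ cf] := starP f; exact: subset_trans fg.
Qed.

Lemma star_exact (x : set V -> int) q : (forall f, x f != 0 -> cell f /\ dim f = q) -> (q < d)%N ->
  (forall f, cell f -> c `<=` f -> boundary o x f = 0) ->
  exists y : set V -> int, (forall g, y g != 0 -> [/\ cell g, c `<=` g & dim g = q.+1]) /\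
    forall f, cell f -> c `<=` f -> boundary o y f = x f.
Proof.
move=> xq qd bx; have [U LC] := star_complex.
have [h [tau [hd hE]]] := local_homotopy LC.
(* The contraction applied to [x] is the primitive; the term with the fundamental class is absent
   because [q < d]. *)
pose y0 (i : S) := \sum_f h i f * x (val f).
pose y g := if insub g is Some i then y0 i else 0.
have yE i : y (val i) = y0 i by rewrite /y valK.
exists y; split=> [g|f cf sf].
  rewrite /y; case: insubP => [i gS gi|]; rewrite ?eqxx// => h0.
  have [ci si] := starP i; rewrite -gi; split=> //.
  have [f hf] : exists f : S, h i f * x (val f) != 0.
    apply: contrapT => nf; move/negP: h0; apply; apply/eqP/big1 => f _.
    by apply/eqP/negPn/negP => hf; apply: nf; exists f.
  move: hf; rewrite mulf_eq0 negb_or => /andP[/hd -> /xq[_ ->]]//.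
have fS : f \in S by rewrite in_star; apply/asboolP.
have -> : f = val [` fS]%fset by []. move: [` fS]%fset => {fS cf sf f} f.
rewrite boundary_star; under eq_bigr do rewrite yE mulr_sumr.
rewrite exchange_big /=.
have [xf0|xf0] := eqVneq (dim (val f)) q; last first.
  have -> : x (val f) = 0 by apply/eqP/negPn/negP => /xq[_]; exact/eqP.
  apply: big1 => f0 _; apply: big1 => g _.
  have [->|/tinc_facet[_ _ _ dg]] := eqVneq (tinc (val g) (val f)) 0; first by rewrite mul0r.
  have [->|/hd dg'] := eqVneq (h g f0) 0; first by rewrite mul0r mulr0.
  have [->|/xq[_ dq]] := eqVneq (x (val f0)) 0; first by rewrite !mulr0.
  by move/eqP: xf0; case; rewrite -dq; apply: succn_inj; rewrite -dg' dg.
have E (f0 : S) : \sum_g tinc (val g) (val f) * (h g f0 * x (val f0)) =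
    (f == f0)%:R * x (val f0) - \sum_g h f g * (tinc (val f0) (val g) * x (val f0)).
  under eq_bigr do rewrite mulrA.
  under [in RHS]eq_bigr do rewrite mulrA.
  rewrite -!mulr_suml -mulrBl; congr (_ * _).
  by rewrite hE /lsigma xf0 ltn_eqF// mul0r addr0 addrK.
under eq_bigr do rewrite E.
rewrite sumrB [X in _ - X]exchange_big /= [X in _ - X]big1 ?subr0; last first.
  move=> g _; rewrite -mulr_sumr -boundary_star bx ?mulr0//; by case: (starP g).
rewrite (bigD1 f)//= eqxx mul1r big1 ?addr0// => f0.
by rewrite eq_sym => /negbTE ->; rewrite mul0r.
Qed.

(** In the top degree there are no cells for the contraction to reach and the boundary of [x]
    vanishes, so only the term with the fundamental class survives. *)
Lemma star_top (x : set V -> int) : (forall f, x f != 0 -> cell f /\ dim f = d) ->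
  (forall f, cell f -> c `<=` f -> boundary o x f = 0) ->
  exists a, forall f, cell f -> c `<=` f -> x f = a * sigma f.
Proof.
move=> xq bx; have [U LC] := star_complex.
have [h [tau [hd hE]]] := local_homotopy LC.
exists (\sum_f0 tau f0 * x (val f0)) => f cf sf.
have fS : f \in S by rewrite in_star; apply/asboolP.
have -> : f = val [` fS]%fset by []. move: [` fS]%fset => {fS cf sf f} f.
have -> : x (val f) = \sum_f0 (f == f0)%:R * x (val f0).
  rewrite (bigD1 f)//= eqxx mul1r big1 ?addr0// => f0.
  by rewrite eq_sym => /negbTE ->; rewrite mul0r.
under eq_bigr do rewrite hE !mulrDl !mulr_suml.
rewrite !big_split /= [X in X + _ + _]big1 ?add0r; last first.
  move=> f0 _; apply: big1 => g _.
  have [->|/hd dg'] := eqVneq (h g f0) 0; first by rewrite mulr0 mul0r.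
  have [->|/xq[_ dq]] := eqVneq (x (val f0)) 0; first by rewrite !mulr0.
  by have := dim_max (val g); rewrite dg' dq ltnn.
rewrite exchange_big /= big1 ?add0r; last first.
  move=> g _; under eq_bigr do rewrite -mulrA.
  by rewrite -mulr_sumr -boundary_star bx ?mulr0//; case: (starP g).
by rewrite mulr_suml; apply: eq_bigr => f0 _; rewrite -mulrA mulrC.
Qed.

End Star.

Lemma tinc_tinc h f r : cell f -> uniq r -> (forall g, facet T f g -> facet T g h -> g \in r) ->
  \sum_(g <- r) tinc h g * tinc g f = 0.
Proof.
move=> cf ur rP.
transitivity (boundary o (tinc h) f).
  rewrite (@boundary_seq _ _ r) => [|//|g fg /tinc_facet]; last exact: rP.
  by apply: eq_bigr => g _; rewrite mulrC.
have [hS|hS] := pselect (cell h /\ f `<=` h); last first.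
  rewrite (@boundary_seq _ _ [::]) ?big_nil// => g [_ _ fg _] /tinc_facet[_ ch gh _].
  by case: hS; split=> //; exact: subset_trans gh.
have [U LC] := star_complex cf.
have fS : f \in fset_set [set e | cell e /\ f `<=` e] by rewrite (in_star cf); apply/asboolP; split.
have hS' : h \in fset_set [set e | cell e /\ f `<=` e] by rewrite (in_star cf); apply/asboolP.
rewrite -[f]/(val [` fS]%fset) (boundary_star cf) -[RHS](boundary_sqr LC [` hS']%fset [` fS]%fset).
by apply: eq_bigr => g _; rewrite mulrC.
Qed.

Lemma boundary_tsigma f : boundary o sigma f = 0.
Proof.
have [cf|ncf] := pselect (cell f); last first.
  by rewrite (@boundary_seq _ _ [::]) ?big_nil// => g [].
have [U LC] := star_complex cf.
have fS : f \in fset_set [set e | cell e /\ f `<=` e] by rewrite (in_star cf); apply/asboolP; split.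
rewrite -[f]/(val [` fS]%fset) (boundary_star cf) -[RHS](boundary_sigma LC [` fS]%fset).
by apply: eq_bigr => g _; rewrite mulrC.
Qed.

Lemma tsigma_sqr c : cell c -> dim c = d -> sigma c * sigma c = 1.
Proof.
move=> cc dc; have [U LC] := star_complex cc.
have cS : c \in fset_set [set e | cell e /\ c `<=` e] by rewrite (in_star cc); apply/asboolP; split.
exact: (lsigma_sqr LC (f := [` cS]%fset) dc).
Qed.

(** Inside the star, [cofacet_exists] is repeated until the dimension is [d]. *)
Lemma cell_tile c : cell c -> exists t, tile T t /\ c `<=` t.
Proof.
move=> cc; have [U LC] := star_complex cc.
suff H k f : (d - dim f < k)%N -> cell f -> c `<=` f -> exists t, tile T t /\ c `<=` t.
  by apply: (H (d - dim c).+1 c).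
elim: k f => // k IH f fk cf sf.
have [df|df] := eqVneq (dim f) d; first by exists f.
have {}df : (dim f < d)%N by rewrite ltn_neqAle df dim_max.
have fS : f \in fset_set [set e | cell e /\ c `<=` e] by rewrite (in_star cc); apply/asboolP.
have [g [/= fg dfg]] := cofacet_exists LC (f := [` fS]%fset) df.
have [cg sg] := starP cc g.
by apply: (IH (val g)) => //; rewrite dfg /=; lia.
Qed.

End Exactness.

(** * Faces of a cell *)

Lemma detl_scale (R : realType) q (l1 l2 : seq 'rV[R]_q) (a : R) (u : 'rV[R]_q) : (size l1 < q)%N ->
  detl (l1 ++ (a *: u) :: l2) = a * detl (l1 ++ u :: l2).
Proof.
move=> sq; have := @detl_linear _ q l1 l2 a u 0 sq; rewrite addr0 => ->.
have := @detl_linear _ q l1 l2 1 0 0 sq; rewrite scaler0 addr0 mul1r.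
by rewrite -[LHS]addr0 => /addrI <-; rewrite addr0.
Qed.

Lemma detl_swap (R : realType) q (l1 l2 : seq 'rV[R]_q) (u v : 'rV[R]_q) : (size l1 + (size l2).+2)%N = q ->
  detl (l1 ++ u :: v :: l2) = - detl (l1 ++ v :: u :: l2).
Proof.
move=> sq; have s1 : (size l1 < q)%N by rewrite -[X in (_ < X)%N]sq addnS ltnS leq_addr.
have s2 w : (size (rcons l1 w) < q)%N by rewrite size_rcons -[X in (_ < X)%N]sq !addnS !ltnS leq_addr.
have dup w : detl (l1 ++ w :: w :: l2) = 0.
  have := @detl_dependent _ q l1 (w :: l2) (fun k => (k == 0%N)%:R) sq.
  by rewrite /= big_ord_recl /= scale1r big1 ?addr0// => i _; rewrite scale0r.
have Dl x y z : detl (l1 ++ x + y :: z :: l2) = detl (l1 ++ x :: z :: l2) + detl (l1 ++ y :: z :: l2).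
  by have := @detl_linear _ q l1 (z :: l2) 1 x y s1; rewrite scale1r mul1r.
have Dr x y z : detl (l1 ++ z :: x + y :: l2) = detl (l1 ++ z :: x :: l2) + detl (l1 ++ z :: y :: l2).
  by have := @detl_linear _ q (rcons l1 z) l2 1 x y (s2 z); rewrite scale1r mul1r !cat_rcons.
by have := dup (u + v); rewrite Dl !Dr !dup add0r addr0 => /eqP; rewrite addr_eq0 => /eqP.
Qed.

Lemma sum_option (P : finType) (F : option P -> int) :
  \sum_i F i = F None + \sum_j F (Some j).
Proof.
rewrite (perm_big (None :: map Some (index_enum P))) /= ?big_cons ?big_map//.
apply: uniq_perm => [|/=|[i|]]; rewrite ?index_enum_uniq//.
- rewrite map_inj_uniq ?index_enum_uniq ?andbT; last by move=> ? ? [].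
  by apply/negP => /mapP[].
- by rewrite mem_index_enum inE map_f ?orbT// mem_index_enum.
- by rewrite mem_index_enum mem_head.
Qed.

Section Pyramid.
Context {R : realType} {d : nat} {L : Type} (T : polytopal_tiling R d L) (o : orientation T).
Local Notation V := 'rV[R]_d.
Implicit Types (f g : set V) (b x y z : V) (t s : R).
Local Notation cell := (cells T).

Definition pyramid b f : set V :=
  [set z | exists t x, [/\ 0 <= t, t <= 1, f x & z = b + t *: (x - b)]].

Lemma pyramid_base b f : f `<=` pyramid b f.
Proof. by move=> x fx; exists 1, x; split=> //; rewrite scale1r addrC subrK. Qed.

Lemma pyramid_apex b f : f !=set0 -> pyramid b f b.
Proof. by move=> [x fx]; exists 0, x; split=> //; rewrite scale0r addr0. Qed.

Lemma pyramidS b f g : f `<=` g -> pyramid b f `<=` pyramid b g.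
Proof. by move=> fg _ [t [x [t0 t1 /fg gx ->]]]; exists t, x. Qed.

Lemma pyramid_polytope b f : polytope f -> polytope (pyramid b f).
Proof.
move=> [n [p ->]]; exists n.+1, (fun i => if unlift ord0 i is Some j then p j else b).
apply/seteqP; split=> [_ [t [_ [t0 t1 [w [w0 w1 ->]] ->]]]|_ [w [w0 w1 ->]]].
  exists (fun i => if unlift ord0 i is Some j then t * w j else 1 - t); split.
  - by move=> i; case: unliftP => [j _|_]; rewrite ?subr_ge0// mulr_ge0.
  - rewrite big_ord_recl unlift_none; under eq_bigr do rewrite liftK.
    by rewrite -mulr_sumr w1 mulr1 subrK.
  - rewrite [RHS]big_ord_recl unlift_none; under [in RHS]eq_bigr do rewrite liftK -scalerA.
    by rewrite -scaler_sumr; apply/rowP => i; rewrite !mxE; ring.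
move: w1; rewrite big_ord_recl [X in _ -> pyramid b _ X]big_ord_recl unlift_none.
under [X in _ -> pyramid b _ (_ + X)]eq_bigr do rewrite liftK.
set s := \sum_i w (lift ord0 i) => w1.
have s0 : 0 <= s by exact: sumr_ge0.
have w00 := w0 ord0.
have [s00|sn] := eqVneq s 0.
  exists 0, (p ord0); split=> //.
    exists (fun i => (i == ord0)%:R); split=> //.
      by rewrite big_ord_recl eqxx big1 ?addr0// => i _.
    by rewrite big_ord_recl eqxx scale1r big1 ?addr0// => i _; rewrite scale0r.
  move: w1; rewrite s00 addr0 => ->; rewrite scale1r scale0r.
  rewrite big1 ?addr0// => i _.
  have /psumr_eq0P : s = 0 by []. move=> /(_ (fun i _ => w0 _)) -> //.
  by rewrite scale0r.
exists s, (s^-1 *: \sum_i w (lift ord0 i) *: p i); split=> //.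
- by lra.
- exists (fun i => s^-1 * w (lift ord0 i)); split.
  + by move=> i; rewrite mulr_ge0// invr_ge0.
  + by rewrite -mulr_sumr mulVf.
  + by rewrite scaler_sumr; apply: eq_bigr => i _; rewrite scalerA.
- rewrite scalerBr scalerA divff// scale1r addrCA addrC; congr (_ + _).
  by rewrite -[X in _ = X - _]scale1r -scalerBl; congr (_ *: _); lra.
Qed.

Variable e : set V.
Hypothesis ce : cell e.
Let n := dim e.
Variable b : V.
Hypothesis rb : relint e b.
Let eb : e b. Proof. by case: rb. Qed.
Let pe : polytope e. Proof. exact: cells_polytope ce. Qed.

Definition proper_face f := [/\ cell f, f `<=` e & f <> e].

Lemma proper_not_relint f x : proper_face f -> f x -> ~ relint e x.
Proof. by move=> [cf fe ne] fx; exact: face_not_relint cf ce ne fe fx. Qed.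

Lemma ray_relint x t : e x -> 0 <= t -> t < 1 -> relint e (b + t *: (x - b)).
Proof.
move=> ex t0 t1; rewrite (_ : _ + _ = (1 - (1 - t)) *: x + (1 - t) *: b); last first.
  by apply/rowP => i; rewrite !mxE; ring.
by apply: relint_segment => //; lra.
Qed.

(** A ray from [b] meets the boundary of [e] once: of two such points the nearer one would be
    relatively interior to [e]. *)
Lemma ray_unique f g x y t s : proper_face f -> proper_face g -> f x -> g y ->
  0 < t -> 0 < s -> b + t *: (x - b) = b + s *: (y - b) -> x = y /\ t = s.
Proof.
move=> pf pg fx gy t0 s0 /addrI E.
wlog ts : f g x y t s pf pg fx gy t0 s0 E / s <= t => [hw|].
  have [st|ts] := leP s t; first exact: (hw f g x y t s).
  by have [-> ->] := hw g f y x s t pg pf gy fx s0 t0 (esym E) (ltW ts).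
have xE : x = b + (s / t) *: (y - b).
  by rewrite mulrC -scalerA -E scalerA mulVf ?gt_eqF// scale1r addrC subrK.
have [_ ge _] := pg.
have st : s = t.
  apply/eqP; rewrite eq_le ts /= leNgt; apply/negP => st.
  apply: (proper_not_relint pf fx); rewrite xE; apply: ray_relint (ge _ gy) _ _.
    by rewrite divr_ge0// ltW.
  by rewrite ltr_pdivrMr// mul1r.
by split=> //; rewrite xE st divff ?gt_eqF// scale1r addrC subrK.
Qed.

Lemma pyramid_sub f : f `<=` e -> pyramid b f `<=` e.
Proof.
move=> fe _ [t [x [t0 t1 /fe ex ->]]].
rewrite (_ : _ + _ = (1 - t) *: b + t *: x); last by apply/rowP => i; rewrite !mxE; ring.
exact: polytope_convex.
Qed.

Lemma apex_direction f x : proper_face f -> f x -> ~ (x - b <= direction f)%MS.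
Proof.
move=> pf fx; have [cf fe ne] := pf.
have [z rz] := polytope_relint (cells_polytope cf).
rewrite -opprB eqmx_opp; apply: (relint_transversal pe fe rz) => //.
by apply: (proper_not_relint pf); case: rz.
Qed.

Lemma pyramid_direction f x : proper_face f -> f x ->
  (direction (pyramid b f) :=: (x - b)%R + direction f)%MS.
Proof.
move=> [cf fe ne] fx; apply/eqmxP/andP; split.
  apply/directionP => _ _ [t [y [_ _ fy ->]]] [s [z [_ _ fz ->]]].
  have h p u : f p -> (u *: (p - b) <= (x - b)%R + direction f)%MS.
    move=> fp; rewrite (_ : p - b = (x - b) + (p - x)); last by rewrite [RHS]addrC addrA subrK.
    apply: scalemx_sub; rewrite addmx_sub//; first exact: addsmxSl.
    by apply: submx_trans (addsmxSr _ _); exact: sub_direction.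
  rewrite opprD addrACA subrr add0r addmx_sub ?eqmx_opp//; exact: h.
rewrite addsmx_sub direction_sub ?andbT; last exact: pyramid_base.
by apply: sub_direction; [apply: pyramid_apex; exists x|exact: pyramid_base].
Qed.

Lemma pyramid_dim f : proper_face f -> dim (pyramid b f) = (dim f).+1.
Proof.
move=> pf; have [cf fe ne] := pf; have [x fx] := cell_nonempty cf.
rewrite /dim (pyramid_direction pf fx); apply/eqP; rewrite eqn_leq; apply/andP; split.
  by apply: leq_trans (mxrank_adds_leqif _ _) _; have := rank_leq_row (x - b); lia.
apply: rank_ltmx; rewrite ltmxE addsmxSr /=; apply/negP => h.
by apply: (apex_direction pf fx); exact: submx_trans (addsmxSl _ _) h.
Qed.

Lemma pyramid_face f g : proper_face f -> proper_face g ->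
  pyramid b f `<=` pyramid b g -> f `<=` g.
Proof.
move=> pf [_ ge _] fg x fx; have [t [y [t0 t1 gy xE]]] := fg _ (@pyramid_base b f x fx).
have [t1'|t1'] := ltP t 1.
  by have := ray_relint (ge _ gy) t0 t1'; rewrite -xE => /(proper_not_relint pf fx).
have t11 : t = 1 by apply/eqP; rewrite eq_le t1.
by rewrite xE t11 scale1r addrC subrK.
Qed.

Lemma pyramid_relintP f z : proper_face f -> relint e z -> relint (pyramid b f) z ->
  exists t x, [/\ 0 < t, t < 1, relint f x & z = b + t *: (x - b)].
Proof.
move=> pf rez rz; have [cf fe ne] := pf.
have [[t [x [t0 t1 fx zE]]] _] := rz.
have {}t1 : t < 1.
  rewrite lt_neqAle t1 andbT; apply/eqP => t11.
  by move: rez; rewrite zE t11 scale1r addrC subrK; exact: proper_not_relint pf fx.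
have xd : (x - b <= direction (pyramid b f))%MS.
  by rewrite (pyramid_direction pf fx) addsmxSl.
have [y ry] := polytope_relint (cells_polytope cf); have fy : f y by case: ry.
(* If [z] were the apex, the pyramid would contain a point beyond [b] on the line from [x], and [b]
   would lie between two points of [f]. *)
have {}t0 : 0 < t.
  rewrite lt_neqAle t0 andbT; apply/eqP => t00.
  move: rz; rewrite zE -t00 scale0r addr0 => /relint_move/(_ xd)[r r0 hr].
  have [|[s [x' [s0 s1 fx' E]]] _] := hr (- r); first by rewrite normrN gtr0_norm.
  apply: (proper_not_relint pf _ rb).
  have rs : 0 < r + s by lra.
  rewrite (_ : b = (1 - s / (r + s)) *: x + (s / (r + s)) *: x'); last first.
    move/addrI: E => E; have {E} E i : - r * (x 0 i - b 0 i) = s * (x' 0 i - b 0 i).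
      by have := congr1 (fun M : V => M 0 i) E; rewrite !mxE.
    apply/rowP => i; rewrite !mxE; apply: (mulfI (lt0r_neq0 rs)).
    rewrite [RHS](_ : _ = r * x 0 i + s * x' 0 i); last by field; rewrite gt_eqF.
    by have := E i; lra.
  apply: polytope_convex (cells_polytope cf) _ _ fx fx'; first by rewrite divr_ge0// ltW.
  by rewrite ler_pdivrMr//; lra.
exists t, x; split=> //.
(* A small move of [z] parallel to [f] stays in the pyramid. The heights [s] and [t] agree because
   [x' - b] is not parallel to [f], so the move prolongs the segment from [y] beyond [x] inside
   [f]. *)
have [r r0 hr] : exists2 r, 0 < r & relint (pyramid b f) (z + r *: (t *: (x - y))).
  have [|r r0 hr] := relint_move rz (w := t *: (x - y)).
    apply: scalemx_sub; rewrite (pyramid_direction pf fx).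
    by apply: submx_trans (addsmxSr _ _); exact: sub_direction.
  by exists r => //; apply: hr; rewrite gtr0_norm.
have [[s [x' [s0 s1 fx' E]]] _] := hr.
apply: (relint_extend (cells_polytope cf) ry r0).
suff -> : x + r *: (x - y) = x' by [].
have E' : t *: (x + r *: (x - y) - b) = s *: (x' - b).
  by apply: (@addrI _ b); rewrite -E zE; apply/rowP => i; rewrite !mxE; ring.
have st : s = t.
  apply/eqP/negPn/negP => st; apply: (apex_direction pf fx').
  rewrite (_ : x' - b = (s - t)^-1 *: (t *: (x + r *: (x - y) - x'))).
    apply/scalemx_sub/scalemx_sub; rewrite addrAC addmx_sub//; first exact: sub_direction.
    by apply: scalemx_sub; exact: sub_direction.
  rewrite (_ : _ - x' = (x + r *: (x - y) - b) - (x' - b)); last first.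
    by rewrite opprB addrA subrK.
  by rewrite scalerBr E' -scalerBl scalerA mulVf ?scale1r// subr_eq0.
move: E'; rewrite st => /(scalerI (lt0r_neq0 t0))/addIr; exact.
Qed.

Lemma pyramid_relint f x t : proper_face f -> relint f x -> 0 < t -> t < 1 ->
  relint (pyramid b f) (b + t *: (x - b)).
Proof.
move=> pf rx t0 t1; have [cf fe ne] := pf.
have [y0 ry] := polytope_relint (pyramid_polytope b (cells_polytope cf)).
have [[t' [y [t'0 t'1 fy yE]]] _] := ry.
have fx : f x by case: rx.
have [r r0 hr] := relint_move rx (sub_direction fy fx).
(* The bounds keep the new height [Tm] in the range from [t / 2] to 1 and the displacement of the
   base point at most [r]. *)
pose s := Num.min ((1 - t) / 2) (Num.min (t / 2) (r * t / 2)).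
have s0 : 0 < s by rewrite /s !lt_min !divr_gt0 ?mulr_gt0 ?invr_gt0 ?subr_gt0.
have s1 : s <= (1 - t) / 2 by rewrite /s ge_min lexx.
have s2 : s <= t / 2 by rewrite /s !ge_min lexx !orbT.
have s3 : s <= r * t / 2 by rewrite /s !ge_min lexx !orbT.
apply: (relint_extend (pyramid_polytope b (cells_polytope cf)) ry s0).
have h1 : s * t' <= s by rewrite ler_piMr// ltW.
have h2 : 0 <= s * t' by rewrite mulr_ge0// ltW.
pose Tm := t + s * t - s * t'.
have st : 0 < s * t by rewrite mulr_gt0.
have Tm0 : t / 2 <= Tm by rewrite /Tm; lra.
have Tm00 : 0 < Tm by apply: lt_le_trans Tm0; rewrite divr_gt0.
have h3 : s * t <= s by rewrite ler_piMr// ltW.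
exists Tm, (x + (s * t' / Tm) *: (x - y)); split.
- exact: ltW.
- rewrite /Tm; lra.
- have [|//] := hr (s * t' / Tm); rewrite ger0_norm; last by rewrite divr_ge0// ltW.
  rewrite ler_pdivrMr//; apply: le_trans (_ : r * (t / 2) <= _); last by rewrite ler_pM2l.
  lra.
- rewrite yE; apply/rowP => i; rewrite !mxE /Tm; field; rewrite gt_eqF//.
Qed.


Let P := fset_set [set f | proper_face f].

Lemma finite_proper_faces : finite_set [set f | proper_face f].
Proof. by apply: sub_finite_set (finite_faces ce) => f []. Qed.

Lemma in_proper f : (f \in P) = `[< proper_face f >].
Proof. by rewrite in_fset_set//; exact: finite_proper_faces. Qed.

Lemma properP (i : P) : proper_face (val i).
Proof. by apply/asboolP; rewrite -in_proper; exact: valP. Qed.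

Definition pyr (i : option P) : set V := if i is Some f then pyramid b (val f) else [set b].

Definition pyr_frame (i : option P) : seq V :=
  if i is Some f then (xget 0 (val f) - b) :: cframe o (val f) else [::].

(* A pyramid on f is oriented by a vector from b to f followed by the frame
   of f, and the apex positively. *)
Definition pyr_inc (i j : option P) : int :=
  match i, j with
  | Some g, Some f => - tinc o (val g) (val f)
  | Some g, None => if dim (val g) == 0%N then -1 else 0
  | None, _ => 0
  end.

Lemma xget_proper (i : P) : val i (xget 0 (val i)).
Proof.
have [cf _ _] := properP i; have [x fx] := cell_nonempty cf.
by case: xgetP => // /(_ x).
Qed.

Lemma point_direction : direction [set b] = 0.
Proof.
apply/eqP; rewrite -submx0; apply/directionP => x y -> ->.
by rewrite subrr sub0mx.
Qed.

Lemma dim_point : dim [set b] = 0%N.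
Proof. by rewrite /dim point_direction mxrank0. Qed.

Lemma point_relint : relint [set b] b.
Proof.
split=> //; near=> y; rewrite point_direction submx0 subr_eq0 => /eqP //.
Unshelve. all: by end_near.
Qed.

Lemma pyr_disjoint i j x : relint e x -> relint (pyr i) x -> relint (pyr j) x -> i = j.
Proof.
have apex (f : P) : ~ relint (pyramid b (val f)) b.
  move=> rfb; have [t [y [t0 _ [fy _] E]]] := pyramid_relintP (properP f) rb rfb.
  apply: (proper_not_relint (properP f) fy); suff -> : y = b by [].
  move: E; rewrite -[X in X = _]addr0 => /addrI/esym/eqP; rewrite scaler_eq0 gt_eqF//= subr_eq0.
  by move/eqP.
move=> rex; case: i => [f|]; case: j => [g|] //=.
- move=> /(pyramid_relintP (properP f) rex)[t [y [t0 t1 ry ->]]].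
  move: rex => _ /[dup] + rg.
  have rz : relint e (b + t *: (y - b)).
    by apply: ray_relint => //; [have [_ fe _] := properP f; apply: fe; case: ry|exact: ltW].
  move=> /(pyramid_relintP (properP g) rz)[s [z [s0 s1 rz' E]]].
  have [yz _] := ray_unique (properP f) (properP g) ry.1 rz'.1 t0 s0 E.
  congr Some; apply: val_inj; have [cf _ _] := properP f; have [cg _ _] := properP g.
  by apply: relint_inj cf cg ry _; rewrite yz.
- by move=> rf [xb _]; move: rf; rewrite xb => /apex.
- by move=> [xb _]; rewrite xb => /apex.
Qed.

(** The ray from [b] through [x] leaves [e] in a proper face, and [x] lies strictly between [b] and
    the exit point. *)
Lemma pyr_cover x : relint e x -> exists i, relint (pyr i) x.
Proof.
move=> rx; have [->|xb] := eqVneq x b; first by exists None; exact: point_relint.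
have [K eK] := polytope_bounded pe.
have w0 : 0 < `|x - b| by rewrite normr_gt0 subr_eq0.
have K0 : 0 <= K by apply: le_trans (eK b eb).
pose z := b + ((K + `|b| + 1) / `|x - b|) *: (x - b).
have ncz : ~ e z.
  move=> /eK; apply/negP; rewrite -ltNge /z.
  have : `|((K + `|b| + 1) / `|x - b|) *: (x - b)| = K + `|b| + 1.
    by rewrite normrZ ger0_norm ?divfK ?gt_eqF// divr_ge0// ?addr_ge0.
  set u := _ *: (x - b) => un; have : `|u| <= `|b + u| + `|b|.
    by have := ler_normB (b + u) b; rewrite addrAC subrr add0r.
  by rewrite un; lra.
have [|t [t0 t1 ey ny]] := relint_exit pe rb ncz.
  by rewrite /z addrAC subrr add0r scalemx_sub// sub_direction//; case: rx.
move: ey ny; set y := b + _ => ey ny.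
have [f cf rf] := point_cell T y; have fe := relint_face cf ce rf ey.
have pf : proper_face f by split=> // fE; apply: ny; rewrite -fE.
have fP : f \in P by rewrite in_proper; apply/asboolP.
exists (Some [` fP]%fset); rewrite /=.
pose k := t * ((K + `|b| + 1) / `|x - b|).
have k0 : 0 < k by rewrite mulr_gt0// divr_gt0//; have := normr_ge0 b; lra.
have yk : y = b + k *: (x - b) by rewrite /y /z addrAC subrr add0r scalerA.
have xE : x = b + k^-1 *: (y - b).
  by rewrite yk addrAC subrr add0r scalerA mulVf ?gt_eqF// scale1r addrC subrK.
rewrite xE; apply: pyramid_relint => //; first by rewrite invr_gt0.
rewrite invf_plt ?posrE// invr1 ltNge; apply/negP => k1.
apply: ny; rewrite yk (_ : _ + _ = (1 - k) *: b + k *: x); last first.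
  by apply/rowP => i; rewrite !mxE; ring.
exact: relint_segment.
Qed.

Lemma pyr_apex i : pyr i b.
Proof. by case: i => [f|] //=; apply: pyramid_apex; exists (xget 0 (val f)); exact: xget_proper. Qed.

Lemma pyr_face i j x : relint e x -> relint (pyr i) x -> pyr j x -> pyr i `<=` pyr j.
Proof.
move=> rex; case: i => [f|] /=; last first.
  by move=> _ _ _ ->; exact: pyr_apex.
move=> /[dup] rx /(pyramid_relintP (properP f) rex)[t [y [t0 t1 ry xE]]].
have xb : x <> b.
  move=> xb; have rxb : relint (pyr (Some f)) b by rewrite -[X in relint _ X]xb.
  by have := pyr_disjoint (i := None) rb point_relint rxb.
case: j => [g|] //= [s [z [s0 s1 gz xE']]].
have [cf _ _] := properP f; have [cg ge _] := properP g.
have {}s0 : 0 < s.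
  by rewrite lt_neqAle s0 andbT; apply/eqP => s00; apply: xb; rewrite xE' -s00 scale0r addr0.
have [yz _] := ray_unique (properP f) (properP g) ry.1 gz t0 s0 (etrans (esym xE) xE').
by apply: pyramidS; apply: (relint_face cf cg ry); rewrite yz.
Qed.

Lemma pyr_polytope i : polytope (pyr i).
Proof.
case: i => [f|] /=; first by have [cf _ _] := properP f; exact: pyramid_polytope (cells_polytope cf).
exists 0%N, (fun=> b); apply/seteqP; split=> [_ ->|_ [w [_ w1 ->]]].
  by exists (fun=> 1); split; rewrite ?big_ord1 ?scale1r.
by move: w1; rewrite !big_ord1 => ->; rewrite scale1r.
Qed.

Lemma pyr_sub i : pyr i `<=` e.
Proof. by case: i => [f|] /=; [have [_ fe _] := properP f; exact: pyramid_sub|move=> _ ->]. Qed.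

Lemma pyr_frame_of i : frame_of (pyr_frame i) (direction (pyr i)) (dim (pyr i)).
Proof.
case: i => [f|] /=; last first.
  rewrite dim_point; split=> // v.
  by rewrite point_direction submx0 => /eqP ->; exists (fun=> 0); rewrite big_ord0.
have pf := properP f; have [cf _ _] := pf; have D := pyramid_direction pf (xget_proper f).
rewrite (pyramid_dim pf); apply: frame_of_cons (frame_of_cframe o cf) _ _ _ _.
- exact: apex_direction pf (xget_proper f).
- by rewrite D addsmxSr.
- by rewrite D addsmxSl.
- by rewrite D.
Qed.

Lemma pyr_facet (f g : option P) : pyr f `<=` pyr g -> dim (pyr g) = (dim (pyr f)).+1 ->
  match g, f with
  | Some g', Some f' => facet T (val f') (val g')
  | Some g', None => dim (val g') = 0%N
  | None, _ => False
  end.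
Proof.
case: g => [g|]; last by rewrite /= dim_point.
have pg := properP g; have [cg _ _] := pg.
case: f => [f|] /=; last by rewrite dim_point (pyramid_dim pg) => _ [].
have pf := properP f; have [cf _ _] := pf.
rewrite (pyramid_dim pf) (pyramid_dim pg) => h [dfg]; split=> //.
exact: pyramid_face pf pg h.
Qed.

Lemma pyr_inc0 (f g : option P) : pyr_inc g f != 0 -> pyr f `<=` pyr g /\ dim (pyr g) = (dim (pyr f)).+1.
Proof.
case: g => [g|] //=; case: f => [f|] /=.
  rewrite oppr_eq0 => /tinc_facet[_ _ fg dfg]; split; first exact: pyramidS.
  by rewrite (pyramid_dim (properP f)) (pyramid_dim (properP g)) dfg.
case: (dim (val g) =P 0%N) => [g0 _|_ /eqP//].
split; last by rewrite dim_point (pyramid_dim (properP g)) g0.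
by move=> _ ->; exact: (pyr_apex (Some g)).
Qed.

Lemma pyr_inc_sqr (f g : option P) : pyr f `<=` pyr g -> dim (pyr g) = (dim (pyr f)).+1 ->
  pyr_inc g f * pyr_inc g f = 1.
Proof.
move=> h1 h2; have := pyr_facet h1 h2; case: g h1 h2 => [g|//] _ _; case: f => [f|] /=.
  by move=> fg; rewrite mulrNN /tinc asboolT// incidence_sqr.
by move=> ->; rewrite eqxx.
Qed.

Lemma half_point f y : relint f y -> proper_face f -> relint (pyramid b f) (b + 2^-1 *: (y - b)).
Proof. by move=> rf pf; apply: pyramid_relint => //; rewrite ?invr_gt0// invf_lt1// ltr1n. Qed.

(** The minus sign comes from exchanging the outward vector with the vector from the apex. For the
    pyramid on a vertex, the outward vector at the apex is opposite to the frame. *)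
Lemma pyr_incidence (f g : option P) x y (q := n.+1) (h : {linear V -> 'rV[R]_q}) (l : seq 'rV[R]_q) :
  pyr f `<=` pyr g -> dim (pyr g) = (dim (pyr f)).+1 ->
  pyr f x -> relint (pyr g) y -> (size l + dim (pyr g))%N = q ->
  sgz (detl (l ++ h (x - y) :: map h (pyr_frame f))) =
  pyr_inc g f * sgz (detl (l ++ map h (pyr_frame g))).
Proof.
move=> sfg dfg fx ry sq; have fc := pyr_facet sfg dfg.
have notr : exists2 z, relint (pyr f) z & ~ relint (pyr g) z.
  have [z [rz Uz]] : exists z, relint (pyr f) z /\ relint e z.
    case: (f) => [f'|]; last by exists b; split; [exact: point_relint|].
    have pf := properP f'; have [cf fe _] := pf; have [w rw] := polytope_relint (cells_polytope cf).
    exists (b + 2^-1 *: (w - b)); split; first exact: half_point.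
    by apply: ray_relint; [apply: fe; case: rw|rewrite invr_ge0|rewrite invf_lt1// ltr1n].
  exists z => // rgz; have fg := pyr_disjoint Uz rz rgz.
  by move: dfg; rewrite fg; lia.
have key x1 y1 : pyr f x1 -> relint (pyr g) y1 ->
    sgz (detl (l ++ h (x - y) :: map h (pyr_frame f))) =
    sgz (detl (l ++ h (x1 - y1) :: map h (pyr_frame f))).
  move=> fx1 ry1; have [t [w [-> t0 wf]]] := outward_unique (pyr_polytope f) (pyr_polytope g)
    sfg dfg notr fx ry fx1 ry1.
  rewrite (detl_outward h (x1 - y1) t (pyr_frame_of f) wf); last by rewrite -dfg.
  by rewrite sgzM gtr0_sgz// mul1r.
have lq : (size l < q)%N by rewrite -[X in (_ < X)%N]sq dfg addnS ltnS leq_addr.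
case: g f fc sfg dfg fx ry sq key notr => [g|//] [f|] fc sfg dfg fx ry sq key notr.
- have pf := properP f; have pg := properP g; have [cf _ _] := pf; have [cg _ _] := pg.
  have fF := xget_proper f; set yf := xget 0 (val f) in fF; have [w rw] := polytope_relint (cells_polytope cg).
  (* Both points are taken halfway to the bases, so that their difference is half an outward vector
     of [val f] in [val g]. *)
  rewrite (key (b + 2^-1 *: (yf - b)) (b + 2^-1 *: (w - b))); last first.
  + exact: half_point.
  + exists 2^-1, yf; split=> //; first by rewrite invr_ge0.
    by rewrite invf_le1// ler1n.
  rewrite (_ : _ - _ = 2^-1 *: (yf - w)); last by apply/rowP => i; rewrite !mxE; ring.
  rewrite linearZ /= detl_scale// detl_swap; last first.
    by rewrite size_map size_rows -[RHS]sq dfg /= (pyramid_dim pf).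
  rewrite sgzM gtr0_sgz ?invr_gt0// mul1r sgzN -cat_rcons.
  rewrite (@outward_incidence _ _ _ _ o (val f) (val g))//; last first.
    by rewrite size_rcons -[RHS]sq /= (pyramid_dim pg) addSnnS.
  rewrite /pyr_inc /tinc asboolT// mulNr cat_rcons; congr (- (_ * sgz _)).
  rewrite /= (_ : yf - b = 1 *: (xget 0 (val g) - b) + (yf - xget 0 (val g))); last first.
    by rewrite scale1r [RHS]addrC addrA subrK.
  rewrite (detl_outward h _ 1 (frame_of_cframe o cg)) ?mul1r//.
    apply: sub_direction; first exact: xget_proper.
    by have [_ _ + _] := fc; apply.
  by rewrite -[RHS]sq /= (pyramid_dim pg).
- have pg := properP g; have [cg _ _] := pg; have [w rw] := polytope_relint (cells_polytope cg).
  have gG := xget_proper g.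
  rewrite (key b (b + 2^-1 *: (w - b)))//; last exact: half_point.
  rewrite (_ : _ - _ = (- 2^-1) *: (w - b)); last by apply/rowP => i; rewrite !mxE; ring.
  rewrite linearZ /= detl_scale// sgzM sgzN gtr0_sgz ?invr_gt0// fc eqxx; congr (_ * sgz (detl (_ ++ _))).
  have -> : w = xget 0 (val g).
    apply/eqP; rewrite -subr_eq0 -submx0; have <- : direction (val g) = 0 by apply/eqP; rewrite -mxrank_eq0; exact/eqP.
    by apply: sub_direction => //; case: rw.
  by rewrite /cframe fc /rows enum_ord0.
Qed.

Lemma pyr_complex : local_complex (frame o n e) (relint e) pyr pyr_frame pyr_inc.
Proof.
have [fE E] := frame_free o ce erefl.
split=> //.
- move=> x y t t0 t1 rx ry; have [->|tn] := eqVneq t 0; first by rewrite subr0 scale1r scale0r addr0.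
  by apply: relint_segment => //; [case: rx|rewrite lt_neqAle eq_sym tn].
- move=> x rx; have [r r0 hr] := relint_nbhd rx; exists r => // y xy yE.
  by apply: hr => //; rewrite -E.
- by move=> x y [ex _] [ey _]; rewrite E sub_direction.
- exact: pyr_polytope.
- by move=> i; exists b; split=> //; exact: pyr_apex.
- by move=> i; rewrite E direction_sub//; exact: pyr_sub.
- by move=> i j x; exact: pyr_disjoint.
- exact: pyr_cover.
- by move=> i j x; exact: pyr_face.
- by move=> i; case: (pyr_frame_of i).
- by move=> i; case: (pyr_frame_of i).
- by move=> i; case: (pyr_frame_of i).
- by move=> i; case: (pyr_frame_of i).
- by move=> f g nfg; apply/eqP/negPn/negP => /pyr_inc0.
- exact: pyr_inc_sqr.
- by move=> f g x y l; exact: pyr_incidence.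
Qed.

(** The fundamental class of the interior of [e] is the cone over the boundary of [e]. Hence the
    cocycle condition at [e] itself becomes orthogonality to the fundamental class. *)
Lemma pyr_sigma i : @lsigma R d n (frame o n e) _ pyr pyr_frame i =
  if i is Some f then tinc o e (val f) else (n == 0%N)%:R.
Proof.
have rowsE : hpt (frame o n e) 0 :: map (hvec (frame o n e)) (cframe o e) = rows 1%:M.
  rewrite scalar_mx_block block_mxEv rows_col; congr (_ :: _).
    by rewrite /hpt mul0mx.
  rewrite -(mulmxVp (frame_free o ce erefl).1) /rows -map_comp; apply: eq_map => j /=.
  by rewrite row_row_mx row0 row_mul.
case: i => [f|]; rewrite /lsigma /=; last first.
  rewrite dim_point eq_sym; case: eqP => // n0.
  have : detl (hpt (frame o n e) 0 :: map (hvec (frame o n e)) (cframe o e)) = 1.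
    by rewrite rowsE detl_rows det1.
  have -> : map (hvec (frame o n e)) (cframe o e) = [::].
    by apply/eqP; rewrite -size_eq0 size_map size_rows; exact/eqP.
  by move=> ->; rewrite sgz1.
have pf := properP f; have [cf fe _] := pf; rewrite (pyramid_dim pf) /tinc.
case: asboolP => [fc|nfc]; case: eqP => // dfe.
- have := @outward_incidence _ _ _ _ o _ _ _ _ _ (hvec (frame o n e)) [:: hpt (frame o n e) 0] fc
    (xget_proper f) rb erefl.
  by rewrite /= rowsE detl_rows det1 sgz1 mulr1.
- by have [_ _ _ /esym] := fc.
- by case: nfc; split.
Qed.

Lemma facet_proper f g : proper_face g -> facet T f g -> proper_face f.
Proof.
move=> [cg ge _] [cf _ fg dfg]; split=> //; first exact: subset_trans ge.
by move=> fE; have := dim_le ge; rewrite dfg fE; lia.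
Qed.

Lemma facet_proper_top f : facet T f e -> proper_face f.
Proof. by move=> [cf _ fe dfe]; split=> // fE; move: dfe; rewrite fE; lia. Qed.

Lemma coboundary_proper (psi : set V -> int) g : proper_face g \/ g = e ->
  coboundary o psi g = \sum_(f : P) tinc o g (val f) * psi (val f).
Proof.
move=> pg; rewrite -(big_seq_fsetE _ P predT (fun f => tinc o g f * psi f)).
apply: coboundary_seq; first exact: fset_uniq.
move=> f fg _; rewrite in_proper; apply/asboolP.
by case: pg fg => [pg|->]; [exact: facet_proper|exact: facet_proper_top].
Qed.

(** The homotopy is used transposed. The cocycle condition on proper faces removes one term and the
    condition at [e] removes the fundamental class. The value at the apex enters only for
    vertices. *)
Lemma pyr_primitive (psi : set V -> int) :
  (forall g, cell g -> g `<=` e -> coboundary o psi g = 0) ->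
  exists Phi : option P -> int,
    (forall g : option P, Phi g != 0 -> exists2 f : P, psi (val f) != 0 & (dim (val f)) = dim (pyr g)) /\
    forall f : P, psi (val f) = - (\sum_(g : P) tinc o (val f) (val g) * Phi (Some g)) -
      (if dim (val f) == 0%N then Phi None else 0).
Proof.
move=> dpsi; have [h [tau [hd hE]]] := local_homotopy pyr_complex.
pose Psi (i : option P) := if i is Some f then psi (val f) else 0.
exists (fun g : option P => \sum_f Psi f * h f g); split=> [g|f].
  move=> h0; have [f hf] : exists f : option P, Psi f * h f g != 0.
    apply: contrapT => nf; move/negP: h0; apply; apply/eqP/big1 => f _.
    by apply/eqP/negPn/negP => hf; apply: nf; exists f.
  move: hf; rewrite mulf_eq0 negb_or => /andP[]; case: f => [f|]; last by rewrite eqxx.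
  move=> /= pf /hd /=; rewrite (pyramid_dim (properP f)) => -[df]; by exists f.
have dP (g : option P) : \sum_f pyr_inc g f * Psi f = 0.
  rewrite sum_option mulr0 add0r; case: g => [g|]; last by rewrite big1// => ? _; rewrite mul0r.
  under eq_bigr do rewrite mulNr.
  have pg := properP g; have [cg ge _] := pg.
  by rewrite sumrN -coboundary_proper ?dpsi ?oppr0//; left.
have sP : \sum_f @lsigma R d n (frame o n e) _ pyr pyr_frame f * Psi f = 0.
  rewrite sum_option mulr0 add0r; under eq_bigr do rewrite pyr_sigma.
  by rewrite -coboundary_proper ?dpsi//; right.
transitivity (\sum_f0 (f0 == Some f)%:R * Psi f0).
  rewrite (bigD1 (Some f))//= eqxx mul1r big1 ?addr0// => f0 /negbTE ->; by rewrite mul0r.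
have E (f' : option P) : (f' == Some f)%:R * Psi f' =
    \sum_g h g (Some f) * (pyr_inc g f' * Psi f') +
    \sum_g pyr_inc (Some f) g * (Psi f' * h f' g) +
    tau (Some f) * (@lsigma R d n (frame o n e) _ pyr pyr_frame f' * Psi f').
  rewrite hE !mulrDl !mulr_suml; congr (_ + _ + _); last by ring.
    by apply: eq_bigr => g _; ring.
  by apply: eq_bigr => g _; ring.
under eq_bigr do rewrite E.
rewrite !big_split /= -mulr_sumr sP mulr0 addr0 exchange_big /= big1 ?add0r; last first.
  by move=> g _; rewrite -mulr_sumr dP mulr0.
rewrite exchange_big /=; under eq_bigr do rewrite -mulr_sumr.
rewrite sum_option addrC -sumrN; congr (_ + _).
  by apply: eq_bigr => g _; rewrite /= mulNr.
by rewrite /=; case: ifP => _; rewrite ?mulN1r// mul0r oppr0.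
Qed.

End Pyramid.

(** * Exactness on the faces of a cell *)

Section Faces.
Context {R : realType} {d : nat} {L : Type} (T : polytopal_tiling R d L) (o : orientation T).
Local Notation V := 'rV[R]_d.
Implicit Types (e f g : set V) (psi phi : set V -> int).
Local Notation cell := (cells T).
Variable e : set V.
Hypothesis ce : cell e.

Lemma proper_dim f : proper_face T e f -> (dim f < dim e)%N.
Proof. by move=> [cf fe ne]; exact: face_dim cf ce ne fe. Qed.

(** Starting at the apex, [cofacet_exists] climbs to a pyramid of full dimension, whose base is a
    facet of [e]. *)
Lemma facet_exists : (0 < dim e)%N -> exists f, facet T f e.
Proof.
move=> n0; have [b rb] := polytope_relint (cells_polytope ce).
have LC := pyr_complex o ce rb.
suff H k (i : option (fset_set [set f | proper_face T e f])) : (dim e - dim (pyr b i) < k)%N -> exists f, facet T f e.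
  by apply: (H (dim e - dim (pyr b (None : option (fset_set [set f | proper_face T e f])))).+1 None).
elim: k i => // k IH i ik.
have [di|di] := eqVneq (dim (pyr b i)) (dim e); last first.
  have dl := dim_lc LC i; have [|g [_ dg]] := cofacet_exists LC (f := i).
    by rewrite ltn_neqAle di.
  apply: (IH g); rewrite dg; lia.
case: i di {ik} => [f|]; last by rewrite /= dim_point => h; move: n0; rewrite -h.
have pf := properP ce f; have [cf fe ne] := pf.
rewrite /= (pyramid_dim ce rb pf) => h; by exists (val f); split.
Qed.

Lemma faces_exact psi p : (forall f, psi f != 0 -> cell f /\ dim f = p.+1) ->
  (forall g, cell g -> g `<=` e -> coboundary o psi g = 0) ->
  exists phi, (forall f, phi f != 0 -> [/\ cell f, f `<=` e & dim f = p]) /\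
    forall f, cell f -> f `<=` e -> coboundary o phi f = psi f.
Proof.
move=> psip dpsi.
have psi0 f : dim f <> p.+1 -> psi f = 0.
  by move=> df; apply/eqP/negPn/negP => /psip[_ /df].
have zero phi f : (forall f, phi f != 0 -> [/\ cell f, f `<=` e & dim f = p]) ->
    dim f <> p.+1 -> coboundary o phi f = 0.
  move=> phip df; rewrite (@coboundary_seq _ _ _ _ _ _ _ [::]) ?big_nil//.
  by move=> h [_ _ _ dh] /phip[_ _ dp]; case: df; rewrite dh dp.
have [b rb] := polytope_relint (cells_polytope ce).
have [pn|pn] := eqVneq (dim e) p.+1.
  have [|f0 f0e] := facet_exists; first by rewrite pn.
  have [cf0 _ sf0 df0] := f0e.
  (* In the top degree only the value at [e] matters, and a single facet suffices since its
     incidence number squares to 1. *)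
  pose phi f := if f == f0 then incidence o e f0 * psi e else 0.
  have phip f : phi f != 0 -> [/\ cell f, f `<=` e & dim f = p].
    rewrite /phi; case: (f =P f0) => [-> _|_ /eqP//].
    by split=> //; apply: succn_inj; rewrite -df0.
  exists phi; split=> // f cf fe.
  have [->|/eqP fE] := eqVneq f e; last first.
    have := proper_dim (And3 cf fe fE); rewrite pn => df.
    by rewrite zero// ?psi0//; lia.
  rewrite (@coboundary_seq _ _ _ _ _ _ _ [:: f0])// ?big_seq1; last first.
    by move=> h _; rewrite /phi inE; case: (h =P f0) => // _ /eqP.
  by rewrite /phi eqxx mulrA /tinc asboolT// incidence_sqr// mul1r.
have [Phi [Phi0 PhiE]] := pyr_primitive ce rb dpsi.
pose P := fset_set [set f | proper_face T e f].
pose phi (g : set V) := if (insub g : option P) is Some g' then - Phi (Some g') else 0.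
have phip f : phi f != 0 -> [/\ cell f, f `<=` e & dim f = p].
  rewrite /phi; case: insubP => [g gP gf|]; rewrite ?eqxx// oppr_eq0 => /Phi0[h /psip[_ dh]].
  have pg := properP ce g; have [cg ge _] := pg.
  rewrite /= (pyramid_dim ce rb pg) dh -gf => -[<-]; by split.
exists phi; split=> // f cf fe.
have [->|/eqP fE] := eqVneq f e.
  by rewrite zero// ?psi0//; exact/eqP.
have pf : proper_face T e f by split.
have fP : f \in P by rewrite in_proper//; apply/asboolP.
rewrite (coboundary_proper o ce); last by left.
rewrite -[f in RHS]/(val [` fP]%fset) PhiE /= -sumrN.
have -> : (if dim f == 0%N then Phi None else 0) = 0.
  case: eqP => // df; apply/eqP/negPn/negP => /Phi0[h /psip[_ dh]].
  by rewrite /= dim_point dh.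
rewrite subr0; apply: eq_bigr => g _.
by rewrite /phi valK mulrN.
Qed.

Lemma faces_const psi : (forall f, psi f != 0 -> cell f /\ dim f = 0%N) ->
  (forall g, cell g -> g `<=` e -> coboundary o psi g = 0) ->
  exists a, forall f, cell f -> f `<=` e -> dim f = 0%N -> psi f = a.
Proof.
move=> psip dpsi; have [b rb] := polytope_relint (cells_polytope ce).
have [n0|n0] := posnP (dim e).
  by exists (psi e) => f cf fe df; rewrite (face_eq cf ce fe)// n0.
have [Phi [Phi0 PhiE]] := pyr_primitive ce rb dpsi.
exists (- Phi None) => f cf fe df.
have pf : proper_face T e f by split=> // fE; move: n0; rewrite -fE df.
have fP : f \in fset_set [set f | proper_face T e f] by rewrite in_proper//; apply/asboolP.
rewrite -[f]/(val [` fP]%fset) PhiE /= df eqxx big1 ?oppr0 ?add0r// => g _.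
rewrite /tinc asboolF ?mul0r// => -[_ _ _]; by rewrite df.
Qed.

(** This is [boundary_sigma] at the apex of the edge: the pyramids on its vertices are the two
    halves of the edge. *)
Lemma edge_vertices : dim e = 1%N ->
  coboundary o (fun v => if `[< cell v /\ dim v = 0%N >] then 1 else 0) e = 0.
Proof.
move=> e1; have [b rb] := polytope_relint (cells_polytope ce).
have LC := pyr_complex o ce rb.
have := boundary_sigma LC None; rewrite sum_option mulr0 add0r => h.
rewrite (coboundary_proper o ce); last by right.
apply/eqP; rewrite -oppr_eq0 -sumrN -[X in _ == X]h; apply/eqP/eq_bigr => f _.
rewrite (pyr_sigma o ce rb) /=; have pf := properP ce f; have [cf _ _] := pf.
have f0 : dim (val f) = 0%N by have := proper_dim pf; rewrite e1 ltnS leqn0 => /eqP.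
by rewrite f0 eqxx asboolT// mulrN.
Qed.

End Faces.

(** * Pattern-equivariant duality *)

Section SubquotientIso.
Variables (M1 M2 : zmodType) (Z1 B1 : zmodClosed M1) (Z2 B2 : zmodClosed M2).
Variable rel : M1 -> M2 -> Prop.
Hypothesis rel_total : forall x, x \in Z1 -> exists2 y, y \in Z2 & rel x y.
Hypothesis rel_onto : forall y, y \in Z2 -> exists2 x, x \in Z1 & rel x y.
Hypothesis rel_sub : forall x y x' y', rel x y -> rel x' y' -> rel (x - x') (y - y').
Hypothesis rel_bound : forall x y, x \in Z1 -> y \in Z2 -> rel x y -> (x \in B1) = (y \in B2).

(** A relation suffices because representatives are chosen arbitrarily. [rel_bound], applied to
    differences, gives both well-definedness and injectivity. *)
Lemma subquotient_iso : exists phi : {additive subquotient Z1 B1 -> subquotient Z2 B2},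
  bijective phi.
Proof.
have /choice[f fP] : forall x : restricted Z1, exists y : restricted Z2, rel (val x) (val y).
  by move=> x; have [y yZ xy] := rel_total (rvalP x); exists (Restricted yZ).
pose phi0 (u : subquotient Z1 B1) : subquotient Z2 B2 := \pi_(subquotient Z2 B2)%qT (f (repr u)).
have B1E (x y : restricted Z1) : (x - y \in restriction B1) = (val x - val y \in B1).
  by rewrite -[LHS]/(val (x - y) \in B1) raddfB.
have B2E (x y : restricted Z2) : (x - y \in restriction B2) = (val x - val y \in B2).
  by rewrite -[LHS]/(val (x - y) \in B2) raddfB.
have eq1 (x y : restricted Z1) :
    (\pi_(subquotient Z1 B1)%qT x = \pi_(subquotient Z1 B1)%qT y) <-> (val x - val y \in B1).
  by rewrite -B1E Quotient.idealrBE; split=> /eqP.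
have eq2 (x y : restricted Z2) :
    (\pi_(subquotient Z2 B2)%qT x = \pi_(subquotient Z2 B2)%qT y) <-> (val x - val y \in B2).
  by rewrite -B2E Quotient.idealrBE; split=> /eqP.
have phiE (x : restricted Z1) (y : restricted Z2) : rel (val x) (val y) ->
    phi0 (\pi x)%qT = (\pi y)%qT.
  move=> xy; apply/eq2; have xZ := rvalP x; have yZ := rvalP y.
  set x' := repr _; have : val x' - val x \in B1 by apply/eq1; rewrite reprK.
  have E : (val x' - val x \in B1) = (val (f x') - val y \in B2) :=
    rel_bound (rpredB (rvalP x') xZ) (rpredB (rvalP (f x')) yZ) (rel_sub (fP x') xy).
  by rewrite E.
have phi_add : {morph phi0 : u v / u - v}.
  move=> u v; rewrite -[u]reprK -[v]reprK -raddfB.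
  rewrite (phiE (repr u - repr v) (f (repr u) - f (repr v))); last first.
    by rewrite !raddfB; exact: rel_sub (fP _) (fP _).
  by rewrite raddfB (phiE _ _ (fP (repr u))) (phiE _ _ (fP (repr v))).
pose phiA := GRing.isZmodMorphism.Build _ _ phi0 phi_add.
pose phi : {additive subquotient Z1 B1 -> subquotient Z2 B2} := HB.pack phi0 phiA.
exists phi; have inj : injective phi.
  move=> u v; rewrite -[u]reprK -[v]reprK => /eqP.
  rewrite -subr_eq0 -raddfB -raddfB /= => /eqP.
  set x := repr u - repr v; rewrite (phiE x (f x) (fP x)) => h.
  have hx : val (f x) - 0 \in B2 by apply: (eq2 (f x) 0).1; rewrite h raddf0.
  have E : (val x \in B1) = (val (f x) \in B2) := rel_bound (rvalP x) (rvalP (f x)) (fP x).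
  rewrite subr0 -E in hx.
  by apply/eq1; rewrite -raddfB.
have surj w : exists u, phi u = w.
  have [x xZ xy] := rel_onto (rvalP (repr w)).
  by exists (\pi_(subquotient Z1 B1)%qT (Restricted xZ)); rewrite /= (phiE _ (repr w))// reprK.
have /choice[g gP] := surj; exists g => [u|w]; last exact: gP.
by apply: inj; rewrite gP.
Qed.

End SubquotientIso.

(** * Local translations and equivariant choices *)

Section Translation.
Context {R : realType} {d : nat} {L : Type} (T : polytopal_tiling R d L) (o : orientation T).
Local Notation V := 'rV[R]_d.
Implicit Types (c e f g t : set V) (v : V) (i j : nat).
Local Notation cell := (cells T).

(** In contrast to [identical_coronas] the vector is kept, so that the same translation can be
    applied to incident cells. *)
Definition locally_translates i v c :=
  [/\ cell c, cell (shift v c) & translates T v (corona T i c) (corona T i (shift v c))].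
Local Notation Loc := locally_translates.

Lemma shift_shift u v c : shift u (shift v c) = shift (v + u) c.
Proof.
apply/seteqP; split=> [_ [_ [x cx <-] <-]|_ [x cx <-]].
  by exists x; rewrite // addrA.
by exists (x + v); [exists x|rewrite addrA].
Qed.

Lemma Loc_sym i v c : Loc i v c -> Loc i (- v) (shift v c).
Proof. by move=> [cc cv tr]; split; rewrite ?shiftK//; exact: translates_sym. Qed.

Lemma tile_corona_shift i v (Q : set (set V)) t : (forall e, Q e -> cell (shift v e)) ->
  tile T t -> tile_corona T i t `<=` Q -> tile T (shift v t) /\
  forall j e, (j <= i)%N -> tile_corona T j t e -> tile_corona T j (shift v t) (shift v e).
Proof.
move=> Qc tt tQ; have tileQ s : tile T s -> Q s -> tile T (shift v s).
  by move=> [cs ds] /Qc; split=> //; rewrite dim_shift.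
split; first by apply: tileQ => //; apply/tQ/tile_corona_id.
have cQ j e : (j <= i)%N -> tile_corona T j t e -> Q e.
  by move=> ji ej; exact/tQ/(tile_corona_le tt ji).
elim=> [|j IH] e ji ej.
  by split; [exact/Qc/cQ/ej|apply: image_subset; case: ej].
have cev := Qc _ (cQ _ _ ji ej).
case: ej => ce' [s [ts es [x [sx [g gj gx]]]]].
have js : tile_corona T j.+1 t s.
  by split; [case: ts|exists s; split=> //; exists x; split=> //; exists g].
split=> //; exists (shift v s); split.
- exact: tileQ ts (cQ _ _ ji js).
- exact: image_subset.
- exists (x + v); split; first by exists x.
  by exists (shift v g); [apply: IH => //; exact: ltnW|exists x].
Qed.

Lemma Loc_corona_half i v c t c' : Loc i.+2 v c -> tile T t -> c `<=` t -> cell c' -> c' `<=` t ->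
  [/\ cell (shift v c'), tile T (shift v t) & forall s, tile T s -> c' `<=` s ->
    tile T (shift v s) /\ forall e, tile_corona T i s e -> tile_corona T i (shift v s) (shift v e)].
Proof.
move=> [cc cv tr] tt ct cc' c't.
have Qc e : corona T i.+2 c e -> cell (shift v e).
  by move=> ce; have : corona T i.+2 (shift v c) (shift v e); [rewrite tr.1; exists e|case].
have tQ := tile_corona_sub_corona (i := i.+1) cc tt ct.
split.
- by apply/Qc/tQ/(tile_corona_le tt (leq0n _)).
- by have [] := tile_corona_shift Qc tt tQ.
- move=> s ts c's; have [|ts' h] := tile_corona_shift (i := i) Qc ts.
    apply: subset_trans tQ; apply: tile_coronaS => //.
    by have [x cx] := cell_nonempty cc'; exists x; split; [exact: c's|exact: c't].
  by split=> // e; exact: h.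
Qed.

(** Two coronas are lost: the [i]-corona of a tile containing [c'] lies in the next corona of [t],
    and that one in the corona of index [i.+2] of [c]. *)
Lemma Loc_move i v c t c' : Loc i.+2 v c -> tile T t -> c `<=` t -> cell c' -> c' `<=` t ->
  Loc i v c'.
Proof.
move=> lc tt ct cc' c't; have [cv' tv h] := Loc_corona_half lc tt ct cc' c't.
have [||_ _ h'] := Loc_corona_half (Loc_sym lc) tv _ cv'; try exact: image_subset.
have [cc cv tr] := lc.
have Q e : corona T i c' e -> corona T i.+2 c e.
  move=> [ce /(_ t tt c't) ei]; apply: (tile_corona_sub_corona cc tt ct).
  exact: (tile_corona_le tt (leqnSn i)).
have Qc e : corona T i.+2 c e -> cell (shift v e).
  by move=> ce; have : corona T i.+2 (shift v c) (shift v e); [rewrite tr.1; exists e|case].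
split=> //; split; last by move=> e /Q; exact: tr.2.
apply/seteqP; split=> [e [ce ei]|_ [e ei <-]].
  exists (shift (- v) e); last by rewrite shiftNK.
  split.
    have [cc1 cv1 tr1] := Loc_sym lc.
    have : corona T i.+2 (shift v c) e.
      apply: (tile_corona_sub_corona cv tv); first exact: image_subset.
      by apply: (tile_corona_le tv (leqnSn i)); apply: ei => //; exact: image_subset.
    by rewrite tr.1 => -[e' [ce' _] <-]; rewrite shiftK.
  move=> s ts c's; have [tsv _] := h s ts c's.
  have [|_ /(_ e)] := h' _ tsv; first exact: image_subset.
  by rewrite shiftK; apply; apply: ei => //; exact: image_subset.
split; first exact/Qc/Q.
move=> s ts c's; have [tsv hs] := h' s ts c's.
have sub : c' `<=` shift (- v) s.
  by move=> x c'x; exists (x + v); [apply: c's; exists x|rewrite addrK].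
have [_ /(_ e)] := h _ tsv sub; rewrite shiftNK; apply.
exact: ei.2.
Qed.

Lemma Loc_coface i v c e : Loc i.+2 v c -> cell e -> c `<=` e -> Loc i v e.
Proof.
move=> lc ce sce; have [t [tt et]] := cell_tile o ce.
exact: Loc_move lc tt (subset_trans sce et) ce et.
Qed.

Lemma Loc_face i v c e : Loc i.+2 v e -> cell c -> c `<=` e -> Loc i v c.
Proof.
move=> le cc sce; have [ce _ _] := le; have [t [tt et]] := cell_tile o ce.
exact: Loc_move le tt et cc (subset_trans sce et).
Qed.

Lemma Loc_le i j v c : (i <= j)%N -> Loc j v c -> Loc i v c.
Proof.
move=> /subnK <-; elim: (j - i)%N => // n IH [cc cv tr]; apply: IH; split=> //; split; last first.
  by move=> e ei; apply: tr.2; exact: corona_le ei.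
have tr' := translates_sym tr.
apply/seteqP; split=> [e e2|_ [e e1 <-]]; last exact: shift_corona tr e1.
exists (shift (- v) e); last by rewrite shiftNK.
have := @shift_corona _ _ _ T (n + i) (- v) (shift v c) c e cv cc.
by rewrite shiftK; apply.
Qed.

Lemma Loc_identical i c1 c2 : cell c1 -> cell c2 ->
  identical_coronas T i c1 c2 <-> exists2 v, c2 = shift v c1 & Loc i v c1.
Proof.
move=> cc1 cc2; split=> [[v [e tr]]|[v e [_ _ tr]]]; exists v => //.
  by split; rewrite -?e.
by split=> //; rewrite e.
Qed.

Lemma shift_inj v : injective (shift v : set V -> set V).
Proof. by move=> c e /(congr1 (shift (- v))); rewrite !shiftK. Qed.

(** Radius 2 is what [Loc_face] needs to make translation by [v] a bijection between the facets of
    [c] and those of its translate. *)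
Lemma coboundary_Loc v c (psi psi' : set V -> int) : Loc 2 v c ->
  (forall f, facet T f c -> psi' (shift v f) = psi f) ->
  coboundary o psi' (shift v c) = coboundary o psi c.
Proof.
move=> lc h; have [cc cv _] := lc.
pose r : seq (set V) := fset_set [set f | facet T f c].
have rP f : (f \in r) = `[< facet T f c >] by rewrite in_fset_set//; exact: finite_facets.
have shc f : facet T f c -> cell (shift v f).
  by move=> [cf _ fc _]; have [] := Loc_face lc cf fc.
rewrite (@coboundary_seq _ _ _ _ _ _ _ (map (shift v) r)); last first.
- move=> f fcv _; have [cf _ fc _] := fcv; have [_ cfv _] := Loc_face (Loc_sym lc) cf fc.
  rewrite -[f](shiftNK v) map_f// rP; apply/asboolP.
  by have := facet_shift (v := - v) cfv _ fcv; rewrite shiftK; apply.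
- by rewrite map_inj_uniq ?fset_uniq//; exact: shift_inj.
rewrite (@coboundary_seq _ _ _ _ _ _ _ r)//; last first.
- by move=> f fc _; rewrite rP; apply/asboolP.
- exact: fset_uniq.
rewrite big_map big_seq [RHS]big_seq; apply: eq_bigr => f; rewrite rP => /asboolP fc.
rewrite h// /tinc !asboolT ?incidence_shift//; try exact: shc.
by apply: facet_shift => //; exact: shc.
Qed.

Lemma boundary_Loc v c (psi psi' : set V -> int) : Loc 2 v c ->
  (forall e, facet T c e -> psi' (shift v e) = psi e) ->
  boundary o psi' (shift v c) = boundary o psi c.
Proof.
move=> lc h; have [cc cv _] := lc.
pose r : seq (set V) := fset_set [set e | facet T c e].
have rP f : (f \in r) = `[< facet T c f >] by rewrite in_fset_set//; exact: finite_cofacets.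
have shc f : facet T c f -> cell (shift v f).
  by move=> [_ cf fc _]; have [] := Loc_coface lc cf fc.
rewrite (@boundary_seq _ _ _ _ _ _ _ (map (shift v) r)); last first.
- move=> f fcv _; have [_ cf fc _] := fcv; have [_ cfv _] := Loc_coface (Loc_sym lc) cf fc.
  rewrite -[f](shiftNK v) map_f// rP; apply/asboolP.
  by have := @facet_shift _ _ _ T (- v) _ _ _ cfv fcv; rewrite shiftK; apply.
- by rewrite map_inj_uniq ?fset_uniq//; exact: shift_inj.
rewrite (@boundary_seq _ _ _ _ _ _ _ r)//; last first.
- by move=> f fc _; rewrite rP; apply/asboolP.
- exact: fset_uniq.
rewrite big_map big_seq [RHS]big_seq; apply: eq_bigr => f; rewrite rP => /asboolP fc.
rewrite h// /tinc !asboolT ?incidence_shift//; try exact: shc.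
by apply: facet_shift => //; exact: shc.
Qed.

(** A point attached to the cell that moves along with every translation; it need not lie in the
    cell. *)
Definition anchor c : V := \row_i sup [set x 0 i | x in c].

Lemma anchor_shift v c : cell c -> anchor (shift v c) = anchor c + v.
Proof.
move=> cc; apply/rowP => i; rewrite !mxE -[in RHS](sup1 (v 0 i)) -sup_sumE.
- congr (sup _); apply/seteqP; split=> [_ [_ [x cx <-] <-]|_ [_ [x cx <-] [_ -> <-]]].
    by exists (x 0 i); [exists x|exists (v 0 i); rewrite ?mxE].
  by exists (x + v); [exists x|rewrite mxE].
- split; first by have [x cx] := cell_nonempty cc; exists (x 0 i), x.
  have [K cK] := polytope_bounded (cells_polytope cc); exists K => _ [x cx <-].
  apply: le_trans (ler_norm _) _; apply: le_trans (cK x cx).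
  rewrite [X in _ <= X]/Num.norm /= mx_normrE.
  exact: (le_bigmax _ (fun ij => `|x ij.1 ij.2|) (0, i)).
- exact: has_sup1.
Qed.

(* Solutions are chosen relative to the anchor of the cell, hence compatibly
   with all local translations of the tiling. *)
Lemma equivariant_choice i (Sol : set V -> set (set V -> int)) :
  (forall c v, Loc i v c -> forall y, Sol (shift v c) y -> Sol c (fun f => y (shift v f))) ->
  exists Y : set V -> set V -> int,
    (forall c, Sol c !=set0 -> Sol c (Y c)) /\
    forall c v f, Loc i v c -> Y (shift v c) (shift v f) = Y c f.
Proof.
move=> SolT.
pose S c := [set y0 : set V -> int | Sol c (fun f => y0 (shift (- anchor c) f))].
have SE c v : Loc i v c -> S (shift v c) `<=` S c.
  move=> lc y; rewrite /S /= => /(SolT _ _ lc); congr (Sol c _).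
  apply/funext => f; have [cc _ _] := lc.
  by rewrite shift_shift anchor_shift// opprD [- _ - v]addrC addrA subrr add0r.
exists (fun c f => xget (fun=> 0) (S c) (shift (- anchor c) f)); split=> [c [y cy]|c v f lc].
  have Sy : S c (fun f => y (shift (anchor c) f)).
    rewrite /S /= [X in Sol c X](_ : _ = y)//; apply/funext => f.
    by rewrite shiftNK.
  by case: xgetP => [y0 _ //|/(_ _ Sy)].
have [cc cv _] := lc.
have -> : S (shift v c) = S c.
  apply/seteqP; split; first exact: SE.
  by have := SE _ _ (Loc_sym lc); rewrite shiftK.
by rewrite shift_shift anchor_shift// opprD [- _ - v]addrC addrA subrr add0r.
Qed.

End Translation.

(** * The pattern-equivariant double complex *)

Section DoubleComplex.
Context {R : realType} {d : nat} {L : Type} (T : polytopal_tiling R d L) (o : orientation T).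
Local Notation V := 'rV[R]_d.
Implicit Types (c e f g t : set V) (v : V) (i j : nat) (x y z : set V -> set V -> int).
Implicit Types (psi phi chi : set V -> int) (m k : int).
Local Notation cell := (cells T).
Local Notation Loc := (locally_translates T).
Local Notation sigma := (tsigma o).

Definition incident c e := [/\ cell c, cell e & c `<=` e].

(** Only the corona of [c] is constrained; [Loc_coface] supplies that of [e] with two coronas
    less. *)
Definition pe_pairs x := exists i, forall c e v, incident c e -> Loc i v c ->
  x (shift v c) (shift v e) = x c e.

(** Chain degree minus cochain degree, which [total] lowers by one. A cochain of degree [k] sits in
    degree [d - k], a chain of degree [m] in degree [m]. *)
Definition of_degree m x := forall c e, x c e != 0 ->
  incident c e /\ (dim e)%:Z = (dim c)%:Z + m.

(* The differential of the total complex of a double complex: x c e has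
   cochain degree dim c and chain degree dim e. *)
Definition total x c e : int := if `[< incident c e >] then
  coboundary o (fun c' => x c' e) c + (-1) ^+ dim c * boundary o (x c) e else 0.

Definition cochain_pair psi c e : int := if `[< incident c e >] then psi c * sigma e else 0.

Definition chain_pair chi c e : int :=
  if `[< incident c e /\ dim c = 0%N >] then chi e else 0.

Lemma totalE x c e : total x c e = if `[< incident c e >] then
  coboundary o (fun c' => x c' e) c + (-1) ^+ dim c * boundary o (x c) e else 0.
Proof. by []. Qed.

Lemma coboundary_neq0 psi c : coboundary o psi c != 0 -> exists2 f, facet T f c & psi f != 0.
Proof.
move=> h; apply: contrapT => nf; move/negP: h; apply.
rewrite (@coboundary_seq _ _ _ _ _ _ _ [::]) ?big_nil// => f fc pf.
by case: nf; exists f.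
Qed.

Lemma boundary_neq0 psi c : boundary o psi c != 0 -> exists2 f, facet T c f & psi f != 0.
Proof.
move=> h; apply: contrapT => nf; move/negP: h; apply.
rewrite (@boundary_seq _ _ _ _ _ _ _ [::]) ?big_nil// => f fc pf.
by case: nf; exists f.
Qed.

Lemma eq_coboundary psi phi c : (forall f, facet T f c -> psi f = phi f) ->
  coboundary o psi c = coboundary o phi c.
Proof.
move=> h; apply/eqP; rewrite -subr_eq0 -coboundaryB; apply/negPn/negP => /coboundary_neq0[f fc].
by rewrite -[(psi - phi) f]/(psi f - phi f) h// subrr eqxx.
Qed.

Lemma eq_boundary psi phi c : (forall f, facet T c f -> psi f = phi f) ->
  boundary o psi c = boundary o phi c.
Proof.
move=> h; apply/eqP; rewrite -subr_eq0 -boundaryB; apply/negPn/negP => /boundary_neq0[f fc].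
by rewrite -[(psi - phi) f]/(psi f - phi f) h// subrr eqxx.
Qed.

Lemma coboundary_eq0 psi c : (forall f, facet T f c -> psi f = 0) -> coboundary o psi c = 0.
Proof. by move=> h; rewrite -(coboundary0 o c); apply: eq_coboundary. Qed.

Lemma boundary_eq0 psi c : (forall f, facet T c f -> psi f = 0) -> boundary o psi c = 0.
Proof. by move=> h; rewrite -(boundary0 o c); apply: eq_boundary. Qed.

Lemma coboundary_lin (a : int) psi phi c :
  coboundary o (fun f => psi f + a * phi f) c = coboundary o psi c + a * coboundary o phi c.
Proof.
pose r : seq (set V) := fset_set [set f | facet T f c].
have rP h f : facet T f c -> h -> f \in r.
  by move=> fc _; rewrite in_fset_set; [exact/mem_set|exact: finite_facets].
rewrite !(@coboundary_seq _ _ _ _ _ _ _ r) ?fset_uniq//; try by move=> f fc; exact: rP.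
by rewrite mulr_sumr -big_split; apply: eq_bigr => f _; rewrite /=; ring.
Qed.

Lemma boundary_lin (a : int) psi phi c :
  boundary o (fun f => psi f + a * phi f) c = boundary o psi c + a * boundary o phi c.
Proof.
pose r : seq (set V) := fset_set [set f | facet T c f].
have rP h f : facet T c f -> h -> f \in r.
  by move=> fc _; rewrite in_fset_set; [exact/mem_set|exact: finite_cofacets].
rewrite !(@boundary_seq _ _ _ _ _ _ _ r) ?fset_uniq//; try by move=> f fc; exact: rP.
by rewrite mulr_sumr -big_split; apply: eq_bigr => f _; rewrite /=; ring.
Qed.

Lemma coboundaryZ (a : int) phi c : coboundary o (fun f => a * phi f) c = a * coboundary o phi c.
Proof.
by have := coboundary_lin a (fun=> 0) phi c; rewrite [X in _ = X + _]coboundary_eq0// add0r => <-;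
  apply: eq_coboundary => f _; rewrite add0r.
Qed.

Lemma boundaryZ (a : int) phi c : boundary o (fun f => a * phi f) c = a * boundary o phi c.
Proof.
by have := boundary_lin a (fun=> 0) phi c; rewrite [X in _ = X + _]boundary_eq0// add0r => <-;
  apply: eq_boundary => f _; rewrite add0r.
Qed.

Lemma coboundary_coboundary psi c : coboundary o (coboundary o psi) c = 0.
Proof.
have [cc|ncc] := pselect (cell c); last by apply: coboundary_eq0 => f [].
pose r : seq (set V) := fset_set [set f | cell f /\ f `<=` c].
have rP f : (f \in r) = `[< cell f /\ f `<=` c >] by rewrite in_fset_set//; exact: finite_faces.
rewrite (@coboundary_seq _ _ _ _ _ _ _ r) ?fset_uniq//; last first.
  by move=> f [cf _ fc _] _; rewrite rP; apply/asboolP.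
transitivity (\sum_(f <- r) \sum_(h <- r) psi h * (tinc o c f * tinc o f h)).
  apply: eq_bigr => f _; have [->|/tinc_facet[cf _ fc _]] := eqVneq (tinc o c f) 0.
    by rewrite mul0r big1// => h _; rewrite mul0r mulr0.
  rewrite (@coboundary_seq _ _ _ _ _ _ _ r) ?fset_uniq//; last first.
    by move=> h [ch _ hf _] _; rewrite rP; apply/asboolP; split=> //; exact: subset_trans fc.
  by rewrite mulr_sumr; apply: eq_bigr => h _; ring.
rewrite exchange_big big_seq big1// => h; rewrite rP => /asboolP[ch hc].
rewrite -mulr_sumr tinc_tinc ?mulr0 ?fset_uniq// => g [_ cg _ _] [_ _ gc _].
by rewrite rP; apply/asboolP.
Qed.

Lemma boundary_boundary psi c : boundary o (boundary o psi) c = 0.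
Proof.
have [cc|ncc] := pselect (cell c); last by apply: boundary_eq0 => f [].
pose r : seq (set V) := fset_set [set f | cell f /\ c `<=` f].
have rP f : (f \in r) = `[< cell f /\ c `<=` f >] by rewrite in_fset_set//; exact: finite_cofaces.
rewrite (@boundary_seq _ _ _ _ _ _ _ r) ?fset_uniq//; last first.
  by move=> f [_ cf fc _] _; rewrite rP; apply/asboolP.
transitivity (\sum_(f <- r) \sum_(h <- r) psi h * (tinc o h f * tinc o f c)).
  apply: eq_bigr => f _; have [->|/tinc_facet[_ cf fc _]] := eqVneq (tinc o f c) 0.
    by rewrite mul0r big1// => h _; rewrite !mulr0.
  rewrite (@boundary_seq _ _ _ _ _ _ _ r) ?fset_uniq//; last first.
    by move=> h [_ ch hf _] _; rewrite rP; apply/asboolP; split=> //; exact: subset_trans hf.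
  by rewrite mulr_sumr; apply: eq_bigr => h _; ring.
rewrite exchange_big big1// => h _.
rewrite -mulr_sumr tinc_tinc ?mulr0 ?fset_uniq// => g [_ cg cg' _] _.
by rewrite rP; apply/asboolP.
Qed.

Lemma coboundary_boundary x c e : cell c -> cell e ->
  coboundary o (fun f => boundary o (x f) e) c = boundary o (fun g => coboundary o (x^~ g) c) e.
Proof.
move=> cc ce; pose r : seq (set V) := fset_set [set f | facet T f c].
have rP h f : facet T f c -> h -> f \in r.
  by move=> fc _; rewrite in_fset_set; [exact/mem_set|exact: finite_facets].
pose s : seq (set V) := fset_set [set f | facet T e f].
have sP h f : facet T e f -> h -> f \in s.
  by move=> fc _; rewrite in_fset_set; [exact/mem_set|exact: finite_cofacets].
rewrite (@coboundary_seq _ _ _ _ _ _ _ r) ?fset_uniq//; last by move=> f fc; exact: rP.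
rewrite (@boundary_seq _ _ _ _ _ _ _ s) ?fset_uniq//; last by move=> f fc; exact: sP.
transitivity (\sum_(f <- r) \sum_(g <- s) tinc o c f * tinc o g e * x f g).
  apply: eq_bigr => f _; rewrite (@boundary_seq _ _ _ _ _ _ _ s) ?fset_uniq//; last by move=> g gc; exact: sP.
  by rewrite mulr_sumr; apply: eq_bigr => g _; ring.
rewrite exchange_big; apply: eq_bigr => g _.
rewrite (@coboundary_seq _ _ _ _ _ _ _ r) ?fset_uniq//; last by move=> f fc; exact: rP.
by rewrite mulr_sumr; apply: eq_bigr => f _ /=; ring.
Qed.

Lemma incident_facetl c e f : incident c e -> facet T f c -> incident f e.
Proof. by move=> [cc ce h] [cf _ fc _]; split=> //; exact: subset_trans h. Qed.

Lemma incident_facetr c e g : incident c e -> facet T e g -> incident c g.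
Proof. by move=> [cc ce h] [_ cg eg _]; split=> //; exact: subset_trans eg. Qed.

Lemma signr_sqr (k : nat) : (-1 : int) ^+ k * (-1) ^+ k = 1.
Proof. by rewrite -exprD addnn -mul2n exprM sqrrN !expr1n. Qed.

Lemma total_total x c e : total (total x) c e = 0.
Proof.
rewrite {1}/total; case: asboolP => // ice; have [cc ce sce] := ice.
rewrite (@eq_coboundary _ (fun f => coboundary o (x^~ e) f + (- (-1) ^+ dim c) * boundary o (x f) e)); last first.
  move=> f fc; rewrite /total asboolT; last exact: incident_facetl fc.
  by have [_ _ _ ->] := fc; rewrite exprS mulN1r opprK.
rewrite (@eq_boundary _ (fun g => coboundary o (x^~ g) c + (-1) ^+ dim c * boundary o (x c) g)); last first.
  by move=> g eg; rewrite /total asboolT//; exact: incident_facetr eg.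
rewrite coboundary_lin boundary_lin coboundary_coboundary boundary_boundary mulr0 addr0 add0r.
by rewrite coboundary_boundary// mulNr addNr.
Qed.

Lemma total_lin (a : int) x y c e :
  total (fun c e => x c e + a * y c e) c e = total x c e + a * total y c e.
Proof.
rewrite /total; case: asboolP => _; last by rewrite mulr0 addr0.
have E (s A B A' B' : int) : A + a * A' + s * (B + a * B') = A + s * B + a * (A' + s * B') by ring.
by rewrite coboundary_lin boundary_lin E.
Qed.

Lemma eq_total x y c e : (forall c e, x c e = y c e) -> total x c e = total y c e.
Proof. by move=> h; congr (total _ _ _); apply/funext => ?; apply/funext => ?. Qed.

Lemma of_degree_total m x : of_degree (m + 1) x -> of_degree m (total x).
Proof.
move=> xm c e; rewrite /total; case: asboolP => [ice h|_]; last by rewrite eqxx.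
split=> //; have [h1|h1] := eqVneq (coboundary o (x^~ e) c) 0.
  have : boundary o (x c) e != 0.
    by apply: contraNneq h => h2; rewrite h1 h2 mulr0 addr0.
  move=> /boundary_neq0[g [_ _ _ dg] /xm[_]]; rewrite dg; lia.
have [f [_ _ _ df] /xm[_]] := coboundary_neq0 h1; rewrite df; lia.
Qed.

Lemma of_degree_lin (a : int) m x y : of_degree m x -> of_degree m y ->
  of_degree m (fun c e => x c e + a * y c e).
Proof.
move=> xm ym c e h; have [x0|/xm//] := eqVneq (x c e) 0.
have [y0|/ym//] := eqVneq (y c e) 0.
by rewrite x0 y0 mulr0 addr0 eqxx in h.
Qed.

Lemma pe_pairs_lin (a : int) x y : pe_pairs x -> pe_pairs y ->
  pe_pairs (fun c e => x c e + a * y c e).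
Proof.
move=> [i xi] [j yj]; exists (maxn i j) => c e v ice lc.
rewrite xi//; last by apply: Loc_le lc; exact: leq_maxl.
by rewrite yj//; apply: Loc_le lc; exact: leq_maxr.
Qed.

Lemma incident_shift i v c e : incident c e -> Loc i.+2 v c -> incident (shift v c) (shift v e).
Proof.
move=> [cc ce h] lc; have [_ cv _] := lc; have [_ ev _] := Loc_coface o lc ce h.
by split=> //; exact: image_subset.
Qed.

Lemma pe_pairs_total x : pe_pairs x -> pe_pairs (total x).
Proof.
move=> [i xi]; exists i.+4 => c e v ice lc; have [cc ce sce] := ice.
have l2 : Loc 2 v c by apply: Loc_le lc.
have le2 : Loc 2 v e by apply: Loc_le (Loc_coface o lc ce sce).
rewrite /total !asboolT//; last exact: incident_shift ice l2.
congr (_ + _ * _); last first.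
- apply: boundary_Loc => // g eg; apply: xi; first exact: incident_facetr eg.
  by apply: Loc_le lc; rewrite -[i.+4]addn4 leq_addr.
- by rewrite dim_shift.
- apply: coboundary_Loc => // f fc; apply: xi; first exact: incident_facetl fc.
  have [cf _ fc' _] := fc; apply: Loc_le (Loc_face o lc cf fc').
  by rewrite -[i.+2]addn2 leq_addr.
Qed.

Lemma total_cochain psi c e :
  total (cochain_pair psi) c e = cochain_pair (coboundary o psi) c e.
Proof.
rewrite /total /cochain_pair; case: asboolP => // ice; have [cc ce sce] := ice.
rewrite (@eq_coboundary _ (fun f => sigma e * psi f)); last first.
  by move=> f fc; rewrite asboolT 1?mulrC//; exact: incident_facetl fc.
rewrite (@eq_boundary _ (fun g => psi c * sigma g)); last first.
  by move=> g eg; rewrite asboolT//; exact: incident_facetr eg.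
by rewrite coboundaryZ boundaryZ boundary_tsigma !mulr0 addr0 mulrC.
Qed.

(** Away from vertices only the coboundary on an edge could contribute, applied to a function
    constant on its two vertices; [edge_vertices] makes it vanish. *)
Lemma total_chain chi c e : total (chain_pair chi) c e = chain_pair (boundary o chi) c e.
Proof.
rewrite /total /chain_pair; have [ice|nice] := asboolP (incident c e); last first.
  by rewrite asboolF// => -[].
have [cc ce sce] := ice; have [c0|c0] := eqVneq (dim c) 0%N.
  rewrite coboundary_eq0 => [|f [_ _ _]]; last by rewrite c0.
  have -> : `[< incident c e /\ dim c = 0%N >] = true by apply/asboolP.
  rewrite c0 expr0 mul1r add0r; apply: eq_boundary => g eg.
  by rewrite asboolT//; split=> //; exact: incident_facetr eg.
rewrite asboolF; last by move=> [_ h]; rewrite h in c0.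
rewrite [X in _ + _ * X]boundary_eq0 ?mulr0 ?addr0; last first.
  by move=> g _; rewrite asboolF// => -[_ h]; rewrite h in c0.
rewrite (@eq_coboundary _ (fun f => chi e * (if `[< cell f /\ dim f = 0%N >] then 1 else 0))); last first.
  move=> f fc; have ife := incident_facetl ice fc; have [cf _ _] := ife.
  by case: asboolP => [[_ f0]|nf]; case: asboolP => h; rewrite ?mulr1 ?mulr0//; [case: h|case: nf; case: h].
rewrite coboundaryZ; have [c1|c1] := eqVneq (dim c) 1%N; first by rewrite edge_vertices// mulr0.
rewrite coboundary_eq0 ?mulr0// => f [_ _ _ df]; case: asboolP => // -[_ f0].
by rewrite df f0 in c1.
Qed.

End DoubleComplex.

(** * Equivariant primitives in the double complex *)

Section Cleaning.
Context {R : realType} {d : nat} {L : Type} (T : polytopal_tiling R d L) (o : orientation T).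
Local Notation V := 'rV[R]_d.
Implicit Types (c e f g t : set V) (v : V) (i j : nat) (x y z : set V -> set V -> int).
Implicit Types (psi phi chi : set V -> int) (m k : int).
Local Notation cell := (cells T).
Local Notation Loc := (locally_translates T).
Local Notation sigma := (tsigma o).
Local Notation incident := (incident T).
Local Notation pe_pairs := (pe_pairs T).
Local Notation of_degree := (of_degree T).
Local Notation total := (total o).

Lemma face_shift_cell v c f : Loc 2 v c -> cell (shift v f) ->
  shift v f `<=` shift v c -> cell f.
Proof. by move=> /Loc_sym lc cf fc; have [_] := Loc_face o lc cf fc; rewrite shiftK. Qed.

(** For fixed [e], the part with [dim c = P.+1] is a cocycle on the faces of [e]: one dimension
    higher [x] is zero, so the boundary term of [total x] is absent. [faces_exact] gives primitives,
    and [equivariant_choice] selects them. *)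
Lemma face_primitive x m (P : nat) : pe_pairs x -> of_degree m x ->
  (forall c e, x c e != 0 -> (dim c <= P.+1)%N) ->
  (forall c e, (0 < dim c)%N -> total x c e = 0) ->
  exists z, [/\ pe_pairs z, of_degree (m + 1) z,
    forall c e, z c e != 0 -> dim c = P &
    forall c e, dim c = P.+1 -> total z c e = x c e].
Proof.
move=> [i xi] xm xP dx.
pose chi e f : int := if dim f == P.+1 then x f e else 0.
pose Sol e := [set y : set V -> int |
  (forall f, y f != 0 -> [/\ cell f, f `<=` e & dim f = P]) /\
  forall f, cell f -> f `<=` e -> coboundary o y f = chi e f].
have SolT e v : Loc (i + 4) v e -> forall y : set V -> int, Sol (shift v e) y -> Sol e (fun f => y (shift v f)).
  move=> le y [y1 y2]; have [ce cev _] := le.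
  have le4 : Loc 4 v e by apply: Loc_le le; rewrite leq_addl.
  have le2 : Loc 2 v e by apply: Loc_le le4.
  split=> [f /y1[cf fe df]|f cf fe].
    split; first exact: (face_shift_cell le2 cf fe).
      exact: shift_sub fe.
    by rewrite -df dim_shift.
  have lf4 : Loc (i + 2) v f by apply: (Loc_face o _ cf fe); rewrite -addnS -addnS.
  have lf2 : Loc 2 v f by apply: Loc_le lf4; rewrite leq_addl.
  have [_ cfv _] := lf2.
  rewrite -(coboundary_Loc o (psi' := y) lf2)// y2//; last exact: image_subset.
  rewrite /chi dim_shift; case: eqP => // _; apply: xi => //.
  by apply: Loc_le lf4; rewrite leq_addr.
have [Y [YS YT]] := equivariant_choice SolT.
have SolE e : cell e -> Sol e !=set0.
  move=> ce; have [||y [y1 y2]] := @faces_exact _ _ _ _ o e ce (chi e) P.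
  - move=> f; rewrite /chi; case: (dim f =P P.+1) => [df /xm[[cf _ _] _]|_ /eqP//]; by split.
  - move=> g cg ge; apply: contrapT => /eqP h; have [f [cf _ fg dg]] := coboundary_neq0 h.
    rewrite /chi; case: (dim f =P P.+1) => [df|_ /eqP//] xf; move/eqP: h; apply.
    have := dx g e; rewrite dg => /(_ isT); rewrite totalE asboolT//.
    rewrite [X in _ + _ * X]boundary_eq0 ?mulr0 ?addr0; last first.
      by move=> h _; apply/eqP/negPn/negP => /xP; rewrite dg df ltnn.
    move=> E; rewrite -[RHS]E; apply: eq_coboundary => f' [_ _ _ dh]; rewrite /chi ifT//.
    by rewrite -df -eqSS -dg -dh.
  - by exists y.
pose z c e : int := if `[< incident c e /\ (dim e)%:Z = P.+1%:Z + m >] then Y e c else 0.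
have zP c e : z c e != 0 -> [/\ incident c e, dim c = P & (dim e)%:Z = P.+1%:Z + m].
  rewrite /z; case: asboolP => [[ice de] h|_ /eqP//]; have [_ ce _] := ice.
  by have [h1 _] := YS e (SolE e ce); have [] := h1 c h.
have zm : of_degree (m + 1) z by move=> c e /zP[ice dc de]; split=> //; rewrite dc de; lia.
exists z; split=> //.
(* The chosen primitive at [e] respects local translations of radius [i + 4], and passing from [c]
   to [e] costs two more. *)
- exists (i + 6)%N => c e v ice lc; have [cc ce sce] := ice.
  have l2 : Loc 2 v c by apply: Loc_le lc; rewrite addnC.
  rewrite /z dim_shift; case: asboolP => [[_ de]|nde]; case: asboolP => [[ice' de']|nde'] //.
  + by apply: YT; apply: (Loc_coface o _ ce sce); rewrite -addnS -addnS.
  + by case: nde'.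
  + by case: nde; split=> //; exact: (incident_shift o ice l2).
- by move=> c e /zP[].
- move=> c e dc; have [[ice de]|nde] := pselect (incident c e /\ (dim e)%:Z = P.+1%:Z + m); last first.
    have -> : x c e = 0.
      by apply/eqP/negPn/negP => /xm[ice de]; apply: nde; rewrite -dc.
    by apply/eqP/negPn/negP => h; apply: nde; have [ice de] := of_degree_total zm h; rewrite -dc.
  have [cc ce sce] := ice; rewrite totalE asboolT//.
  rewrite [X in _ + _ * X]boundary_eq0 ?mulr0 ?addr0; last first.
    by move=> h _; apply/eqP/negPn/negP => /zP[_]; rewrite dc => /eqP; rewrite eqn_leq ltnn.
  have [_ h2] := YS e (SolE e ce).
  transitivity (chi e c); last by rewrite /chi dc eqxx.
  rewrite -h2//; apply: eq_coboundary => f fc.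
  by rewrite /z asboolT//; split=> //; exact: incident_facetl fc.
Qed.

Lemma coface_primitive x m (P q : nat) : pe_pairs x -> of_degree m x ->
  q%:Z = P%:Z + m -> (q < d)%N ->
  (forall c e, x c e != 0 -> (P <= dim c)%N) ->
  (forall c e, (dim e < d)%N -> total x c e = 0) ->
  exists z, [/\ pe_pairs z, of_degree (m + 1) z,
    forall c e, z c e != 0 -> dim c = P &
    forall c e, dim c = P -> total z c e = x c e].
Proof.
move=> [i xi] xm qm qd xP dx.
have xq c e : dim c = P -> x c e != 0 -> dim e = q by move=> dc /xm[_]; rewrite dc -qm => -[].
(* The factor compensates the sign of the boundary in [total]. *)
pose chi c e : int := if dim c == P then (-1) ^+ P * x c e else 0.
pose Sol c := [set y : set V -> int |
  (forall f, y f != 0 -> [/\ cell f, c `<=` f & dim f = q.+1]) /\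
  forall f, cell f -> c `<=` f -> boundary o y f = chi c f].
have SolT c v : Loc (i + 4) v c -> forall y : set V -> int, Sol (shift v c) y -> Sol c (fun f => y (shift v f)).
  move=> le y [y1 y2]; have [ce cev _] := le.
  have le2 : Loc 2 v c by apply: Loc_le le; rewrite addnC.
  split=> [f /y1[cf fe df]|f cf fe].
    split; last by rewrite -df dim_shift.
      by have [_] := Loc_coface o (Loc_sym le2) cf fe; rewrite shiftK.
    exact: shift_sub fe.
  have lf4 : Loc (i + 2) v f by apply: (Loc_coface o _ cf fe); rewrite -addnS -addnS.
  have lf2 : Loc 2 v f by apply: Loc_le lf4; rewrite leq_addl.
  have [_ cfv _] := lf2.
  rewrite -(boundary_Loc o (psi' := y) lf2)// y2//; last exact: image_subset.
  rewrite /chi dim_shift; case: eqP => // _; congr (_ * _); apply: xi => //.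
  by apply: Loc_le le; rewrite leq_addr.
have [Y [YS YT]] := equivariant_choice SolT.
have SolE c : cell c -> Sol c !=set0.
  move=> cc; have [|//||y [y1 y2]] := @star_exact _ _ _ _ o c cc (chi c) q.
  - move=> f; rewrite /chi; case: (dim c =P P) => [dc|_ /eqP//] h.
    have xf : x c f != 0 by apply: contraNneq h => ->; rewrite mulr0.
    by have [[_ cf _] _] := xm _ _ xf; split=> //; exact: xq xf.
  - move=> f cf sf; rewrite /chi; case: (dim c =P P) => [dc|_]; last exact: boundary_eq0.
    rewrite boundaryZ; apply: contrapT => /eqP h.
    have bx : boundary o (x c) f != 0 by apply: contraNneq h => ->; rewrite mulr0.
    have [g [_ cg fg dg] xg] := boundary_neq0 bx.
    have df : (dim f < d)%N by apply: leq_trans (dim_max g); rewrite dg.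
    have := dx c f df; rewrite totalE asboolT// coboundary_eq0 ?add0r; last first.
      move=> h' [_ _ _ dh]; apply/eqP/negPn/negP => /xP.
      by rewrite -dc dh ltnn.
    by move/eqP; rewrite dc; exact/negP.
  - by exists y.
pose z c e : int := if `[< incident c e /\ dim c = P >] then Y c e else 0.
have zP c e : z c e != 0 -> [/\ incident c e, dim c = P & dim e = q.+1].
  rewrite /z; case: asboolP => [[ice dc] h|_ /eqP//]; have [cc _ _] := ice.
  by have [h1 _] := YS c (SolE c cc); have [] := h1 e h.
have zm : of_degree (m + 1) z.
  by move=> c e /zP[ice dc de]; split=> //; rewrite dc de -addn1 PoszD qm; lia.
exists z; split=> //.
- exists (i + 4)%N => c e v ice lc; have [cc ce sce] := ice.
  have l2 : Loc 2 v c by apply: Loc_le lc; rewrite addnC.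
  rewrite /z dim_shift; case: asboolP => [[_ de]|nde]; case: asboolP => [[ice' de']|nde'] //.
  + exact: YT.
  + by case: nde'.
  + by case: nde; split=> //; exact: (incident_shift o ice l2).
- by move=> c e /zP[].
- move=> c e dc; have [ice|nice] := pselect (incident c e); last first.
    rewrite totalE asboolF//; apply/eqP; rewrite eq_sym; apply/negPn/negP.
    by move=> /xm[].
  have [cc ce sce] := ice; rewrite totalE asboolT// coboundary_eq0 ?add0r; last first.
    by move=> f [_ _ _ df]; apply/eqP/negPn/negP => /zP[_]; rewrite -dc df => /eqP; rewrite eqn_leq ltnn andbF.
  have [_ h2] := YS c (SolE c cc).
  rewrite (@eq_boundary _ _ _ _ _ _ (Y c)); last first.
    by move=> g eg; rewrite /z asboolT//; split=> //; exact: incident_facetr eg.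
  by rewrite h2// /chi dc eqxx mulrA signr_sqr mul1r.
Qed.

(** The coefficient of a cell is read off at one of its vertices, whose local translations are
    controlled by those of the cell. *)
Lemma chain_pair_pe m chi : (forall e, chi e != 0 -> cell e /\ (dim e)%:Z = m) ->
  pe_pairs (chain_pair T chi) -> chi \in pe_chains T m.
Proof.
move=> chim [i chii]; apply/asboolP; split.
  by move=> c nc; apply/eqP/negPn/negP => /chim.
exists i.+2 => c1 c2 [cc1 _] [cc2 _] /(Loc_identical _ cc1 cc2)[v -> lc].
have [w [cw wc w0]] := cell_vertex cc1; have lw := Loc_face o lc cw wc.
have [_ cwv _] := lw; have [_ cv _] := lc.
have := chii w c1 v (And3 cw cc1 wc) lw; rewrite /chain_pair !asboolT// dim_shift w0; split=> //.
by split=> //; exact: image_subset.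
Qed.

Lemma pe_chain_pair m chi : chi \in pe_chains T m ->
  pe_pairs (chain_pair T chi) /\ of_degree m (chain_pair T chi).
Proof.
move=> /asboolP[chi0 [i chii]]; split.
  exists i.+2 => c e v ice lc; have [cc ce sce] := ice.
  have l2 : Loc 2 v c by apply: Loc_le lc.
  have iv := incident_shift o ice l2.
  have le := Loc_coface o lc ce sce; have [_ cev _] := le.
  rewrite /chain_pair dim_shift; case: asboolP => [[_ c0]|n1]; case: asboolP => [[_ c0']|n2] //.
  - have [de|de] := eqVneq ((dim e)%:Z) m.
      apply/esym/chii => //; first by split=> //; rewrite dim_shift.
      by apply/(Loc_identical _ ce cev); exists v.
    rewrite !chi0// => -[_] => [|de']; first exact/eqP.
    by move/eqP: de; rewrite -de' dim_shift.
  - by case: n2.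
  - by case: n1.
move=> c e; rewrite /chain_pair; case: asboolP => [[ice c0] h|_ /eqP//].
split=> //; rewrite c0 add0r; apply: contrapT => de.
by rewrite chi0 ?eqxx in h => // -[].
Qed.

(** The coefficient is recovered from a tile containing the cell, where [sigma] is invertible and
    invariant under translation. *)
Lemma cochain_pair_pe m psi : (forall c, psi c != 0 -> cell c /\ (dim c)%:Z = m) ->
  pe_pairs (cochain_pair o psi) -> psi \in pe_chains T m.
Proof.
move=> psim [i psii]; apply/asboolP; split.
  by move=> c nc; apply/eqP/negPn/negP => /psim.
exists (maxn 2 i) => c1 c2 [cc1 _] [cc2 _] /(Loc_identical _ cc1 cc2)[v -> lc].
have [t [[ct dt] ct']] := cell_tile o cc1.
have li : Loc i v c1 by apply: Loc_le lc; exact: leq_maxr.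
have l2 : Loc 2 v c1 by apply: Loc_le lc; exact: leq_maxl.
have ict : incident c1 t by [].
have icv := incident_shift o ict l2; have [_ ctv _] := icv.
have := psii c1 t v ict li; rewrite /cochain_pair !asboolT// tsigma_shift//.
move/(congr1 (fun a => a * sigma t)); rewrite -!mulrA tsigma_sqr// !mulr1 => ->//.
Qed.

Lemma pe_cochain_pair m psi : psi \in pe_chains T m ->
  pe_pairs (cochain_pair o psi) /\ of_degree (d%:Z - m) (cochain_pair o psi).
Proof.
move=> /asboolP[psi0 [i psii]]; split.
  exists (maxn 2 i) => c e v ice lc; have [cc ce sce] := ice.
  have li : Loc i v c by apply: Loc_le lc; exact: leq_maxr.
  have l2 : Loc 2 v c by apply: Loc_le lc; exact: leq_maxl.
  have iv := incident_shift o ice l2; have [cv ev _] := iv.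
  rewrite /cochain_pair !asboolT// tsigma_shift//; congr (_ * _).
  have [dc|dc] := eqVneq ((dim c)%:Z) m.
    apply/esym/psii => //; first by split=> //; rewrite dim_shift.
    by apply/(Loc_identical _ cc cv); exists v.
  rewrite !psi0// => -[_] => [|dc']; first exact/eqP.
  by move/eqP: dc; rewrite -dc' dim_shift.
move=> c e; rewrite /cochain_pair; case: asboolP => [ice h|_ /eqP//].
have [pc|pc] := eqVneq (psi c) 0; first by rewrite pc mul0r eqxx in h.
have [se|se] := eqVneq (sigma e) 0; first by rewrite se mulr0 eqxx in h.
have de : dim e = d by move: se; rewrite /tsigma; case: (dim e =P d) => // _ /eqP.
have dc : (dim c)%:Z = m.
  by apply: contrapT => dc; rewrite psi0 ?eqxx in pc => // -[].
by split=> //; rewrite de dc; lia.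
Qed.

End Cleaning.

(** * Comparison of cohomology and homology *)

Section Duality.
Context {R : realType} {d : nat} {L : Type} (T : polytopal_tiling R d L) (o : orientation T).
Local Notation V := 'rV[R]_d.
Implicit Types (c e f g t : set V) (v : V) (i j : nat) (x y z : set V -> set V -> int).
Implicit Types (psi phi chi : set V -> int) (m k : int).
Local Notation cell := (cells T).
Local Notation Loc := (locally_translates T).
Local Notation sigma := (tsigma o).
Local Notation incident := (incident T).
Local Notation pe_pairs := (pe_pairs T).
Local Notation of_degree := (of_degree T).
Local Notation total := (total o).

Lemma total0 c e : total (fun _ _ => 0) c e = 0.
Proof.
by rewrite totalE; case: ifP => _ //; rewrite coboundary_eq0// boundary_eq0// mulr0 addr0.
Qed.

Lemma total_sub_total x z c e :
  total (fun c e => x c e - total z c e) c e = total x c e.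
Proof.
rewrite (@eq_total _ _ _ _ _ _ (fun c e => x c e + (-1) * total z c e)).
  by rewrite total_lin total_total mulr0 addr0.
by move=> c' e'; rewrite mulN1r.
Qed.

Lemma pe_pairs_sub x z : pe_pairs x -> pe_pairs z -> pe_pairs (fun c e => x c e - z c e).
Proof.
move=> px pz; have [i h] := pe_pairs_lin (-1) px pz; exists i => c e v ice lc.
by have := h c e v ice lc; rewrite !mulN1r.
Qed.

Lemma of_degree_sub m x z : of_degree m x -> of_degree m z ->
  of_degree m (fun c e => x c e - z c e).
Proof.
move=> xm zm c e h; apply: (of_degree_lin (a := -1) xm zm).
by rewrite mulN1r.
Qed.

Lemma total_add x z c e : total (fun c e => x c e + z c e) c e = total x c e + total z c e.
Proof.
rewrite -[total z c e]mul1r -total_lin; apply: eq_total => c' e'.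
by rewrite mul1r.
Qed.

Lemma total_sub x z c e : total (fun c e => x c e - z c e) c e = total x c e - total z c e.
Proof.
rewrite -[total z c e]mul1r -mulNr -total_lin; apply: eq_total => c' e'.
by rewrite mulN1r.
Qed.

Lemma pe_pairs_add x z : pe_pairs x -> pe_pairs z -> pe_pairs (fun c e => x c e + z c e).
Proof.
move=> px pz; have [i h] := pe_pairs_lin 1 px pz; exists i => c e v ice lc.
by have := h c e v ice lc; rewrite !mul1r.
Qed.

Lemma of_degree_add m x z : of_degree m x -> of_degree m z ->
  of_degree m (fun c e => x c e + z c e).
Proof.
move=> xm zm c e h; apply: (of_degree_lin (a := 1) xm zm).
by rewrite mul1r.
Qed.

(** [face_primitive] clears the highest dimension of [c] until only vertices remain. The total is
    required to vanish only where [dim c] is positive, so the lemma applies both to cocycles and to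
    elements whose total is a [chain_pair]. *)
Lemma face_reduction m (P : nat) x : pe_pairs x -> of_degree m x ->
  (forall c e, x c e != 0 -> (dim c <= P)%N) ->
  (forall c e, (0 < dim c)%N -> total x c e = 0) ->
  exists z chi, [/\ pe_pairs z, of_degree (m + 1) z, chi \in pe_chains T m &
    forall c e, x c e - total z c e = chain_pair T chi c e].
Proof.
elim: P x => [|P IH] x px xm xP dx; last first.
  have [z [pz zm zP dz]] := face_primitive px xm xP dx.
  have [||||z' [chi [pz' z'm chiP E]]] := IH (fun c e => x c e - total z c e).
  - by apply: pe_pairs_sub => //; exact: pe_pairs_total.
  - by apply: of_degree_sub => //; exact: of_degree_total.
  - move=> c e; have [dc|dc] := eqVneq (dim c) P.+1; first by rewrite dz// subrr eqxx.
    move=> h; rewrite -ltnS ltn_neqAle dc /=.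
    have [x0|/xP//] := eqVneq (x c e) 0.
    have : total z c e != 0 by apply: contraNneq h => ->; rewrite x0 subr0.
    rewrite totalE; case: asboolP => [ice|_ /eqP//] h'.
    have [h1|/coboundary_neq0[f [_ _ _ df] /zP fP]] := eqVneq (coboundary o (z^~ e) c) 0.
      have /boundary_neq0[g _ /zP ->//] : boundary o (z c) e != 0.
      by apply: contraNneq h' => h2; rewrite h1 h2 mulr0 addr0.
    by rewrite df fP.
  - by move=> c e c0; rewrite total_sub_total dx.
  exists (fun c e => z c e + z' c e), chi; split=> //.
  - exact: pe_pairs_add.
  - exact: of_degree_add.
  - by move=> c e; rewrite total_add opprD addrA.
(* Which vertex [xget] returns is irrelevant: by [faces_const], [x] has the same value at all
   vertices of [e]. *)
pose chi e : int := if `[< cell e >] then x (xget set0 [set w | [/\ cell w, w `<=` e & dim w = 0%N]]) e else 0.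
have xE c e : x c e = chain_pair T chi c e.
  rewrite /chain_pair; case: asboolP => [[ice c0]|n]; last first.
    apply/eqP/negPn/negP => h; apply: n; have [ice _] := xm _ _ h.
    by split=> //; apply/eqP; rewrite -leqn0; exact: xP h.
  have [cc ce sce] := ice; rewrite /chi asboolT//.
  have [||a ha] := @faces_const _ _ _ _ o e ce (x^~ e).
  - by move=> f h; have [[cf _ _] _] := xm _ _ h; split=> //; apply/eqP; rewrite -leqn0; exact: xP h.
  - move=> g cg ge; have [g0|g0] := posnP (dim g).
      by apply: coboundary_eq0 => f [_ _ _]; rewrite g0.
    have := dx g e g0; rewrite totalE asboolT// [X in _ + _ * X]boundary_eq0 ?mulr0 ?addr0// => h _.
    by apply/eqP/negPn/negP => /xP; rewrite leqNgt g0.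
  rewrite ha//; case: xgetP => [w _ [cw we w0]|/(_ c)]; first by rewrite ha.
  by case.
exists (fun _ _ => 0), chi; split=> //.
- by exists 0%N.
- apply: (chain_pair_pe o).
    move=> e; rewrite /chi; case: asboolP => [ce h|_ /eqP//]; split=> //.
    have [[cw _ _] de] := xm _ _ h; rewrite de.
    by have := xP _ _ h; rewrite leqn0 => /eqP ->; rewrite add0r.
  have -> : chain_pair T chi = x by apply/funext => c; apply/funext => e; rewrite xE.
  by [].
- by move=> c e; rewrite -xE total0 subr0.
Qed.

(** [coface_primitive] clears the lowest dimension [P] of [c] as long as the matching dimension of
    [e] is below [d]; [n] bounds the remaining rounds. The total may be nonzero at tiles [e], so
    elements whose total is a [cochain_pair] are covered too. *)
Lemma coface_reduction m (n P : nat) x : (d < P + n)%N -> pe_pairs x -> of_degree m x ->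
  (forall c e, x c e != 0 -> (P <= dim c)%N) ->
  (forall c e, (dim e < d)%N -> total x c e = 0) ->
  exists z phi, [/\ pe_pairs z, of_degree (m + 1) z, phi \in pe_chains T (d%:Z - m) &
    forall c e, x c e - total z c e = cochain_pair o phi c e].
Proof.
elim: n P x => [|n IH] P x Pn px xm xP dx.
  have x0 c e : x c e = 0.
    apply/eqP/negPn/negP => /xP; apply/negP; rewrite -ltnNge.
    by apply: leq_ltn_trans (dim_max c) _; rewrite -[P]addn0.
  exists (fun _ _ => 0), (fun=> 0); split.
  - by exists 0%N.
  - by move=> c e /eqP.
  - exact: rpred0.
  - by move=> c e; rewrite x0 total0 subr0 /cochain_pair mul0r if_same.
have next z : pe_pairs z -> of_degree (m + 1) z -> (forall c e, z c e != 0 -> dim c = P) ->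
    (forall c e, dim c = P -> total z c e = x c e) ->
    exists z phi, [/\ pe_pairs z, of_degree (m + 1) z, phi \in pe_chains T (d%:Z - m) &
    forall c e, x c e - total z c e = cochain_pair o phi c e].
  move=> pz zm zP dz.
  have [|||||z' [phi [pz' z'm phiP E]]] := IH P.+1 (fun c e => x c e - total z c e).
  - by rewrite addSnnS.
  - by apply: pe_pairs_sub => //; exact: pe_pairs_total.
  - by apply: of_degree_sub => //; exact: of_degree_total.
  - move=> c e; have [dc|dc] := eqVneq (dim c) P; first by rewrite dz// subrr eqxx.
    move=> h; rewrite ltn_neqAle eq_sym dc /=.
    have [x0|/xP//] := eqVneq (x c e) 0.
    have : total z c e != 0 by apply: contraNneq h => ->; rewrite x0 subr0.
    rewrite totalE; case: asboolP => [ice|_ /eqP//] h'.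
    have [h1|/coboundary_neq0[f [_ _ _ df] /zP fP]] := eqVneq (coboundary o (z^~ e) c) 0.
      have /boundary_neq0[g _ /zP ->//] : boundary o (z c) e != 0.
      by apply: contraNneq h' => h2; rewrite h1 h2 mulr0 addr0.
    by rewrite df fP leqnSn.
  - by move=> c e c0; rewrite total_sub_total dx.
  exists (fun c e => z c e + z' c e), phi; split=> //.
  - exact: pe_pairs_add.
  - exact: of_degree_add.
  - by move=> c e; rewrite total_add opprD addrA.
have zero : (forall c e, dim c = P -> x c e = 0) ->
    exists z phi, [/\ pe_pairs z, of_degree (m + 1) z, phi \in pe_chains T (d%:Z - m) &
    forall c e, x c e - total z c e = cochain_pair o phi c e].
  move=> x0; apply: (next (fun _ _ => 0)).
  - by exists 0%N.
  - by move=> c e /eqP.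
  - by move=> c e /eqP.
  - by move=> c e dc; rewrite x0// total0.
(* The cells [e] paired with [c] of dimension [P] have dimension [P + m]. Outside the range from 0
   to [d] there is nothing to clear, and at [d] the reduction stops. *)
have [Pm|Pm] := ltP (P%:Z + m) 0.
  apply: zero => c e dc; apply/eqP/negPn/negP => /xm[_]; rewrite dc => h.
  by rewrite -h in Pm.
have /eqP qm := gez0_abs Pm; move: qm; set q := `|_|%N => /eqP qm.
have [qd|dq] := ltnP q d.
  by have [z [pz zm zP dz]] := coface_primitive px xm qm qd xP dx; exact: next zP dz.
have [qd|qd] := eqVneq q d; last first.
  apply: zero => c e dc; apply/eqP/negPn/negP => /xm[_]; rewrite dc -qm => -[de].
  by have := dim_max e; rewrite de leqNgt ltn_neqAle eq_sym qd dq.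
(* A larger [dim c] would need a cell [e] of dimension above [d], so this part is all of [x], and
   [star_top] makes it a multiple of [sigma] for each [c]. *)
have xtop c e : x c e != 0 -> dim c = P /\ dim e = d.
  move=> h; have Pc := xP _ _ h; have [_ de] := xm _ _ h; have := dim_max e.
  by move: qm de; rewrite qd; lia.
have a c : exists a : int, cell c -> forall f, cell f -> c `<=` f -> x c f = a * sigma f.
  have [cc|ncc] := pselect (cell c); last by exists 0.
  have [||a ha] := @star_top _ _ _ _ o c cc (x c).
  - by move=> f h; have [_ df] := xtop _ _ h; have [[_ cf _] _] := xm _ _ h.
  - move=> f cf sf; have [df|df] := eqVneq (dim f) d.
      by apply: boundary_eq0 => g [_ _ _ dg]; have := dim_max g; rewrite dg df ltnn.
    have {}df : (dim f < d)%N by rewrite ltn_neqAle df dim_max.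
    have := dx c f df; rewrite totalE asboolT// coboundary_eq0 ?add0r; last first.
      by move=> h _; apply/eqP/negPn/negP => /xtop[_]; move: df => /[swap] ->; rewrite ltnn.
    move/(congr1 (fun b => (-1) ^+ dim c * b)).
    by rewrite mulr0 mulrA signr_sqr mul1r.
  by exists a.
have [A AP] := choice a.
pose phi c : int := if `[< cell c /\ dim c = P >] then A c else 0.
have xE c e : x c e = cochain_pair o phi c e.
  rewrite /cochain_pair /phi; case: asboolP => [[cc ce sce]|nce]; last first.
    by apply/eqP/negPn/negP => /xm[].
  case: asboolP => [[_ dc]|ncd]; first exact: AP.
  by rewrite mul0r; apply/eqP/negPn/negP => /xtop[dc _]; apply: ncd.
exists (fun _ _ => 0), phi; split=> //.
- by exists 0%N.
- apply: (cochain_pair_pe (o := o)).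
    move=> c; rewrite /phi; case: asboolP => [[cc dc] _|_ /eqP//]; split=> //.
    by move: qm; rewrite qd dc; lia.
  have -> : cochain_pair o phi = x by apply/funext => c; apply/funext => e; rewrite xE.
  by [].
- by move=> c e; rewrite total0 subr0.
Qed.

Lemma chain_pair_inj chi chi' : (forall c, ~ cell c -> chi c = chi' c) ->
  (forall c e, chain_pair T chi c e = chain_pair T chi' c e) -> chi = chi'.
Proof.
move=> h0 h; apply/funext => e; have [ce|nce] := pselect (cell e); last exact: h0.
have [w [cw we w0]] := cell_vertex ce.
by have := h w e; rewrite /chain_pair !asboolT.
Qed.

Lemma cochain_pair_inj psi psi' : (forall c, ~ cell c -> psi c = psi' c) ->
  (forall c e, cochain_pair o psi c e = cochain_pair o psi' c e) -> psi = psi'.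
Proof.
move=> h0 h; apply/funext => c; have [cc|ncc] := pselect (cell c); last exact: h0.
have [t [[ct dt] ct']] := cell_tile o cc.
have := h c t; rewrite /cochain_pair !asboolT// => /(congr1 (fun b => b * sigma t)).
by rewrite -!mulrA tsigma_sqr// !mulr1.
Qed.

Lemma pe_chains_cell m chi c : chi \in pe_chains T m -> ~ cell c -> chi c = 0.
Proof. by move=> /asboolP[h _] ncc; apply: h => -[]. Qed.

Lemma coboundary_cell psi c : ~ cell c -> coboundary o psi c = 0.
Proof. by move=> ncc; apply: coboundary_eq0 => f [_]. Qed.

Lemma boundary_cell psi c : ~ cell c -> boundary o psi c = 0.
Proof. by move=> ncc; apply: boundary_eq0 => f []. Qed.

Variable k : int.
Let m := d%:Z - k.

(** The images of [psi] and [chi] are homologous in the pattern-equivariant total complex. *)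
Definition dual_rel psi chi := exists z, [/\ pe_pairs z, of_degree (m + 1) z &
  forall c e, cochain_pair o psi c e - chain_pair T chi c e = total z c e].

Lemma dual_rel_sub psi chi psi' chi' : dual_rel psi chi -> dual_rel psi' chi' ->
  dual_rel (psi - psi') (chi - chi').
Proof.
move=> [z [pz zm zE]] [z' [pz' zm' zE']]; exists (fun c e => z c e - z' c e); split.
- exact: pe_pairs_sub.
- exact: of_degree_sub.
- move=> c e; rewrite total_sub -zE -zE' /cochain_pair /chain_pair.
  rewrite -[(psi - psi') c]/(psi c - psi' c) -[(chi - chi') e]/(chi e - chi' e).
  by case: ifP => _; case: ifP => _; ring.
Qed.

Lemma chain_pair0 c e : chain_pair T 0 c e = 0.
Proof. by rewrite /chain_pair; case: ifP. Qed.

Lemma cochain_pair0 c e : cochain_pair o 0 c e = 0.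
Proof. by rewrite /cochain_pair; case: ifP => // _; rewrite mul0r. Qed.

Lemma dual_rel_total psi : psi \in pe_cocycles o k ->
  exists2 chi, chi \in pe_cycles o m & dual_rel psi chi.
Proof.
move=> /asboolP[psiP dpsi]; have [pp pm] := pe_cochain_pair o psiP.
have dc c e : total (cochain_pair o psi) c e = 0.
  by rewrite total_cochain /cochain_pair dpsi mul0r if_same.
have [||z [chi [pz zm chiP E]]] := face_reduction (P := d) pp pm.
- by move=> c e _; exact: dim_max.
- by move=> c e _; rewrite dc.
exists chi; last by exists z; split=> // c e; rewrite -E subKr.
apply/asboolP; split=> // f; apply: (congr1 (fun h : set V -> int => h f) (y := 0)).
apply: chain_pair_inj => [c ncc|c e]; first exact: boundary_cell.
rewrite chain_pair0 -total_chain -[RHS](dc c e) -[RHS](total_sub_total _ z).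
by apply: eq_total => c' e'; rewrite E.
Qed.

Lemma dual_rel_onto chi : chi \in pe_cycles o m ->
  exists2 psi, psi \in pe_cocycles o k & dual_rel psi chi.
Proof.
move=> /asboolP[chiP dchi]; have [pp pm] := pe_chain_pair o chiP.
have dc c e : total (chain_pair T chi) c e = 0.
  by rewrite total_chain /chain_pair dchi if_same.
have [|||z [psi [pz zm psiP E]]] := coface_reduction (n := d.+1) (P := 0%N) _ pp pm.
- by rewrite add0n.
- by [].
- by move=> c e _; rewrite dc.
have km : d%:Z - m = k by rewrite /m; lia.
rewrite km in psiP.
exists psi; last first.
  exists (fun c e => 0 - z c e); split.
  - by apply: pe_pairs_sub => //; exists 0%N.
  - by apply: of_degree_sub => // c e /eqP.
  - move=> c e; by rewrite total_sub -E total0 sub0r addrAC subrr add0r.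
apply/asboolP; split=> // f; apply: (congr1 (fun h : set V -> int => h f) (y := 0)).
apply: cochain_pair_inj => [c ncc|c e]; first exact: coboundary_cell.
rewrite cochain_pair0 -total_cochain -[RHS](dc c e) -[RHS](total_sub_total _ z).
by apply: eq_total => c' e'; rewrite E.
Qed.

Lemma dual_rel_coboundary psi : psi \in pe_coboundaries o k -> dual_rel psi 0.
Proof.
move=> /asboolP[phi phiP ->]; have [pp pm] := pe_cochain_pair o phiP.
exists (cochain_pair o phi); split=> // [|c e].
  by rewrite (_ : m + 1 = d%:Z - (k - 1)) // /m; lia.
by rewrite chain_pair0 subr0 total_cochain.
Qed.

Lemma dual_rel_boundary chi : chi \in pe_boundaries o m -> dual_rel 0 (- chi).
Proof.
move=> /asboolP[xi xiP ->]; have [pp pm] := pe_chain_pair o xiP.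
exists (chain_pair T xi); split=> // c e.
rewrite cochain_pair0 sub0r total_chain /chain_pair.
by case: ifP => _; rewrite ?oppr0// opprK.
Qed.

Lemma boundary_dual_rel chi : chi \in pe_chains T m -> dual_rel 0 (- chi) ->
  chi \in pe_boundaries o m.
Proof.
move=> chiP [z [pz zm zE]].
have dz c e : total z c e = chain_pair T chi c e.
  rewrite -zE cochain_pair0 sub0r /chain_pair.
  by case: ifP => _; rewrite ?oppr0// -[(- chi) e]/(- chi e) opprK.
have [||z' [xi [_ _ xiP E]]] := face_reduction (P := d) pz zm.
- by move=> c e _; exact: dim_max.
- by move=> c e c0; rewrite dz /chain_pair asboolF// => -[_ h]; rewrite h in c0.
apply/asboolP; exists xi => //; apply: chain_pair_inj => [c ncc|c e].
  by rewrite (pe_chains_cell chiP ncc) boundary_cell.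
rewrite -dz -total_chain -(total_sub_total _ z').
by apply: eq_total => c' e'; rewrite E.
Qed.

Lemma coboundary_dual_rel psi : psi \in pe_chains T k -> dual_rel psi 0 ->
  psi \in pe_coboundaries o k.
Proof.
move=> psiP [z [pz zm zE]].
have dz c e : total z c e = cochain_pair o psi c e by rewrite -zE chain_pair0 subr0.
have [|||z' [phi [_ _ phiP E]]] := coface_reduction (n := d.+1) (P := 0%N) _ pz zm.
- by rewrite add0n.
- by [].
- move=> c e de; rewrite dz /cochain_pair (_ : sigma e = 0) ?mulr0 ?if_same//.
  by rewrite /tsigma ifN// neq_ltn de.
have km : d%:Z - (m + 1) = k - 1 by rewrite /m; lia.
rewrite km in phiP.
apply/asboolP; exists phi => //; apply: cochain_pair_inj => [c ncc|c e].
  by rewrite (pe_chains_cell psiP ncc) coboundary_cell.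
rewrite -dz -total_cochain -(total_sub_total _ z').
by apply: eq_total => c' e'; rewrite E.
Qed.

(** If one side bounds, subtracting its primitive relates the other side to 0, and a reduction
    replaces the primitive in the total complex by a pattern-equivariant cochain or chain. *)
Lemma dual_rel_bound psi chi : psi \in pe_cocycles o k -> chi \in pe_cycles o m ->
  dual_rel psi chi -> (psi \in pe_coboundaries o k) = (chi \in pe_boundaries o m).
Proof.
move=> /asboolP[psiP _] /asboolP[chiP _] rel; apply/idP/idP => [h|h].
  apply: boundary_dual_rel => //.
  by have := dual_rel_sub (dual_rel_coboundary h) rel; rewrite subrr sub0r.
apply: coboundary_dual_rel => //.
(* Subtracting [rel] from itself relates 0 to 0, which serves to reverse the sign in
   [dual_rel_boundary] before subtracting from [rel]. *)
have := dual_rel_sub (dual_rel_sub rel rel) (dual_rel_boundary h).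
rewrite !subrr opprK add0r => /(dual_rel_sub rel).
by rewrite subr0 subrr.
Qed.

End Duality.

Theorem theorem2p2 (R : realType) (d : nat) (L : Type)
    (T : polytopal_tiling R d L) (o : orientation T) (hFLC : FLC T) (k : int) :
  exists phi : {additive pe_cohomology o k -> pe_homology o (d%:Z - k)},
    bijective phi.
Proof.
apply: (@subquotient_iso _ _ _ _ _ _ (dual_rel o k)).
- exact: dual_rel_total.
- exact: dual_rel_onto.
- exact: dual_rel_sub.
- exact: dual_rel_bound.
Qed.
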